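(* Let $(M,F,\mathsf m)$ be a complete Finsler manifold endowed with a smooth measure $\mathsf m$, with $r_F<\infty$, and let $\Omega\subset M$ be an open set. Let $\rho\in W^{1,2}_{\mathrm{loc}}(\Omega)$ be a nonnegative function such that $\boldsymbol\Delta\rho\ge0$ on $\Omega$ in weak sense. If $q>-1$ is such that $\rho^qF^{*2}(D\rho)\in L^1_{\mathrm{loc}}(\Omega)$ and $\rho^{2+q}\in L^1_{\mathrm{loc}}(\Omega)$, then $$\frac{(1+q)^2}{4r_F^2}\int_\Omega\rho^qF^{*2}(x,D\rho)\,u^2\,\mathrm d\mathsf m\le\int_\Omega\rho^{2+q}F^2(x,\boldsymbol\nabla u)\,\mathrm d\mathsf m\quad\text{for all }u\in C_0^\infty(\Omega).$$
   Context: A Finsler manifold $(M,F)$ is a connected $n$-dimensional smooth manifold $M$ with a continuous $F:TM\to[0,\infty)$ (Finsler structure) that is $C^\infty$ on $TM\setminus\{0\}$, satisfies $F(x,\lambda y)=\lambda F(x,y)$ for all $\lambda\ge0$ (not necessarily reversible), and has positive definite Hessian $g_{ij}(x,y)=[\frac12F^2(x,y)]_{y^iy^j}$ for all $(x,y)\in TM\setminus\{0\}$. It is complete if every geodesic $\gamma:[a,b]\to M$ (i.e. $D_{\dot\gamma}\dot\gamma=0$ for the Chern connection) extends to a geodesic on $[a,\infty)$ and to a geodesic on $(-\infty,b]$. $\mathsf m$ is a smooth measure, i.e. $\mathrm d\mathsf m=\sigma_F\,dx^1\wedge\dots\wedge dx^n$ in local coordinates with smooth positive density. Reversibility constant: $r_F=\sup_{x\in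 M}\sup_{y\in T_xM\setminus\{0\}}F(x,y)/F(x,-y)$. Polar transform: $F^*(x,\alpha)=\sup\{\alpha(y):y\in T_xM,\ F(x,y)=1\}$ for $\alpha\in T_x^*M$. Legendre transform: $J^*(x,\alpha)$ is the unique maximizer $y\in T_xM$ of $y\mapsto\alpha(y)-\frac12F^2(x,y)$. $Du$ is the (weak) differential of $u$ and the gradient is $\boldsymbol\nabla u(x)=J^*(x,Du(x))$; one has $F(x,\boldsymbol\nabla u)=F^*(x,Du)$. The Finsler-Laplacian is $\boldsymbol\Delta\rho=\mathrm{div}(\boldsymbol\nabla\rho)$ in the distributional sense; $\boldsymbol\Delta\rho\ge0$ in weak sense means $\int_\Omega D\varphi(\boldsymbol\nabla\rho)\,\mathrm d\mathsf m\le0$ for every nonnegative $\varphi\in C_0^\infty(\Omega)$ (smooth, compactly supported in $\Omega$). Convention: $\rho^qF^{*2}(D\rho)$ is read as $0$ where $\rho=0$ and $D\rho=0$ (one has $D\rho=0$ a.e. on $\{\rho=0\}$). *)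

(* Defs.v *)
From HB Require Import structures.
From mathcomp Require Import all_boot all_order all_algebra.
From mathcomp Require Import all_classical all_reals all_analysis.
Set Implicit Arguments.
Unset Strict Implicit.
Unset Printing Implicit Defensive.
Import Order.TTheory GRing.Theory Num.Theory.
Import numFieldNormedType.Exports.
Local Open Scope classical_set_scope.
Local Open Scope ring_scope.

Notation borel T := (g_sigma_algebraType (@open T)).

Definition tsupport (R : realType) (T : topologicalType) (f : T -> R) : set T :=
  closure [set x | f x != 0].

(** ** Calculus on R^n, points being row vectors *)

Section euclidean.
Context {R : realType} {n : nat}.
Implicit Types (U : set 'rV[R]_n) (f : 'rV[R]_n -> R).

Definition partial (i : 'I_n) f : 'rV[R]_n -> R :=
  fun p => 'D_(delta_mx 0 i) f p.

Definition partials (s : seq 'I_n) f : 'rV[R]_n -> R := foldr partial f s.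

(** For [U] open: partial derivatives of all orders exist and are continuous. *)
Definition smooth_on U f : Prop := forall (s : seq 'I_n) p, U p ->
  {for p, continuous (partials s f)} /\
  forall i, derivable (partials s f) p (delta_mx 0 i).

Definition test_function U f : Prop :=
  [/\ smooth_on setT f, compact (tsupport f) & tsupport f `<=` U].

End euclidean.

(** [n]-dimensional Lebesgue measure on Borel sets, slicing along the first
    coordinate (Tonelli); in dimension 0 it is the Dirac mass. *)
Fixpoint lebesgue_rV (R : realType) (n : nat) :
    set (borel 'rV[R]_n) -> \bar R :=
  match n with
  | 0%N => fun A => \d_(0 : borel 'rV[R]_0) A
  | k.+1 => fun A => (\int[lebesgue_measure]_t
      lebesgue_rV [set v : borel 'rV[R]_k |
        A (row_mx (t%:M : 'rV[R]_1) (v : 'rV[R]_k))])%E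
  end.
Arguments lebesgue_rV R n : clear implicits.

Definition L1loc (R : realType) (T : ptopologicalType)
    (mu : set (borel T) -> \bar R) (U : set T) (f : T -> R) : Prop :=
  forall K : set T, compact K -> K `<=` U ->
    integrable mu (K : set (borel T)) (EFin \o f).

(** [f] is in [W^{1,2}_loc(U)] for [U] open in R^n, and the column [a p] lists
    its weak partial derivatives at [p]. *)
Definition W12loc_rV (R : realType) (n : nat) (U : set 'rV[R]_n)
    (f : 'rV[R]_n -> R) (a : 'rV[R]_n -> 'cV[R]_n) : Prop :=
  let lambda := lebesgue_rV R n in
  [/\ measurable_fun (U : set (borel 'rV[R]_n)) f,
      L1loc lambda U (fun p => f p ^+ 2)
    & forall i,
      [/\ measurable_fun (U : set (borel 'rV[R]_n)) (fun p => a p i 0),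
          L1loc lambda U (fun p => a p i 0 ^+ 2)
        & forall psi, test_function U psi ->
          (\int[lambda]_(p in U) (f p * partial i psi p)%:E =
           - \int[lambda]_(p in U) (a p i 0 * psi p)%:E)%E]].

(** ** Smooth manifolds *)

(** [cinv] is only meaningful on the image of [cdom]. *)
Record chart (R : realType) (n : nat) (T : topologicalType) := Chart {
  cdom : set T;
  cmap : T -> 'rV[R]_n;
  cinv : 'rV[R]_n -> T }.

Definition cimage (R : realType) n (T : topologicalType) (c : chart R n T) :
  set 'rV[R]_n := cmap c @` cdom c.

Definition is_chart (R : realType) n (T : topologicalType) (c : chart R n T) :=
  [/\ open (cdom c), open (cimage c),
      {within cdom c, continuous (cmap c)},
      {within cimage c, continuous (cinv c)}
    & forall x, cdom c x -> cinv c (cmap c x) = x].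

Definition transition (R : realType) n (T : topologicalType)
  (c c' : chart R n T) : 'rV[R]_n -> 'rV[R]_n := cmap c' \o cinv c.

Definition smooth_transition (R : realType) n (T : topologicalType)
    (c c' : chart R n T) : Prop :=
  forall j, smooth_on (cmap c @` (cdom c `&` cdom c'))
                      (fun p => transition c c' p 0 j).

(** The preferred chart [chart_at x] only fixes the coordinates in which tangent
    vectors at [x] are written; the smooth structure is that of [atlas]. *)
Record manifold (R : realType) (n : nat) := Manifold {
  carrier :> ptopologicalType;
  atlas : set (chart R n carrier);
  chart_at : carrier -> chart R n carrier;
  manifold_hausdorff : hausdorff_space carrier;
  manifold_second_countable : @second_countable carrier;
  atlas_chart : forall c, atlas c -> is_chart c;
  atlas_smooth : forall c c', atlas c -> atlas c' -> smooth_transition c c';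
  chart_at_atlas : forall x, atlas (chart_at x);
  chart_at_dom : forall x, cdom (chart_at x) x }.

Section tangent_bundle.
Context {R : realType} {n : nat} {M : manifold R n}.
Implicit Types (c : chart R n M) (x : M) (p y : 'rV[R]_n).

(** Tangent vectors at [x] are given by their coordinates (a row) in
    [chart_at x], covectors by their coordinates (a column). *)
Definition tangent (x : M) : Type := 'rV[R]_n.
Definition cotangent (x : M) : Type := 'cV[R]_n.

Definition pairing x (alpha : cotangent x) (y : tangent x) : R :=
  ((y : 'rV[R]_n) *m (alpha : 'cV[R]_n)) 0 0.

(** Jacobian at [p] of the change of coordinates from [c] to the preferred
    chart at the point [cinv c p]; it acts on rows from the right. *)
Definition to_preferred c p : 'M[R]_n :=
  jacobian (transition c (chart_at (cinv c p))) p.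

(** The tangent vector at [cinv c p] with coordinates [y] in the chart [c]. *)
Definition tangent_of c p y : tangent (cinv c p) := y *m to_preferred c p.

(** The coordinates in the chart [c] of a field of covectors. *)
Definition covector_in c (alpha : forall x, cotangent x) p : 'cV[R]_n :=
  to_preferred c p *m (alpha (cinv c p) : 'cV[R]_n).

Definition differential (u : M -> R) x : cotangent x :=
  \col_i partial i (u \o cinv (chart_at x)) (cmap (chart_at x) x).

Definition smooth_fun (u : M -> R) : Prop :=
  forall c, atlas c -> smooth_on (cimage c) (u \o cinv c).

(** [C_0^oo(Omega)], functions being extended by 0 outside [Omega]. *)
Definition C0infty (Omega : set M) (u : M -> R) : Prop :=
  [/\ smooth_fun u, compact (tsupport u) & tsupport u `<=` Omega].

(** [rho] is in [W^{1,2}_loc(Omega)] and [Drho] is (a version of) its weak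
    differential. *)
Definition W12loc (Omega : set M) (rho : M -> R)
    (Drho : forall x, cotangent x) : Prop :=
  forall c, atlas c ->
    W12loc_rV (cmap c @` (cdom c `&` Omega)) (rho \o cinv c)
              (covector_in c Drho).

Definition smooth_measure (m : {measure set (borel M) -> \bar R}) : Prop :=
  forall c, atlas c -> exists sigma : 'rV[R]_n -> R,
    [/\ smooth_on (cimage c) sigma,
        forall p, cimage c p -> 0 < sigma p
      & forall A : set (borel M), measurable A -> A `<=` cdom c ->
          m A = (\int[lebesgue_rV R n]_(p in cmap c @` A) (sigma p)%:E)%E].

End tangent_bundle.

(** ** Chern connection of a function [L p y] on an open subset of TR^n *)

Section chern.
Context {R : realType} {n : nat} (L : 'rV[R]_n -> 'rV[R]_n -> R).
Implicit Types (p y v w : 'rV[R]_n) (i j k l r s : 'I_n).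

(** The fundamental tensor g_ij. *)
Definition fund p y : 'M[R]_n :=
  \matrix_(i, j) partial i (partial j (fun z => L p z ^+ 2 / 2)) y.

Definition pos_def (g : 'M[R]_n) : Prop :=
  forall v, v != 0 -> 0 < (v *m g *m v^T) 0 0.

Definition dx k (f : 'rV[R]_n -> 'rV[R]_n -> R) p y : R :=
  partial k (fun q => f q y) p.
Definition dy k (f : 'rV[R]_n -> 'rV[R]_n -> R) p y : R :=
  partial k (f p) y.

(** 1/2 g^{is} (d_k g_sj - d_s g_jk + d_j g_ks), for derivations [d]. *)
Definition christoffel_for
    (d : 'I_n -> ('rV[R]_n -> 'rV[R]_n -> R) -> 'rV[R]_n -> 'rV[R]_n -> R)
    p y i j k : R :=
  let dg k i j := d k (fun q z => fund q z i j) p y in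
  2^-1 * \sum_s invmx (fund p y) i s * (dg k s j - dg s j k + dg j k s).

(** Formal Christoffel symbols, gamma^i_jk. *)
Definition formal_christoffel p y i j k : R := christoffel_for dx p y i j k.

(** C^i_jk = g^{is} C_sjk, where C_sjk = 1/2 dg_sj/dy^k. *)
Definition cartan p y i j k : R :=
  \sum_s invmx (fund p y) i s * (dy k (fun q z => fund q z s j) p y / 2).

(** N^i_j = gamma^i_jk y^k - C^i_jk gamma^k_rs y^r y^s. *)
Definition nonlinear_connection p y i j : R :=
  \sum_k formal_christoffel p y i j k * y 0 k
  - \sum_k \sum_r \sum_s
      cartan p y i j k * formal_christoffel p y k r s * y 0 r * y 0 s.

(** delta/delta x^k = d/dx^k - N^r_k d/dy^r. *)
Definition horizontal k (f : 'rV[R]_n -> 'rV[R]_n -> R) p y : R :=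
  dx k f p y - \sum_r nonlinear_connection p y r k * dy r f p y.

(** The coefficients Gamma^i_jk of the Chern connection. *)
Definition chern p y i j k : R := christoffel_for horizontal p y i j k.

(** D_V V with reference vector V, for a curve through [p] whose velocity V has
    coordinates [v], the derivative of [v] being [w]. *)
Definition covariant_acceleration p v w : 'rV[R]_n :=
  \row_i (w 0 i + \sum_j \sum_k chern p v i j k * v 0 j * v 0 k).

End chern.

(** ** Finsler manifolds *)

(** One-sided at the endpoints of an interval [I]. *)
Definition is_derive_within (R : realType) n (I : set R) (f : R -> 'rV[R]_n)
    (t : R) (l : 'rV[R]_n) : Prop :=
  (fun s => (s - t)^-1 *: (f s - f t)) @ within (I `\ t) (nbhs t) --> l.

Section finsler.
Context {R : realType} {n : nat} {M : manifold R n}.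
Variable F : forall x : M, tangent x -> R.
Implicit Types (x : M) (c : chart R n M) (Omega : set M).

(** [F] in the coordinates that the chart [c] induces on TM. *)
Definition F_in c (p y : 'rV[R]_n) : R := F (tangent_of c p y).

Definition finsler_structure : Prop :=
  [/\ forall x (y : tangent x), 0 <= F y,
      forall c, atlas c ->
        {within [set z : 'rV[R]_(n + n) | cimage c (lsubmx z)],
          continuous (fun z => F_in c (lsubmx z) (rsubmx z))},
      forall c, atlas c ->
        smooth_on [set z : 'rV[R]_(n + n) |
                    cimage c (lsubmx z) /\ rsubmx z != 0]
                  (fun z => F_in c (lsubmx z) (rsubmx z)),
      forall x (y : tangent x) (k : R), 0 <= k ->
        F (k *: (y : 'rV[R]_n) : tangent x) = k * F y
    & forall c, atlas c -> forall p y, cimage c p -> y != 0 ->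
        pos_def (fund (F_in c) p y)].

(** D_{g'} g' = 0 in every chart, for [I] an interval which is not a point.
    Where the velocity vanishes, the equation reads g'' = 0, so that constant
    curves are geodesics. *)
Definition geodesic_on (I : set R) (g : R -> M) : Prop :=
  {within I, continuous g} /\
  forall c, atlas c -> exists v w : R -> 'rV[R]_n,
    forall t, I t -> cdom c (g t) ->
    [/\ is_derive_within I (cmap c \o g) t (v t),
        is_derive_within I v t (w t)
      & covariant_acceleration (F_in c) (cmap c (g t)) (v t) (w t) = 0].

Definition finsler_complete : Prop :=
  forall (a b : R) (g : R -> M), a < b -> geodesic_on `[a, b] g ->
    (exists2 h, geodesic_on `[a, +oo[ h & {in `[a, b], h =1 g}) /\
    (exists2 h, geodesic_on `]-oo, b] h & {in `[a, b], h =1 g}).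

Definition reversibility : \bar R :=
  ereal_sup [set r | exists x (y : tangent x),
    (y : 'rV[R]_n) != 0 /\
    r = (F y / F (- (y : 'rV[R]_n) : tangent x))%:E].

Definition polar x (alpha : cotangent x) : R :=
  sup [set pairing alpha y | y in [set y : tangent x | F y = 1]].

Definition legendre x (alpha : cotangent x) : tangent x :=
  xget (0 : 'rV[R]_n)
    [set y : 'rV[R]_n | forall z : 'rV[R]_n, z <> y ->
      pairing alpha (z : tangent x) - F (z : tangent x) ^+ 2 / 2 <
      pairing alpha (y : tangent x) - F (y : tangent x) ^+ 2 / 2].

(** The gradient of a function with differential [Du]. *)
Definition gradient (Du : forall x, cotangent x) x : tangent x :=
  legendre (Du x).

(** The Finsler-Laplacian of a function with weak differential [Drho] is
    nonnegative on [Omega] in weak sense. *)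
Definition laplacian_ge0 (m : {measure set (borel M) -> \bar R}) Omega
    (Drho : forall x, cotangent x) : Prop :=
  forall phi : M -> R, C0infty Omega phi -> (forall x, 0 <= phi x) ->
    (\int[m]_(x in (Omega : set (borel M)))
       (pairing (differential phi x) (gradient Drho x))%:E <= 0)%E.

End finsler.

(* Main.v *)
(** In a chart, the weak inequality is tested against [w * g rho], where [w >= 0]
    is a test function and [g] a bounded increasing function on the half-line; this
    is legitimate after mollifying [rho]. Writing [u ^ 2] as a finite sum of such [w]
    supported in charts gives
      int 2 u g(rho) Du(grad rho) + u^2 g'(rho) F*(Drho)^2 <= 0.
    Since Du(grad rho) is bounded by F*(Du) F*(Drho) up to the sign, which costs a
    factor [r_F], the inequality 2 x y <= x^2 / 2 + 2 y^2 turns this into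
      1/2 int u^2 g'(rho) F*(Drho)^2 <= 2 r_F^2 int (g^2 / g')(rho) F*(Du)^2.
    Finally [g] runs through truncations of t^(1+q) / (1+q) for which
    g^2 / g' = (t + d)^(2+q) / (1+q)^2, and d -> 0 by dominated convergence. *)
Require Import Defs.
From HB Require Import structures.
From mathcomp Require Import all_boot all_order all_algebra.
From mathcomp Require Import all_classical all_reals all_analysis.
From mathcomp Require Import measurable_realfun ring lra.
Import Order.TTheory GRing.Theory Num.Theory.
Import numFieldNormedType.Exports.
Local Open Scope classical_set_scope.
Local Open Scope ring_scope.
Set Implicit Arguments.
Unset Strict Implicit.
Unset Printing Implicit Defensive.

(** * Smooth functions of several variables *)

(** The Legendre transform is nonlinear, so it is never applied to a mollified function: the
    gradient of rho, weighted by the density of the measure, is frozen as a vector field in L^2_loc,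
    and only the test function is regularised. That this field is measurable and locally square
    integrable rests on the joint continuity and the local bounds of the Legendre transform in the
    base point and the covector; this is the purpose of the study of families of Minkowski norms.
    The inequality obtained in a chart is linear in [w], hence survives summation over charts; the
    quadratic step comes only afterwards, pointwise on the manifold. The function [g] is a power
    followed by the map s -> s / (1 + d s), whose square divided by its derivative is s^2 whatever
    [d] is: it makes [g] bounded without disturbing g^2 / g'. The shift by [d] keeps the powers
    smooth where rho = 0, although q may be negative. The final constant is 1/2 divided by 2 r_F^2 /
    (1+q)^2. *)

Section continuously_differentiable.
Context {R : realType}.
Implicit Types (n : nat).

(** Directional derivatives become derivatives of functions of one real variable, for which the mean
    value theorem and the chain rule are available. *)
Lemma is_derive_lineP {V W : normedModType R} (f : V -> W) (a v : V) (t : R) (l : W) :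
  is_derive (a + t *: v) v f l <-> is_derive t 1 (fun s : R => f (a + s *: v)) l.
Proof.
suff E : (fun h : R => h^-1 *: (f (h *: v + (a + t *: v)) - f (a + t *: v))) =
    (fun h : R => h^-1 *: (f (a + (h *: 1 + t) *: v) - f (a + t *: v))).
  by split=> -[d <-]; split; rewrite /derivable /derive/= ?E// -?E.
apply/funext => h; congr (_ *: (f _ - _)).
by rewrite scalerDl addrCA [h *: 1]mulr1.
Qed.

Lemma is_derive_dirZ {V W : normedModType R} (f : V -> W) (a v : V) (c : R) (l : W) :
  is_derive a v f l -> is_derive a (c *: v) f (c *: l).
Proof.
have [->|c0] := eqVneq c 0.
  by rewrite !scale0r => _; exact: is_derive0.
move=> [fav <-].
(* The quotient along c v at h is c times the quotient along v at h c, and h c tends to 0 without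
   reaching it because c is nonzero. *)
suff : (fun h : R => h^-1 *: (f (h *: (c *: v) + a) - f a)) @ 0^' --> c *: 'D_v f a.
  by move=> H; split; [apply/cvg_ex; exists (c *: 'D_v f a)|exact/cvg_lim].
have E : (fun h : R => h^-1 *: (f (h *: (c *: v) + a) - f a)) =
    (fun h => c *: h) \o ((fun h : R => h^-1 *: (f (h *: v + a) - f a)) \o (fun h => h * c)).
  apply/funext => h /=; rewrite !scalerA invfM mulrCA mulfV// mulr1.
  by [].
suff Hc : (fun h : R => h * c) @ 0^' --> 0^'.
  have H1 := cvg_comp _ _ Hc fav.
  have H2 := cvg_comp _ _ H1 (@scaler_continuous R W c _).
  by rewrite E; apply: H2.
move=> A [e/= e0 eA]; exists (e / `|c|); first by rewrite /= divr_gt0// normr_gt0.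
move=> h /=; rewrite !sub0r !normrN => hc h0; apply: eA; rewrite /= ?sub0r ?normrN.
  by rewrite normrM -ltr_pdivlMr// normr_gt0.
by rewrite mulf_neq0.
Qed.

Lemma mean_value_line {V : normedModType R} (f : V -> R) (a v : V) :
  (forall t : R, 0 <= t <= 1 -> derivable f (a + t *: v) v) ->
  exists2 c : R, 0 <= c <= 1 & f (a + v) - f a = 'D_v f (a + c *: v).
Proof.
move=> dfv.
have H (t : R) : 0 <= t <= 1 -> is_derive t 1 (fun s : R => f (a + s *: v)) ('D_v f (a + t *: v)).
  by move=> /dfv/derivableP/is_derive_lineP.
have [|||c c01] := @MVT_segment R (fun s => f (a + s *: v)) (fun t => 'D_v f (a + t *: v)) 0 1.
- by [].
- by move=> x; rewrite in_itv/= => /andP[x0 x1]; apply: H; rewrite !ltW.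
- apply: derivable_within_continuous => x; rewrite in_itv/= => x01.
  by have [] := H x x01.
rewrite scale1r scale0r addr0 subr0 mulr1 => E; exists c => //.
Qed.

Lemma continuous_sumR {T : topologicalType} n (h : 'I_n -> T -> R) p :
  (forall i, {for p, continuous (h i)}) ->
  {for p, continuous (fun x => \sum_(i < n) h i x)}.
Proof.
move=> ch; apply: cvg_big => [|i _]; last exact: ch.
exact: add_continuous.
Qed.

(** The increment is cut into steps parallel to the axes; the mean value theorem turns each into a
    partial derivative at a nearby point, and continuity of the partials replaces that point by
    [p]. *)
Lemma differentiable_of_partials n (f : 'rV[R]_n -> R) p :
  (\forall q \near p, forall i, derivable f q (delta_mx 0 i)) ->
  (forall i, {for p, continuous (partial i f)}) ->
  differentiable f p.
Proof.
move=> df cf.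
pose L (v : 'rV[R]_n) : R := \sum_i v 0 i * partial i f p.
have lL : linear L.
  move=> a u v; rewrite /L scaler_sumr -big_split/=; apply: eq_bigr => i _.
  by rewrite !mxE scalerAl -mulrDl.
have [L' L'E] : exists L' : {linear 'rV[R]_n -> R}, forall v, L' v = L v.
  by exists (HB.pack L (GRing.isLinear.Build _ _ _ _ _ lL) : {linear 'rV[R]_n -> R}).
have cL : continuous L'.
  have -> : (L' : 'rV[R]_n -> R) = L by apply/funext.
  move=> v; apply: continuous_sumR => i.
  apply: (@continuousM R _ (fun x : 'rV[R]_n => x 0 i) (cst (partial i f p))).
    exact: coord_continuous.
  exact: cst_continuous.
suff E : f \o shift p = cst (f p) + L' +o_ 0 id.
  apply/diff_locallyP; split.
    by rewrite (diff_unique cL E).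
  by rewrite (diff_unique cL E).
apply/eqaddoP => _/posnumP[e].
(* There are [n] steps to share the error; dividing by n + 1 also covers n = 0. *)
pose e' := e%:num / n.+1%:R.
have e'0 : 0 < e' by rewrite divr_gt0.
have /nbhs_ballP[d /= d0 dP] : \forall q \near p, forall i,
    derivable f q (delta_mx 0 i) /\ `|partial i f q - partial i f p| <= e'.
  have cn : \forall q \near nbhs p, forall i : 'I_n, `|partial i f q - partial i f p| <= e'.
    apply: filter_forall => j.
    have /(@cvgrPdist_le R R 'rV[R]_n (nbhs p) (nbhs_filter p))/(_ _ e'0) := cf j.
    apply: filterS => q.
    by rewrite distrC.
  by near=> q; move=> i; split; [move: i; near: q|move: i; near: q].
near=> h.
have hd : `|h| < d.
  near: h; apply/nbhs_ballP; exists d => //= y.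
  by rewrite -ball_normE/= sub0r normrN.
(* These are the corners of the axis-parallel path from [p] to p + h. As the norm is the sup norm,
   no point of the path is farther from [p] than |h|. *)
pose tr k : 'rV[R]_n := \row_i (if (i < k)%N then h 0 i else 0).
have trn : tr n = h by apply/rowP => i; rewrite !mxE ltn_ord.
have tr0 : tr 0%N = 0 by apply/rowP => i; rewrite !mxE.
have step (k : 'I_n) : tr k.+1 = tr k + h 0 k *: delta_mx 0 k.
  apply/rowP => i; rewrite !mxE/= ltnS leq_eqVlt.
  have [->|ik] := eqVneq i k; first by rewrite eqxx/= ltnn add0r mulr1.
  by rewrite (negbTE (ik : i != k :> nat))/= mulr0 addr0.
have bound k t : (k < n)%N -> 0 <= t <= 1 ->
   forall i : 'I_n, k = i -> ball p d (p + tr k + t *: (h 0 i *: delta_mx 0 i)).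
  move=> kn /andP[t0 t1] i ki; rewrite -ball_normE/= -addrA opprD addNKr normrN.
  apply: le_lt_trans hd.
  rewrite [leLHS]/Num.norm/= mx_normrE; apply: bigmax_le => // -[u j] _ /=.
  rewrite !mxE (ord1 u) ?eqxx/=.
  have hj : `|h 0 j| <= `|h|.
    by rewrite [leRHS]/Num.norm/= mx_normrE; apply: (le_bigmax _ (fun ij => `|h ij.1 ij.2|) (0, j)).
  rewrite ki; have [->|ji] := eqVneq j i.
    rewrite ltnn add0r mulr1 normrM (ger0_norm t0).
    rewrite -[leRHS]mul1r ler_pM//.
    by rewrite [leRHS]/Num.norm/= mx_normrE; apply: (le_bigmax _ (fun ij => `|h ij.1 ij.2|) (0, i)).
  by rewrite !mulr0 addr0; case: ifP => _ //; rewrite normr0.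
have tele : f (h + p) - f p = \sum_(i < n) (f (p + tr i.+1) - f (p + tr i)).
  rewrite -(big_mkord xpredT (fun i => f (p + tr i.+1) - f (p + tr i))).
  rewrite (telescope_sumr (fun i => f (p + tr i)))// trn tr0 addr0.
  by rewrite (addrC p h).
have -> : (f \o shift p - (cst (f p) + L')) h = 
    \sum_(i < n) (f (p + tr i.+1) - f (p + tr i) - h 0 i * partial i f p).
  rewrite sumrB -tele /L/=.
  transitivity (f (h + p) - (f p + L h)); first by rewrite -L'E.
  by rewrite opprD addrA.
apply: (@le_trans _ _ (\sum_(i < n) (e' * `|h|))).
  apply: le_trans (ler_norm_sum _ _ _) _; apply: ler_sum => i _.
  have B t : 0 <= t <= 1 -> _ := fun t01 => dP _ (bound i t (ltn_ord i) t01 i erefl) i.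
  have [|c c01] := @mean_value_line _ f (p + tr i) (h 0 i *: delta_mx 0 i).
    move=> t /B[/derivableP Dt _].
    by have [] := is_derive_dirZ (h 0 i) Dt.
  rewrite -addrA -step => ->; have [/derivableP Dt] := B _ c01.
  have [_ ->] := is_derive_dirZ (h 0 i) Dt.
  rewrite -/(partial i f _) => Hle.
  rewrite [_ *: _]/(_ * _) -mulrBr normrM mulrC ler_pM//.
  by rewrite [leRHS]/Num.norm/= mx_normrE; apply: (le_bigmax _ (fun ij => `|h ij.1 ij.2|) (0, i)).
rewrite sumr_const card_ord -mulr_natr mulrAC ler_wpM2r// /e' mulrAC ler_pdivrMr//.
by rewrite ler_wpM2l// ler_nat.
Unshelve. all: by end_near. Qed.

Lemma diff_partial n (f : 'rV[R]_n -> R) p v : differentiable f p ->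
  'd f p v = \sum_i v 0 i * partial i f p.
Proof.
move=> df; rewrite [in LHS](row_sum_delta v) linear_sum/=; apply: eq_bigr => i _.
by rewrite linearZ/= -deriveE.
Qed.

Lemma differentiable_rowP n k (f : 'rV[R]_n -> 'rV[R]_k) p :
  (forall j, differentiable (fun q => f q 0 j) p) -> differentiable f p.
Proof.
move=> df.
have -> : f = \sum_(j < k) (fun q => f q 0 j *: (delta_mx 0 j : 'rV[R]_k)).
  by apply/funext => q; rewrite fct_sumE {1}(row_sum_delta (f q)).
apply: differentiable_sum => j.
exact: differentiableZl.
Qed.

Lemma jacobian_partial n k (f : 'rV[R]_n -> 'rV[R]_k) p i j :
  differentiable f p -> jacobian f p i j = partial i (fun q => f q 0 j) p.
Proof.
move=> df; rewrite /jacobian mxE -deriveE//.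
have Df : derivable f p (delta_mx 0 i) by exact: diff_derivable.
apply/esym/cvg_lim => //.
have := @cvg_comp _ _ _ _ _ _ _ _ Df (@coord_continuous R 1 k 0 j _).
by apply: cvg_trans; apply: near_eq_cvg; near=> h => /=; rewrite !mxE.
Unshelve. all: by end_near. Qed.

End continuously_differentiable.

Section smooth_functions.
Context {R : realType}.

(** An inductive predicate, so that a derivative inside the same algebra can be constructed along
    the way a function is built. *)
Inductive algebra_of {n} (G : set ('rV[R]_n -> R)) : set ('rV[R]_n -> R) :=
| algebra_cst c : algebra_of G (fun=> c)
| algebra_gen h : G h -> algebra_of G h
| algebra_add h k : algebra_of G h -> algebra_of G k ->
    algebra_of G (fun p => h p + k p)
| algebra_mul h k : algebra_of G h -> algebra_of G k ->
    algebra_of G (fun p => h p * k p).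

Lemma algebra_sum n (G : set ('rV[R]_n -> R)) k (h : 'I_k -> 'rV[R]_n -> R) :
  (forall j, algebra_of G (h j)) -> algebra_of G (fun p => \sum_(j < k) h j p).
Proof.
move=> hG; have : forall r : seq 'I_k, algebra_of G (fun p => \sum_(j <- r) h j p).
  elim=> [|a r IH].
    have -> : (fun p => \sum_(j <- [::]) h j p) = (fun=> 0).
      by apply/funext => p; rewrite big_nil.
    exact: algebra_cst.
  have -> : (fun p => \sum_(j <- (a :: r)) h j p) =
     (fun p => h a p + \sum_(j <- r) h j p).
    by apply/funext => p; rewrite big_cons.
  exact: algebra_add.
exact.
Qed.

Lemma is_derive_near_eq {V W : normedModType R} (U : set V) (f g : V -> W) p v l :
  open U -> U p -> {in U, f =1 g} -> is_derive p v f l -> is_derive p v g l.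
Proof.
move=> oU Up fg; apply: near_eq_is_derive.
by near=> q; apply: fg; rewrite inE; near: q; exact: open_nbhs_nbhs.
Unshelve. all: by end_near. Qed.

Lemma continuous_near_eq {V : topologicalType} {W : topologicalType} (U : set V) (f g : V -> W) p :
  open U -> U p -> {in U, f =1 g} -> {for p, continuous f} -> {for p, continuous g}.
Proof.
move=> oU Up fg cf; rewrite /prop_for /continuous_at -fg ?inE//.
apply: cvg_trans cf; apply: near_eq_cvg.
by near=> q; apply: fg; rewrite inE; near: q; exact: open_nbhs_nbhs.
Unshelve. all: by end_near. Qed.

(* A class of functions whose partial derivatives stay in the algebra that it
   generates consists of smooth functions: no induction on the order is needed
   to differentiate products and composites. *)
Lemma algebra_smooth n (U : set 'rV[R]_n) (G : set ('rV[R]_n -> R)) : open U ->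
  (forall h, G h -> forall p, U p -> {for p, continuous h}) ->
  (forall h i, G h -> exists2 h', algebra_of G h' &
     forall p, U p -> is_derive p (delta_mx 0 i) h (h' p)) ->
  forall h, algebra_of G h -> smooth_on U h.
Proof.
move=> oU Gc Gd.
have Ac h : algebra_of G h -> forall p, U p -> {for p, continuous h}.
  elim => {h} [c|h /Gc//|h k _ IHh _ IHk|h k _ IHh _ IHk] p Up.
  - exact: cst_continuous.
  - by apply: (@continuousD R R^o _ h k); [exact: IHh|exact: IHk].
  - by apply: (@continuousM R _ h k); [exact: IHh|exact: IHk].
have Ad h i : algebra_of G h -> exists2 h', algebra_of G h' &
     forall p, U p -> is_derive p (delta_mx 0 i) h (h' p).
  elim => {h} [c|h /Gd//|h k Ah [h' Ah' dh] Ak [k' Ak' dk]|h k Ah [h' Ah' dh] Ak [k' Ak' dk]].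
  - by exists (fun=> 0); [exact: algebra_cst|move=> p _; exact: is_derive_cst].
  - exists (fun p => h' p + k' p); first exact: algebra_add.
    by move=> p Up; have := is_deriveD (dh p Up) (dk p Up).
  - exists (fun p => h p * k' p + k p * h' p).
      by apply: algebra_add; exact: algebra_mul.
    by move=> p Up; have := is_deriveM (dh p Up) (dk p Up).
move=> h Ah.
have H s : exists2 h', algebra_of G h' & {in U, partials s h =1 h'}.
  elim: s => [|i s [k Ak sk]]; first by exists h.
  have [k' Ak' dk] := Ad k i Ak; exists k' => // p; rewrite inE => Up /=.
  rewrite /partial.
  by have [_ <-] := is_derive_near_eq oU Up (fun q Uq => esym (sk q Uq)) (dk p Up).
move=> s p Up; have [k Ak sk] := H s; split.
  by apply: (@continuous_near_eq _ _ U k) => //; [move=> q /sk|exact: Ac].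
move=> i; have [k' Ak' dk] := Ad k i Ak.
by have [] := is_derive_near_eq oU Up (fun q Uq => esym (sk q Uq)) (dk p Up).
Qed.

Section smooth_on_theory.
Context {n : nat}.
Implicit Types (U V : set 'rV[R]_n) (f g : 'rV[R]_n -> R).

Lemma smooth_onS U V f : V `<=` U -> smooth_on U f -> smooth_on V f.
Proof. by move=> VU fU s p /VU/(fU s). Qed.

Lemma smooth_on_continuous U f p : smooth_on U f -> U p -> {for p, continuous f}.
Proof. by move=> fU /(fU [::])[]. Qed.

Lemma smooth_on_is_derive U f p i : smooth_on U f -> U p ->
  is_derive p (delta_mx 0 i) f (partial i f p).
Proof. by move=> fU /(fU [::])[_ /(_ i)/derivableP]. Qed.

Lemma smooth_on_partial U f i : smooth_on U f -> smooth_on U (partial i f).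
Proof.
move=> fU s p Up.
have E t : partials t (partial i f) = partials (rcons t i) f.
  by rewrite /partials foldr_rcons.
by rewrite E; exact: fU.
Qed.

(** Derivatives of every order depend on germs only, so a function given by different formulas on
    different open sets can be treated piece by piece. *)
Lemma smooth_on_near U f : (forall p, U p -> exists V g,
   [/\ open V, V p, smooth_on V g & {in V, g =1 f}]) -> smooth_on U f.
Proof.
move=> H s p /H[V [g [oV Vp gV gf]]].
have E t : {in V, partials t g =1 partials t f}.
  elim: t => [|i t IH]//= q; rewrite inE => Vq.
  apply: near_eq_derive; near=> z; apply: IH.
  by rewrite inE; near: z; exact: open_nbhs_nbhs.
have [cs ds] := gV s p Vp; split.
  exact: (continuous_near_eq oV Vp (E s)).
move=> i; have := derivableP (ds i).
by move=> /(is_derive_near_eq oV Vp (E s))[].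
Unshelve. all: by end_near. Qed.

Lemma smooth_on_eq U f g : open U -> {in U, f =1 g} -> smooth_on U f -> smooth_on U g.
Proof.
by move=> oU fg fU; apply: smooth_on_near => p Up; exists U, f.
Qed.

Lemma smooth_on_differentiable U f p : open U -> smooth_on U f -> U p ->
  differentiable f p.
Proof.
move=> oU fU Up; apply: differentiable_of_partials.
  near=> q => i.
  have Uq : U q by near: q; exact: open_nbhs_nbhs.
  by have [] := smooth_on_is_derive i fU Uq.
by move=> i; apply: smooth_on_continuous Up; exact: smooth_on_partial.
Unshelve. all: by end_near. Qed.

Lemma smooth_on_algebra U f : open U -> algebra_of (smooth_on U) f -> smooth_on U f.
Proof.
move=> oU; apply: algebra_smooth => //.
  by move=> h hU p; exact: smooth_on_continuous.
move=> h i hU; exists (partial i h).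
  by apply: algebra_gen; exact: smooth_on_partial.
by move=> p; exact: smooth_on_is_derive.
Qed.

Lemma smooth_on_cst U c : open U -> smooth_on U (fun=> c).
Proof. by move=> oU; apply: smooth_on_algebra => //; exact: algebra_cst. Qed.

Lemma smooth_onD U f g : open U -> smooth_on U f -> smooth_on U g ->
  smooth_on U (fun p => f p + g p).
Proof.
by move=> oU fU gU; apply: smooth_on_algebra => //; apply: algebra_add; exact: algebra_gen.
Qed.

Lemma smooth_onM U f g : open U -> smooth_on U f -> smooth_on U g ->
  smooth_on U (fun p => f p * g p).
Proof.
by move=> oU fU gU; apply: smooth_on_algebra => //; apply: algebra_mul; exact: algebra_gen.
Qed.

Lemma smooth_on_sum U k (h : 'I_k -> 'rV[R]_n -> R) : open U ->
  (forall j, smooth_on U (h j)) -> smooth_on U (fun p => \sum_(j < k) h j p).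
Proof.
by move=> oU hU; apply: smooth_on_algebra => //; apply: algebra_sum => j; exact: algebra_gen.
Qed.

Lemma smooth_on_prod U k (h : 'I_k -> 'rV[R]_n -> R) : open U ->
  (forall j, smooth_on U (h j)) -> smooth_on U (fun p => \prod_(j < k) h j p).
Proof.
move=> oU hU; have : forall r : seq 'I_k, smooth_on U (fun p => \prod_(j <- r) h j p).
  elim=> [|a r IH].
    have -> : (fun p => \prod_(j <- [::]) h j p) = (fun=> 1).
      by apply/funext => p; rewrite big_nil.
    exact: smooth_on_cst.
  have -> : (fun p => \prod_(j <- (a :: r)) h j p) =
     (fun p => h a p * \prod_(j <- r) h j p).
    by apply/funext => p; rewrite big_cons.
  exact: (smooth_onM oU (hU a) IH).
exact.
Qed.


Lemma is_derive_coord (p v : 'rV[R]_n) j : is_derive p v (fun q : 'rV[R]_n => q 0 j) (v 0 j).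
Proof.
have E : (fun h : R => h^-1 *: ((fun q : 'rV[R]_n => q 0 j) (h *: v + p) - p 0 j)) @ 0^' --> v 0 j.
  apply: (@cvg_trans _ ((fun=> v 0 j) @ (0 : R)^')); last exact: cvg_cst.
  apply: near_eq_cvg; near=> h.
  rewrite !mxE addrK [_ *: _]mulrA mulVf ?mul1r//; near: h.
  exact: nbhs_dnbhs_neq.
by split; [apply/cvg_ex; exists (v 0 j)|exact/cvg_lim].
Unshelve. all: by end_near. Qed.

Lemma partial_coord i j (p : 'rV[R]_n) : partial i (fun q : 'rV[R]_n => q 0 j) p = (i == j)%:R.
Proof. by rewrite /partial (@derive_val _ _ _ _ _ _ _ (is_derive_coord _ _ _)) mxE eqxx eq_sym. Qed.

Lemma smooth_on_coord U j : open U -> smooth_on U (fun p => p 0 j).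
Proof.
move=> oU.
refine (@algebra_smooth n U [set (fun p : 'rV[R]_n => p 0 j)] oU _ _ (fun p => p 0 j) _).
- by move=> _ -> p _; exact: coord_continuous.
- move=> _ i ->; exists (fun=> (delta_mx 0 i : 'rV[R]_n) 0 j); first exact: algebra_cst.
  by move=> p _; exact: is_derive_coord.
- exact: algebra_gen.
Qed.

Lemma is_derive_comp_dir {W : normedModType R} (g : R -> R) (f : W -> R) (p v : W) (a b : R) :
  is_derive (f p) 1 g a -> is_derive p v f b -> is_derive p v (g \o f) (a * b).
Proof.
move=> dg df.
have df0 : is_derive (0 : R) 1 (fun s : R => f (p + s *: v)) b.
  apply: (proj1 (is_derive_lineP f p v 0 b)).
  by have -> : p + 0 *: v = p by rewrite scale0r addr0.
suff : is_derive (p + (0 : R) *: v) v (g \o f) (a * b).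
  by have -> : p + 0 *: v = p by rewrite scale0r addr0.
apply: (proj2 (is_derive_lineP _ p v 0 _)).
refine (@is_derive1_comp R g (fun s => f (p + s *: v)) 0 a b _ df0).
by have -> : p + 0 *: v = p by rewrite scale0r addr0.
Qed.

(** [G] is a family of functions of one variable whose derivatives are combinations of two members,
    as for powers and for t^-k exp(-1/t). The composites with [f], together with the smooth
    functions, then form a class to which [algebra_smooth] applies. *)
Lemma smooth_on_comp1 U (J : set R) (G : set (R -> R)) f : open U ->
  (forall k, G k -> exists k1 k2 c1 c2, [/\ G k1, G k2 &
     forall t, J t -> is_derive t 1 k (c1 * k1 t + c2 * k2 t)]) ->
  smooth_on U f -> (forall p, U p -> J (f p)) ->
  forall k, G k -> smooth_on U (k \o f).
Proof.
move=> oU GG fU fJ g Gg.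
pose G' := [set h | smooth_on U h \/ exists2 k, G k & h = k \o f].
apply: (@algebra_smooth n U G') => //.
- move=> h [hU p|[k Gk -> p Up]]; first exact: smooth_on_continuous.
  apply: continuous_comp; first exact: smooth_on_continuous Up.
  have [g1 [g2 [c1 [c2 [_ _ /(_ _ (fJ p Up))[dk _]]]]]] := GG k Gk.
  by apply: differentiable_continuous; exact/derivable1_diffP.
- move=> h i [hU|[k Gk ->]].
    exists (partial i h); first by apply: algebra_gen; left; exact: smooth_on_partial.
    by move=> p; exact: smooth_on_is_derive.
  have [g1 [g2 [c1 [c2 [G1 G2 dk]]]]] := GG k Gk.
  exists (fun p => (c1 * g1 (f p) + c2 * g2 (f p)) * partial i f p).
    apply: algebra_mul.
      apply: algebra_add; apply: algebra_mul => //; try exact: algebra_cst.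
        by apply: algebra_gen; right; exists g1.
      by apply: algebra_gen; right; exists g2.
    by apply: algebra_gen; left; exact: smooth_on_partial.
  move=> p Up; refine (is_derive_comp_dir _ (smooth_on_is_derive i fU Up)).
  exact/dk/fJ.
- by apply: algebra_gen; right; exists g.
Qed.

End smooth_on_theory.

Lemma is_derive_comp_row n k (f : 'rV[R]_k -> R) (h : 'rV[R]_n -> 'rV[R]_k) p i :
  differentiable f (h p) -> differentiable h p ->
  is_derive p (delta_mx 0 i) (f \o h)
    (\sum_(j < k) partial i (fun q => h q 0 j) p * partial j f (h p)).
Proof.
move=> df dh.
have dfh : differentiable (f \o h) p by exact: differentiable_comp.
have D : derivable (f \o h) p (delta_mx 0 i) by exact: diff_derivable.
split => //; rewrite deriveE// diff_comp//= diff_partial//.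
apply: eq_bigr => j _; congr (_ * _).
by rewrite -(jacobian_partial i j dh) /jacobian mxE.
Qed.

(** By the chain rule the composites with [h], together with the smooth functions on [U], are closed
    under partial derivatives up to sums and products; [algebra_smooth] then handles all orders at
    once. *)
Lemma smooth_on_comp_row n k (U : set 'rV[R]_n) (V : set 'rV[R]_k)
    (h : 'rV[R]_n -> 'rV[R]_k) f : open U -> open V ->
  (forall j, smooth_on U (fun p => h p 0 j)) -> smooth_on V f ->
  (forall p, U p -> V (h p)) -> smooth_on U (f \o h).
Proof.
move=> oU oV hU fV hUV.
pose G' := [set g | smooth_on U g \/ exists2 g0, smooth_on V g0 & g = g0 \o h].
have dh p : U p -> differentiable h p.
  by move=> Up; apply: differentiable_rowP => j; exact: (smooth_on_differentiable oU).
apply: (@algebra_smooth n U G') => //.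
- move=> g [gU p|[g0 g0V -> p Up]]; first exact: smooth_on_continuous.
  apply: continuous_comp; first exact/differentiable_continuous/dh.
  exact: (smooth_on_continuous g0V (hUV _ Up)).
- move=> g i [gU|[g0 g0V ->]].
    exists (partial i g); first by apply: algebra_gen; left; exact: smooth_on_partial.
    by move=> p; exact: smooth_on_is_derive.
  exists (fun p => \sum_(j < k) partial i (fun q => h q 0 j) p * (partial j g0 \o h) p).
    apply: algebra_sum => j; apply: algebra_mul; apply: algebra_gen.
      by left; exact: smooth_on_partial.
    by right; exists (partial j g0); [exact: smooth_on_partial|].
  move=> p Up; apply: is_derive_comp_row; last exact: dh.
  exact: (smooth_on_differentiable oV g0V (hUV _ Up)).
- by apply: algebra_gen; right; exists f.
Qed.

End smooth_functions.

(** * Flat exponentials and real powers *)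

Section smooth_real_functions.
Context {R : realType}.

(** The case k = 0 is the usual flat function behind bumps; the factors t^-k make the family closed
    under differentiation. *)
Definition flat_exp (k : nat) (t : R) : R :=
  if 0 < t then t^-1 ^+ k * expR (- t^-1) else 0.

Lemma flat_exp_ge0 k t : 0 <= flat_exp k t.
Proof.
by rewrite /flat_exp; case: ifPn => // t0; rewrite mulr_ge0 ?expR_ge0// exprn_ge0// invr_ge0 ltW.
Qed.

Lemma flat_exp_gt0 k t : 0 < t -> 0 < flat_exp k t.
Proof. by move=> t0; rewrite /flat_exp t0 mulr_gt0 ?expR_gt0// exprn_gt0// invr_gt0. Qed.

(** Quadratic decay is what differentiability at 0 takes: the difference quotient there is at most a
    constant times |h|. *)
Lemma flat_exp_le_sqr k t : flat_exp k t <= k.+2%:R ^+ k.+2 * t ^+ 2.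
Proof.
have [t0|t0] := ltP 0 t; last first.
  by rewrite /flat_exp ltNge t0/= mulr_ge0 ?sqr_ge0// exprn_ge0.
have s0 : 0 < t^-1 by rewrite invr_gt0.
set N := k.+2; set s := t^-1.
(* exp(s) is the N-th power of exp(s/N), and exp(s/N) >= s/N. The two factors of N beyond [k] leave
   t^2 in the bound. *)
have H : s ^+ N <= N%:R ^+ N * expR s.
  have -> : expR s = expR (s / N%:R) ^+ N by rewrite -expRM_natl mulrC divfK// pnatr_eq0.
  rewrite -exprMn lerXn2r ?nnegrE ?mulr_ge0 ?expR_ge0 ?(ltW s0)//.
  rewrite -ler_pdivrMl ?ltr0n// mulrC.
  by apply: le_trans (expR_ge1Dx _); rewrite lerDr.
rewrite /flat_exp t0 -/s expRN ler_pdivrMr ?expR_gt0//.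
have -> : s ^+ k = s ^+ N * t ^+ 2.
  by rewrite /N -addn2 exprD -mulrA -exprMn /s mulVf ?gt_eqF// expr1n mulr1.
by rewrite [leRHS]mulrAC ler_wpM2r// ?exprn_ge0// ltW.
Qed.

Lemma flat_exp_is_derive k (t : R) : is_derive t (1 : R) (flat_exp k)
  (- k%:R * flat_exp k.+1 t + 1 * flat_exp k.+2 t).
Proof.
have [t0|t0|->] := ltgtP t 0.
- have nt : (t < 0) by [].
  have -> : - k%:R * flat_exp k.+1 t + 1 * flat_exp k.+2 t = 0.
    by rewrite /flat_exp (lt_gtF t0) !mulr0 addr0.
  refine (@is_derive_near_eq R R R [set x | x < 0] (cst 0) _ t 1 0 _ nt _ _).
  - exact: open_lt.
  - by move=> x; rewrite inE/= => x0; rewrite /flat_exp (lt_gtF x0).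
- refine (@is_derive_near_eq R R R [set x | 0 < x] (fun x => x^-1 ^+ k * expR (- x^-1)) _ t 1 _ _ t0 _ _).
  - exact: open_gt.
  - by move=> x; rewrite inE/= => x0; rewrite /flat_exp x0.
  rewrite /flat_exp t0.
  have t0' : t != 0 by rewrite gt_eqF.
  have dV : is_derive t 1 (fun x : R => x^-1) (- t ^- 2).
    have di : derivable (id : R -> R) t 1 by exact: derivable_id.
    split; first exact: (@derivableV R _ id t 1 t0' di).
    by rewrite (@deriveV R _ id t 1 t0' di) derive_id [_ *: _]mulr1.
  have dN : is_derive t 1 (fun x : R => - x^-1) (t ^- 2).
    by have := is_deriveN dV; rewrite opprK.
  have dE := @is_derive1_comp R expR (fun x => - x^-1) t _ _ (is_derive_expR (- t^-1)) dN.
  have dX := is_deriveX k dV.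
  have dP := is_deriveM dX dE.
  have -> : (fun x : R => x^-1 ^+ k * expR (- x^-1)) =
      (@GRing.inv R) ^+ k * (expR \o (fun x => - x^-1)).
    by apply/funext => x; rewrite !fctE.
  refine (is_derive_eq dP _).
  rewrite /GRing.scale/= !fctE {dX dP}.
  case: k => [|k]; first by rewrite /= !expr0; field.
  rewrite [_.+1.-1]/= !(exprS _ k.+2) !(exprS _ k.+1) !(exprS _ k).
  set a := t^-1 ^+ k; set c : R := k.+1%:R; set e := expR _.
  by field.
- suff H : (fun h : R => h^-1 *: (flat_exp k (h *: 1 + 0) - flat_exp k 0)) @ 0^' --> 0.
    have -> : - k%:R * flat_exp k.+1 0 + 1 * flat_exp k.+2 0 = 0.
      by rewrite /flat_exp ltxx !mulr0 addr0.
    by split; [apply/cvg_ex; exists 0|exact/cvg_lim].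
  apply/cvgr0Pnorm_le => e e0.
  near=> h.
  rewrite [h *: 1]mulr1 addr0 {2}/flat_exp ltxx subr0 normrM normfV.
  have h0 : h != 0 by near: h; exact: nbhs_dnbhs_neq.
  rewrite mulrC ler_pdivrMr ?normr_gt0// ger0_norm ?flat_exp_ge0//.
  apply: le_trans (flat_exp_le_sqr _ _) _.
  rewrite -[h ^+ 2]ger0_norm ?sqr_ge0// normrX expr2 mulrA ler_wpM2r//.
  rewrite mulrC -ler_pdivlMr ?exprn_gt0//.
  near: h; apply: (@cvg_within _ (nbhs (0 : R))).
  apply/nbhs_ballP; exists (e / k.+2%:R ^+ k.+2); first by rewrite /= divr_gt0// exprn_gt0.
  by move=> y; rewrite -ball_normE/= sub0r normrN => /ltW.
Unshelve. all: by end_near. Qed.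

Lemma smooth_on_flat_exp n (U : set 'rV[R]_n) f : open U -> smooth_on U f ->
  smooth_on U (fun p => flat_exp 0 (f p)).
Proof.
move=> oU fU.
apply: (@smooth_on_comp1 _ _ U setT [set g | exists k, g = flat_exp k]) => //.
- move=> _ [k ->]; exists (flat_exp k.+1), (flat_exp k.+2), (- k%:R), 1; split.
  + by exists k.+1.
  + by exists k.+2.
  + by move=> t _; exact: flat_exp_is_derive.
- by exists 0%N.
Qed.

Lemma is_derive_powR (a t : R) : 0 < t ->
  is_derive t 1 (fun s => s `^ a) (a * t `^ (a - 1)).
Proof.
move=> t0.
have ti : t \in `]0, +oo[ by rewrite in_itv/= t0.
split; first exact: derivable_powR.
by rewrite -derive1E powR_derive1.
Qed.

Lemma smooth_on_powR n (U : set 'rV[R]_n) f (a : R) : open U -> smooth_on U f ->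
  (forall p, U p -> 0 < f p) -> smooth_on U (fun p => f p `^ a).
Proof.
move=> oU fU f0.
refine (@smooth_on_comp1 _ _ U [set t | 0 < t] [set g | exists b, g = (fun t => t `^ b)] f oU _ fU f0 (fun t => t `^ a) _).
- move=> _ [b ->]; exists (fun t => t `^ (b - 1)), (fun t => t `^ (b - 1)), b, 0; split.
  + by exists (b - 1).
  + by exists (b - 1).
  + by move=> t t0; rewrite mul0r addr0; exact: is_derive_powR.
- by exists a.
Qed.

Lemma smooth_on_inv n (U : set 'rV[R]_n) f : open U -> smooth_on U f ->
  (forall p, U p -> 0 < f p) -> smooth_on U (fun p => (f p)^-1).
Proof.
move=> oU fU f0; have := smooth_on_powR (- 1) oU fU f0.
apply: smooth_on_eq => // p; rewrite inE => Up.
by rewrite powR_inv1// ltW// f0.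
Qed.

End smooth_real_functions.

(** * Lebesgue measure on row vectors *)

Section borel_sets.

Lemma borel_open {T : ptopologicalType} (A : set T) :
  open A -> measurable (A : set (borel T)).
Proof. by move=> oA; exact: sub_sigma_algebra. Qed.

Lemma borel_closed {T : ptopologicalType} (A : set T) :
  closed A -> measurable (A : set (borel T)).
Proof.
move=> cA; rewrite -[A]setCK; apply: measurableC.
by apply: borel_open; exact: closed_openC.
Qed.

Lemma borel_compact {T : ptopologicalType} (A : set T) : hausdorff_space T ->
  compact A -> measurable (A : set (borel T)).
Proof. by move=> hT cA; apply: borel_closed; exact: compact_closed. Qed.

Lemma open_preimage_for {T T' : topologicalType} (U : set T) (f : T -> T') (V : set T') :
  open U -> (forall p, U p -> {for p, continuous f}) -> open V ->
  open (U `&` f @^-1` V).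
Proof.
move=> oU cf oV; rewrite openE => p [Up Vp]; apply: filterI.
  exact: open_nbhs_nbhs.
by apply: cf => //; exact: open_nbhs_nbhs.
Qed.

Lemma continuous_borel_fun {T T' : ptopologicalType} (U : set T) (f : T -> T') :
  open U -> (forall p, U p -> {for p, continuous f}) ->
  measurable_fun (U : set (borel T)) (f : borel T -> borel T').
Proof.
move=> oU cf; refine (@measurability _ _ (borel T) (borel T') U f (@open T') erefl _).
move=> _ [V oV <-]; apply: borel_open; exact: open_preimage_for.
Qed.

Lemma continuous_borel_real {R : realType} {T : ptopologicalType} (U : set T) (f : T -> R) :
  open U -> (forall p, U p -> {for p, continuous f}) ->
  measurable_fun (U : set (borel T)) f.
Proof.
move=> oU cf; apply: (measurability _ (measurable_realfun.RGenOInfty.measurableE R)).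
move=> /= _ [_ [a ->]] <-; apply: borel_open; apply: open_preimage_for => //.
Qed.

Context {R : realType}.

Lemma rat_approx (x e : R) : 0 < e -> exists r : rat, `|x - ratr r| < e.
Proof.
move=> e0; have [|r] := @rat_in_itvoo R (x - e) (x + e).
  by rewrite ltrD2l gtrN.
rewrite in_itv/= => /andP[r1 r2]; exists r.
by rewrite ltr_norml; apply/andP; split; lra.
Qed.

(** Rational centres and radii 1/(m+1) suffice. Balls that do not fit in [O] are replaced by the
    empty set, so that the index type is countable and independent of [O]. *)
Lemma open_rV_bigcup_ball n (O : set 'rV[R]_n) : open O ->
  exists (c : 'rV[rat]_n * nat -> 'rV[R]_n) (P : 'rV[rat]_n * nat -> bool),
  O = \bigcup_k (if P k then ball (c k) (k.2.+1%:R^-1) else set0).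
Proof.
move=> oO; pose c (k : 'rV[rat]_n * nat) : 'rV[R]_n := map_mx ratr k.1.
exists c, (fun k => `[< ball (c k) (k.2.+1%:R^-1) `<=` O >]).
apply/seteqP; split => [x Ox|x [k _]]; last by case: ifPn => // /asboolP; exact.
have /nbhs_ballP[e /= e0 eO] : nbhs x O by exact: open_nbhs_nbhs.
have [m me] : exists m : nat, m.+1%:R^-1 < e / 2.
  have [m _] := @near_infty_natSinv_lt R (PosNum (divr_gt0 e0 (ltr0n R 2))).
  by move=> /(_ m (leqnn m)); exists m.
have [q xq] : exists q : 'I_n -> rat, forall i, `|x 0 i - ratr (q i)| < m.+1%:R^-1.
  have := @choice _ _ (fun i r => `|x 0 i - ratr r| < m.+1%:R^-1).
  case=> [i|q qP]; last by exists q.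
  exact: rat_approx.
exists (\row_i q i, m) => //=.
have xc : ball (c (\row_i q i, m)) m.+1%:R^-1 x.
  split; first by rewrite invr_gt0.
  by move=> i j; rewrite ord1 /ball/= !mxE distrC.
case: ifPn => // /asboolP; case => y yc; apply: eO.
apply: (@le_ball _ _ x (m.+1%:R^-1 + m.+1%:R^-1)).
  by rewrite [leRHS]splitr lerD// ltW.
by apply: ball_triangle yc; exact: ball_sym.
Qed.

(** A ball of the sup norm is a finite intersection of conditions on single coordinates, and
    countably many balls make up any open set. *)
Lemma measurable_fun_rV d (T : measurableType d) n (D : set T) (g : T -> 'rV[R]_n) :
  measurable D -> (forall i, measurable_fun D (fun x => g x 0 i)) ->
  measurable_fun D (g : T -> borel 'rV[R]_n).
Proof.
move=> mD mg; refine (@measurability _ _ T (borel 'rV[R]_n) D g (@open 'rV[R]_n) erefl _).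
move=> _ [V oV <-]; have [c [P ->]] := open_rV_bigcup_ball oV.
rewrite preimage_bigcup setI_bigcupr; apply: countable_bigcupT_measurable => //= k.
case: (P k); last by rewrite preimage_set0 setI0.
have -> : D `&` g @^-1` ball (c k) k.2.+1%:R^-1 =
    D `&` \bigcap_(i in [set: 'I_n]) (D `&` (fun x => g x 0 i) @^-1` (ball (c k 0 i) k.2.+1%:R^-1)).
  apply/seteqP; split => x [Dx].
    by move=> [_ gx]; split=> // i _; split=> //; exact: gx.
  move=> H; split=> //; split; first by rewrite invr_gt0.
  by move=> i j; rewrite ord1; have [_] := H j Logic.I.
apply: measurableI => //; apply: fin_bigcap_measurable => [|i _]; first exact: finite_finset.
apply: mg => //.
by apply: open_measurable; exact: ball_open.
Qed.

Lemma measurable_coord n (i : 'I_n) :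
  measurable_fun setT (fun x : borel 'rV[R]_n => (x : 'rV[R]_n) 0 i).
Proof.
apply: (@continuous_borel_real R 'rV[R]_n) => [|p _]; first exact: openT.
exact: coord_continuous.
Qed.

End borel_sets.

Section sigma_finite_measures.
Context d (T : measurableType d) (R : realType) (mu : set T -> \bar R).
Hypotheses (mu0 : mu set0 = 0%E) (mu_ge0 : forall A, (0 <= mu A)%E).
Hypotheses (mu_sa : semi_sigma_additive mu) (mu_sf : sigma_finite setT mu).

HB.instance Definition _ := isMeasure.Build _ T R mu mu0 mu_ge0 mu_sa.
HB.instance Definition _ := Measure_isSigmaFinite.Build _ T R mu mu_sf.

(** Bundles a set function known to be a measure only through hypotheses: in the induction on the
    dimension, the product with the lower-dimensional measure requires such a bundle. *)
Lemma sigma_finite_measureP :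
  exists nu : {sigma_finite_measure set T -> \bar R}, (nu : set T -> \bar R) = mu.
Proof. by exists mu. Qed.

End sigma_finite_measures.

Section lebesgue_measure_on_rows.
Context {R : realType}.

Let cons n (z : measurableTypeR R * borel 'rV[R]_n) : borel 'rV[R]_n.+1 :=
  row_mx (z.1%:M : 'rV[R]_1) (z.2 : 'rV[R]_n).

Lemma measurable_row_cons n :
  measurable_fun setT (fun z : measurableTypeR R * borel 'rV[R]_n =>
     (row_mx (z.1%:M : 'rV[R]_1) (z.2 : 'rV[R]_n) : borel 'rV[R]_n.+1)).
Proof.
apply: measurable_fun_rV => // i.
case: (@split_ordP 1 n i) => j ->.
  have -> : (fun z : measurableTypeR R * borel 'rV[R]_n =>
     (row_mx (z.1%:M : 'rV[R]_1) (z.2 : 'rV[R]_n)) 0 (lshift n j)) = fst.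
    by apply/funext => z; rewrite row_mxEl !ord1 mxE mulr1n.
  exact: measurable_fst.
have -> : (fun z : measurableTypeR R * borel 'rV[R]_n =>
     (row_mx (z.1%:M : 'rV[R]_1) (z.2 : 'rV[R]_n)) 0 (rshift 1 j)) =
   (fun x : borel 'rV[R]_n => (x : 'rV[R]_n) 0 j) \o snd.
  by apply/funext => z; rewrite row_mxEr.
by apply: measurableT_comp; [exact: measurable_coord|exact: measurable_snd].
Qed.

Lemma lebesgue_rV0 n : lebesgue_rV R n set0 = 0%E.
Proof.
elim: n => [|n IH]; first by rewrite /lebesgue_rV measure0.
rewrite /= (eq_integral (cst 0%E)) ?integral0// => t _ /=.
Qed.

Lemma lebesgue_rV_ge0 n A : (0 <= lebesgue_rV R n A)%E.
Proof.
elim: n A => [|n IH] A; first by rewrite /lebesgue_rV measure_ge0.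
by apply: integral_ge0 => t _; exact: IH.
Qed.

Definition box k (N : R) : set (borel 'rV[R]_k) := [set v : 'rV[R]_k | forall i, `|v 0 i| <= N].

Lemma closed_box k N : closed (@box k N : set 'rV[R]_k).
Proof.
have -> : (@box k N : set 'rV[R]_k) = \bigcap_(i in [set: 'I_k]) (fun v : 'rV[R]_k => v 0 i) @^-1` [set t | `|t| <= N].
  by apply/seteqP; split => v H i => [_|]; apply: H.
apply: closed_bigI => i _; apply: preimage_closed => [v _|]; first exact: coord_continuous.
by apply: preimage_closed (@closed_le R N) => v _; exact: norm_continuous.
Qed.

Lemma measurable_box k N : measurable (@box k N).
Proof. exact: (@borel_closed 'rV[R]_k _ (@closed_box k N)). Qed.

Lemma lebesgue_rV_box k N : 0 <= N -> lebesgue_rV R k (@box k N) = ((N *+ 2) ^+ k)%:E.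
Proof.
move=> N0; elim: k => [|k IH].
  by rewrite /= diracE mem_set// => -[].
have -> : lebesgue_rV R k.+1 (@box k.+1 N) =
   (\int[lebesgue_measure]_t ((\1_`[- N, N] t)%:E * lebesgue_rV R k (@box k N)))%E.
  rewrite /=; apply: eq_integral => t _; rewrite indicE mem_setE in_itv/= -ler_norml.
  have [tN|tN] := leP `|t| N.
    rewrite mul1e; congr (lebesgue_rV R k _); apply/seteqP; split => v H i.
      by have := H (rshift 1 i); rewrite (row_mxEr (t%:M : 'rV[R]_1)).
    case: (@split_ordP 1 k i) => j ->; last by rewrite (row_mxEr (t%:M : 'rV[R]_1)); exact: H.
    by rewrite (row_mxEl (t%:M : 'rV[R]_1)) !ord1 mxE mulr1n.
  rewrite mul0e -[RHS](lebesgue_rV0 k); congr (lebesgue_rV R k _).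
  apply/seteqP; split => v // H; have := H (@lshift 1 k 0).
  by rewrite (row_mxEl (t%:M : 'rV[R]_1)) mxE mulr1n leNgt tN.
have m1 : measurable_fun setT (fun t : measurableTypeR R => (\1_`[- N, N] t)%:E : \bar R).
  by apply/measurable_EFinP; exact: measurable_indic.
have f1 (t : measurableTypeR R) : setT t -> (0 <= (\1_`[- N, N] t)%:E :> \bar R)%E.
  by rewrite lee_fin.
rewrite (ge0_integralZr lebesgue_measure measurableT m1 f1 (lebesgue_rV_ge0 _)) IH.
rewrite integral_indic// setIT.
have := @lebesgue_measure_itv R `[- N, N]; rewrite /= => ->.
rewrite lte_fin; have [N1|N1] := ltP 0 N.
  by rewrite gtrN// -EFinB -EFinM opprK -mulr2n -exprS.
have -> : N = 0 by apply/eqP; rewrite eq_le N0 N1.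
by rewrite oppr0 ltxx mul0rn exprS mul0r mul0e.
Qed.

Let box_cover k : \bigcup_N @box k N%:R = setT.
Proof.
apply/seteqP; split => // v _; have vN := archi_boundP (normr_ge0 (v : 'rV[R]_k)).
exists (Num.bound `|(v : 'rV[R]_k)|) => // i; apply: le_trans (ltW vN).
rewrite [leRHS]/Num.norm/= mx_normrE.
exact: (le_bigmax _ (fun ij => `|(v : 'rV[R]_k) ij.1 ij.2|) (0, i)).
Qed.

Lemma lebesgue_rV_sigma_finite n : sigma_finite setT (lebesgue_rV R n).
Proof.
exists (fun N => @box n N%:R); first by rewrite box_cover.
by move=> N; split; [exact: measurable_box|rewrite lebesgue_rV_box ?ltry].
Qed.

(** In positive dimension the slicing formula is the image of a product measure under prepending a
    coordinate, and countable additivity is inherited from the product. *)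
Lemma lebesgue_rV_semi_sigma_additive n : semi_sigma_additive (lebesgue_rV R n).
Proof.
elim: n => [|n musa]; first by rewrite /lebesgue_rV; exact: measure_semi_sigma_additive.
have [mu muE] := sigma_finite_measureP (lebesgue_rV0 n) (@lebesgue_rV_ge0 n) musa
  (lebesgue_rV_sigma_finite n).
pose pm := (lebesgue_measure \x mu)%E.
have nuE : lebesgue_rV R n.+1 = fun A => pm (@cons n @^-1` A).
  apply/funext => A; rewrite /= -muE /pm /product_measure1.
  apply: eq_integral => t _ /=; congr (mu _); apply/seteqP.
  by split=> v; rewrite /xsection/= inE.
have mpre (A : set (borel 'rV[R]_n.+1)) : measurable A -> measurable (@cons n @^-1` A).
  by move=> mA; rewrite -[X in measurable X]setTI; exact: measurable_row_cons.
rewrite nuE => F mF tF mUF; rewrite preimage_bigcup.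
refine (@measure_semi_sigma_additive _ _ _ (lebesgue_measure \x mu)%E _ _ _ _).
- by move=> k; exact: mpre.
- apply/trivIsetP => /= i j _ _ ij; rewrite -preimage_setI.
  by move/trivIsetP : tF => /(_ _ _ _ _ ij) ->//; rewrite preimage_set0.
- by rewrite -preimage_bigcup; exact: mpre.
Qed.

HB.instance Definition _ n := isMeasure.Build _ (borel 'rV[R]_n) R (lebesgue_rV R n)
  (lebesgue_rV0 n) (@lebesgue_rV_ge0 n) (@lebesgue_rV_semi_sigma_additive n).

HB.instance Definition _ n := Measure_isSigmaFinite.Build _ (borel 'rV[R]_n) R
  (lebesgue_rV R n) (lebesgue_rV_sigma_finite n).

Lemma measurable_slice n (A : set (borel 'rV[R]_n.+1)) (t : R) : measurable A ->
  measurable [set v : borel 'rV[R]_n | A (row_mx (t%:M : 'rV[R]_1) (v : 'rV[R]_n))].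
Proof.
move=> mA.
have := measurable_xsection (t : measurableTypeR R) (measurable_row_cons measurableT mA).
congr measurable; apply/seteqP; split => v; rewrite /xsection/= inE/=; [by case|by []].
Qed.

Lemma measurable_fun_slice n (A : set (borel 'rV[R]_n.+1)) : measurable A ->
  measurable_fun setT (fun t : R => lebesgue_rV R n
    [set v : borel 'rV[R]_n | A (row_mx (t%:M : 'rV[R]_1) (v : 'rV[R]_n))]).
Proof.
move=> mA.
have := measurable_fun_xsection (lebesgue_rV R n) (measurable_row_cons measurableT mA).
congr (measurable_fun _ _); apply/funext => t /=; congr (lebesgue_rV R n _).
apply/seteqP; split => v; rewrite /xsection/= inE/=; [by case|by []].
Qed.

Lemma lebesgue_measure_shift (a : R) (A : set R) : measurable A ->
  lebesgue_measure ((fun t => t + a) @^-1` A) = lebesgue_measure A.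
Proof.
move=> mA.
have mf : measurable_fun setT (fun t : R => t + a) by exact: measurable_funD.
suff : pushforward lebesgue_measure ((fun t => t + a) : measurableTypeR R -> measurableTypeR R) A
    = lebesgue_measure A by [].
apply/esym/lebesgue_measure_unique => //= _ [[b c]] _ <-.
rewrite /pushforward.
have -> : (fun t => t + a) @^-1` `]b, c]%classic = `]b - a, c - a]%classic.
  by apply/seteqP; split => t /=; rewrite !in_itv/= ltrBlDr lerBrDr.
rewrite !lebesgue_measure_itv/= !lte_fin ltrD2r; case: ifP => // _.
by rewrite -!EFinB; congr (_%:E); ring.
Qed.

Lemma ge0_integral_shift (a : R) (f : R -> \bar R) : measurable_fun setT f ->
  (forall t, 0 <= f t)%E ->
  (\int[lebesgue_measure]_t f (t + a)%R = \int[lebesgue_measure]_t f t)%E.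
Proof.
move=> mf f0.
have mg : measurable_fun setT ((fun t => t + a) : measurableTypeR R -> measurableTypeR R).
  exact: measurable_funD.
have := @ge0_integral_pushforward _ _ _ _ R _ mg lebesgue_measure setT f measurableT mf
  (fun y _ => f0 y).
rewrite preimage_setT => <-.
apply: eq_measure_integral => //= A mA _; exact: lebesgue_measure_shift.
Qed.

(** The first coordinate of [h] is absorbed by translation invariance on the line, the others by the
    induction hypothesis on each slice. *)
Lemma lebesgue_rV_shift n (h : 'rV[R]_n) (A : set (borel 'rV[R]_n)) : measurable A ->
  lebesgue_rV R n [set x : borel 'rV[R]_n | A ((x : 'rV[R]_n) + h)] = lebesgue_rV R n A.
Proof.
elim: n h A => [|n IH] h A mA.
  congr (lebesgue_rV R 0 _); apply/seteqP.
  by split=> v /=; rewrite [v + h]thinmx0 [v]thinmx0.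
pose G t := lebesgue_rV R n [set v : borel 'rV[R]_n | A (row_mx (t%:M : 'rV[R]_1) (v : 'rV[R]_n))].
transitivity (\int[lebesgue_measure]_t G (t + h 0 0)%R)%E; last first.
  have mG : measurable_fun setT G by exact: measurable_fun_slice.
  have G0 t : (0 <= G t)%E by exact: lebesgue_rV_ge0.
  by rewrite (ge0_integral_shift (h 0 0) mG G0).
apply: eq_integral => t _; rewrite /G -(IH (@rsubmx R 1 1 n h)); last exact: measurable_slice.
congr (lebesgue_rV R n _); apply/seteqP.
suff E (v : 'rV[R]_n) : row_mx (t%:M : 'rV[R]_1) v + h =
    row_mx ((t + h 0 0)%:M : 'rV[R]_1) (v + @rsubmx R 1 1 n h).
  by split => v /=; rewrite E.
rewrite -[in LHS](@hsubmxK R 1 1 n h) add_row_mx; congr row_mx.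
apply/matrixP => i j; rewrite !ord1 !mxE !mulr1n; congr (_ + h _ _).
by apply/val_inj.
Qed.

Lemma ge0_integral_rV_shift n (h : 'rV[R]_n) (f : borel 'rV[R]_n -> \bar R) :
  measurable_fun setT f -> (forall x, 0 <= f x)%E ->
  (\int[lebesgue_rV R n]_x f ((x : 'rV[R]_n) + h)%R = \int[lebesgue_rV R n]_x f x)%E.
Proof.
move=> mf f0.
have mg : measurable_fun setT ((fun x : 'rV[R]_n => x + h) : borel 'rV[R]_n -> borel 'rV[R]_n).
  apply: continuous_borel_fun; first exact: openT.
  by move=> p _; apply: (@cvgD R 'rV[R]_n _ (nbhs p) _ id (cst h) p h); [exact: cvg_id|exact: cvg_cst].
have := @ge0_integral_pushforward _ _ _ _ R _ mg (lebesgue_rV R n) setT f measurableT mf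
  (fun y _ => f0 y).
rewrite preimage_setT => <-.
apply: eq_measure_integral => //= A mA _; exact: lebesgue_rV_shift.
Qed.

Lemma lebesgue_rV_compact_lt_pinfty n (K : set 'rV[R]_n) : compact K ->
  (lebesgue_rV R n K < +oo)%E.
Proof.
move=> cK; have [N [_ /(_ (N + 1))]] := compact_bounded cK.
rewrite ltrDl => /(_ ltr01) KN.
apply: (@le_lt_trans _ _ (lebesgue_rV R n (@box n `|N + 1|))).
  apply: le_measure.
- by rewrite inE; apply: borel_compact => //; exact: norm_hausdorff.
  - by rewrite inE; exact: measurable_box.
  - move=> v /KN /= vN i; apply: (le_trans _ (ler_norm _)); move: vN.
    rewrite [leLHS]/Num.norm/= mx_normrE => H; apply: le_trans H.
    exact: (le_bigmax _ (fun ij => `|v ij.1 ij.2|) (0, i)).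
by rewrite lebesgue_rV_box ?ltry.
Qed.

End lebesgue_measure_on_rows.

(** * Mollification in L^2 *)

Section square_integrals.
Local Open Scope ereal_scope.
Context d (T : measurableType d) (R : realType) (mu : {measure set T -> \bar R}).
Implicit Types (D : set T) (f g h : T -> R).

(** The squared L^2 norm as an extended real, finiteness being a separate statement. The inequality
    (a + b)^2 <= 2 (a^2 + b^2) does the work of the triangle inequality. *)
Definition sqint D f := \int[mu]_(x in D) (f x ^+ 2)%:E.

Lemma measurable_sqr D f : measurable_fun D f ->
  measurable_fun D (fun x => (f x ^+ 2)%:E).
Proof. by move=> mf; apply/measurable_EFinP; exact: measurable_funX. Qed.

Lemma sqint_ge0 D f : 0 <= sqint D f.
Proof. by apply: integral_ge0 => x _; rewrite lee_fin sqr_ge0. Qed.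

Lemma sqint_le D f g : measurable D -> measurable_fun D f -> measurable_fun D g ->
  (forall x, D x -> (`|f x| <= `|g x|)%R) -> sqint D f <= sqint D g.
Proof.
move=> mD mf mg fg; apply: ge0_le_integral => //.
- by move=> x _; rewrite lee_fin sqr_ge0.
- exact: measurable_sqr.
- exact: measurable_sqr.
- move=> x Dx; rewrite lee_fin -(real_normK (num_real (f x))) -(real_normK (num_real (g x))).
  by rewrite lerXn2r ?nnegrE// fg.
Qed.

Lemma sqintD_le D f g : measurable D -> measurable_fun D f -> measurable_fun D g ->
  sqint D (fun x => f x + g x)%R <= 2%:E * (sqint D f + sqint D g).
Proof.
move=> mD mf mg; rewrite /sqint -ge0_integralD//; last 4 first.
- by move=> x _; rewrite lee_fin sqr_ge0.
- exact: measurable_sqr.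
- by move=> x _; rewrite lee_fin sqr_ge0.
- exact: measurable_sqr.
have m2 : measurable_fun D (fun x => (f x ^+ 2)%:E + (g x ^+ 2)%:E).
  by apply: emeasurable_funD; exact: measurable_sqr.
rewrite -ge0_integralZl//; last first.
  by move=> x _; rewrite -EFinD lee_fin addr_ge0 ?sqr_ge0.
apply: ge0_le_integral => //.
- by move=> x _; rewrite lee_fin sqr_ge0.
- by apply: measurable_sqr; exact: measurable_funD.
- exact: emeasurable_funM.
- move=> x _; rewrite -EFinD -EFinM lee_fin.
  by have := sqr_ge0 (f x - g x)%R; nra.
Qed.

Lemma sqintZ D f (c : R) : measurable D -> measurable_fun D f ->
  sqint D (fun x => c * f x)%R = (c ^+ 2)%:E * sqint D f.
Proof.
move=> mD mf; rewrite /sqint -ge0_integralZl//.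
- by apply: eq_integral => x _; rewrite exprMn EFinM.
- exact: measurable_sqr.
- by move=> x _; rewrite lee_fin sqr_ge0.
- by rewrite lee_fin sqr_ge0.
Qed.

Lemma sqint_cvg0 D (f_ : nat -> T -> R) f g : measurable D ->
  (forall k, measurable_fun D (f_ k)) -> measurable_fun D f -> measurable_fun D g ->
  sqint D g < +oo ->
  (forall x, D x -> (f_ ^~ x) @ \oo --> f x) ->
  (forall k x, D x -> (`|f_ k x - f x| <= `|g x|)%R) ->
  (fun k => sqint D (fun x => f_ k x - f x)%R) @ \oo --> 0.
Proof.
move=> mD mf_ mf mg goo fcvg fg.
have mh k : measurable_fun D (fun x => ((f_ k x - f x) ^+ 2)%:E).
  by apply: measurable_sqr; exact: measurable_funB.
have [||||_ _] := @dominated_convergence _ _ _ mu D mD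
  (fun k x => ((f_ k x - f x) ^+ 2)%:E) (cst 0) (fun x => (g x ^+ 2)%:E) mh.
- exact: measurable_cst.
- apply: aeW => x Dx; apply/fine_cvgP; split; first exact: nearW.
  have : (fun k => f_ k x - f x)%R @ \oo --> (f x - f x)%R.
    by apply: cvgB; [exact: fcvg|exact: cvg_cst].
  rewrite subrr => H.
  rewrite (_ : fine \o _ = (fun k => f_ k x - f x)%R \* (fun k => f_ k x - f x)%R)%R; last first.
    by apply/funext => k /=; rewrite expr2.
  by rewrite -[X in _ --> X](mul0r 0%R); exact: (cvgM H H).
- apply/integrableP; split; first exact: measurable_sqr.
  apply: le_lt_trans goo; rewrite le_eqVlt; apply/orP; left; apply/eqP.
  by apply: eq_integral => x _; rewrite gee0_abs// lee_fin sqr_ge0.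
- apply: aeW => x k Dx; rewrite gee0_abs ?lee_fin ?sqr_ge0//.
  rewrite -(real_normK (num_real (f_ k x - f x))) -(real_normK (num_real (g x))).
  by rewrite lerXn2r ?nnegrE// fg.
- by rewrite integral0.
Qed.

(* [A] is a class of admissible approximants, to be the continuous functions. *)
Definition L2_approx (A : set (T -> R)) D f :=
  forall e : R, (0 < e)%R -> exists2 k, A k & sqint D (fun x => f x - k x)%R <= e%:E.

Context (A : set (T -> R)) (D : set T).
Hypotheses (mD : measurable D) (mA : forall k, A k -> measurable_fun D k).
Hypotheses (AD : forall k l, A k -> A l -> A (fun x => k x + l x)%R)
  (AZ : forall k c, A k -> A (fun x => c * k x)%R).

Lemma L2_approxD f g : measurable_fun D f -> measurable_fun D g ->
  L2_approx A D f -> L2_approx A D g -> L2_approx A D (fun x => f x + g x)%R.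
Proof.
move=> mf mg fA gA e e0; have e4 : (0 < e / 4)%R by rewrite divr_gt0.
have [k Ak kf] := fA _ e4; have [l Al lg] := gA _ e4.
exists (fun x => k x + l x)%R; first exact: AD.
rewrite (_ : (fun x => _) = (fun x => (f x - k x) + (g x - l x))%R); last first.
  by apply/funext => x; rewrite opprD addrACA.
apply: le_trans (sqintD_le mD _ _) _.
- by apply: measurable_funB => //; exact: mA.
- by apply: measurable_funB => //; exact: mA.
apply: (@le_trans _ _ (2%:E * ((e / 4)%:E + (e / 4)%:E))).
  by rewrite lee_pmul2l// leeD.
by rewrite -EFinD -EFinM lee_fin; lra.
Qed.

Lemma L2_approxZ f c : measurable_fun D f ->
  L2_approx A D f -> L2_approx A D (fun x => c * f x)%R.
Proof.
move=> mf fA e e0; have c0 : (0 < c ^+ 2 + 1)%R by rewrite ltr_wpDl ?sqr_ge0.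
have [k Ak kf] := fA (e / (c ^+ 2 + 1))%R (divr_gt0 e0 c0).
exists (fun x => c * k x)%R; first exact: AZ.
rewrite (_ : (fun x => _) = (fun x => c * (f x - k x))%R); last first.
  by apply/funext => x; rewrite mulrBr.
rewrite sqintZ//; last by apply: measurable_funB => //; exact: mA.
apply: (@le_trans _ _ ((c ^+ 2)%:E * (e / (c ^+ 2 + 1))%:E)).
  by rewrite lee_wpmul2l// lee_fin sqr_ge0.
rewrite -EFinM lee_fin mulrCA ger_pMr// ler_pdivrMr// mul1r lerDl//.
Qed.

Lemma L2_approx_lim f (f_ : nat -> T -> R) : measurable_fun D f ->
  (forall k, measurable_fun D (f_ k)) -> (forall k, L2_approx A D (f_ k)) ->
  (fun k => sqint D (fun x => f_ k x - f x)%R) @ \oo --> 0 ->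
  L2_approx A D f.
Proof.
move=> mf mf_ fA fl e e0; have e4 : (0 < e / 4)%R by rewrite divr_gt0.
have [N _ /(_ N (leqnn N)) Nf] : \forall k \near \oo, sqint D (fun x => f_ k x - f x)%R < (e / 4)%:E.
  move: fl => /(_ [set y | y < (e / 4)%:E]); apply.
  apply: open_nbhs_nbhs; split; first exact: open_ereal_lt_ereal.
  by rewrite /= lte_fin.
have [k Ak kf] := fA N _ e4; exists k => //.
rewrite (_ : (fun x => _) = (fun x => (f_ N x - k x) + (- 1) * (f_ N x - f x))%R); last first.
  by apply/funext => x; ring.
apply: le_trans (sqintD_le mD _ _) _.
- by apply: measurable_funB => //; exact: mA.
- by apply: measurable_funM => //; exact: measurable_funB.
rewrite sqintZ//; last exact: measurable_funB.
rewrite sqrrN expr1n mul1e.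
apply: (@le_trans _ _ (2%:E * ((e / 4)%:E + (e / 4)%:E))).
  by rewrite lee_pmul2l// leeD// ltW.
by rewrite -EFinD -EFinM lee_fin; lra.
Qed.

End square_integrals.

(** * Density of continuous functions in L^2 *)

Section continuous_density.
Context {R : realType} {n : nat}.
Local Notation lambda := (lebesgue_rV R n).
Import HBSimple HBNNSimple.
Implicit Types (D E : set (borel 'rV[R]_n)) (f : borel 'rV[R]_n -> R).

Lemma continuous_measurable_rV (k : 'rV[R]_n -> R) : continuous k ->
  measurable_fun setT (k : borel 'rV[R]_n -> R).
Proof. by move=> ck; apply: (@continuous_borel_real R 'rV[R]_n setT) => [|p _]; [exact: openT|exact: ck]. Qed.

(** Values in [0, 1] allow approximants to be combined: 1 - k for complements and the maximum for
    unions, with squared errors that at most add up. *)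
Let A01 : set (borel 'rV[R]_n -> R) :=
  [set k | continuous (k : 'rV[R]_n -> R) /\ forall x, 0 <= k x <= 1].

Context (D : set (borel 'rV[R]_n)).
Hypotheses (mD : measurable D) (Doo : (lambda D < +oo)%E).

Let mA01 k : A01 k -> measurable_fun D k.
Proof. by move=> [ck _]; apply: measurable_funTS; exact: continuous_measurable_rV. Qed.

Let good (E : set (borel 'rV[R]_n)) := measurable E /\ L2_approx lambda A01 D (\1_E).

Let mindic E : measurable E -> measurable_fun D (\1_E : borel 'rV[R]_n -> R).
Proof. by move=> mE; exact: measurable_indic. Qed.

Let sqint1 : (sqint lambda D (cst 1%R) < +oo)%E.
Proof.
rewrite /sqint; under eq_integral do rewrite expr1n.
by rewrite integral_cst// mul1e.
Qed.

Let good_lim E (h : nat -> borel 'rV[R]_n -> R) : measurable E ->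
  (forall k, measurable_fun D (h k)) -> (forall k, L2_approx lambda A01 D (h k)) ->
  (forall k x, 0 <= h k x <= 1) -> (forall x, D x -> h ^~ x @ \oo --> (\1_E x : R)) -> good E.
Proof.
move=> mE mh hA h01 hE; split=> //; apply: (L2_approx_lim mD mA01 _ mh hA); first exact: mindic.
refine (sqint_cvg0 mD mh (mindic mE) (measurable_cst (1 : R)) sqint1 hE _) => k x _.
rewrite normr1; have := h01 k x; rewrite indicE; case: (_ \in _) => /=; rewrite ler_norml; lra.
Qed.

Let good_ball c r : good (ball (c : 'rV[R]_n) r).
Proof.
(* Continuous functions increasing to the indicator of the ball: [j] times the depth inside the
   ball, cut off at 1. *)
pose h (j : nat) (x : borel 'rV[R]_n) : R := Num.min 1 (j%:R * Num.max 0 (r - `|c - (x : 'rV[R]_n)|)).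
have ch j : continuous (h j : 'rV[R]_n -> R).
  move=> x; apply: (@continuous_min _ _ (cst (1 : R)) (fun x : 'rV[R]_n => j%:R * Num.max 0 (r - `|c - x|))).
    exact: cst_continuous.
  apply: continuousM; first exact: cst_continuous.
  apply: (@continuous_max _ _ (cst (0 : R)) (fun x : 'rV[R]_n => r - `|c - x|)); first exact: cst_continuous.
  apply: continuousB; first exact: cst_continuous.
  apply: (@continuous_comp _ _ _ (fun x : 'rV[R]_n => c - x) (@Num.norm R 'rV[R]_n)); last exact: norm_continuous.
  by apply: (@continuousB R 'rV[R]_n); [exact: cst_continuous|exact: cvg_id].
have h01 j x : 0 <= h j x <= 1.
  by rewrite /h ge_min lexx/= le_min ler01/= mulr_ge0// le_max lexx.
apply: (@good_lim _ h) => //.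
- by apply: (@borel_open 'rV[R]_n); exact: ball_open.
- by move=> j; apply: mA01.
- move=> j e e0; exists (h j) => //.
  rewrite /sqint; under eq_integral do rewrite subrr expr0n/=.
  by rewrite integral0 lee_fin ltW.
- move=> x _; rewrite indicE -ball_normE.
  have [xr|xr] := ltP `|c - (x : 'rV[R]_n)| r.
    rewrite mem_set//=; apply: (@cvg_near_cst _ _ _ _ _).
    have [N rN] : exists N : nat, (r - `|c - (x : 'rV[R]_n)|)^-1 <= N%:R.
      by exists (Num.bound (r - `|c - (x : 'rV[R]_n)|)^-1); apply/ltW/archi_boundP; rewrite invr_ge0 subr_ge0 ltW.
    exists N => // j /= Nj; rewrite /h max_r ?subr_ge0 ?(ltW xr)//.
    apply/eqP; rewrite eq_minl// -ler_pdivrMr ?subr_gt0// mul1r (le_trans rN)//.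
    by rewrite ler_nat.
  rewrite memNset /=; last by apply/negP; rewrite -leNgt.
  apply: cvg_near_cst; apply: nearW => j; rewrite /h max_l ?subr_le0// mulr0.
  by rewrite min_r.
Qed.

Let good_setC E : good E -> good (~` E).
Proof.
move=> [mE gE]; split; first exact: measurableC.
move=> e e0; have [k [ck k01] kE] := gE e e0.
exists (fun x => 1 - k x); first split.
- by move=> x; apply: continuousB; [exact: cst_continuous|exact: ck].
- by move=> x; have := k01 x; lra.
apply: le_trans kE; rewrite le_eqVlt; apply/orP; left; apply/eqP.
apply: eq_integral => x _; congr EFin; rewrite !indicE in_setC; case: (x \in E) => /=; ring.
Qed.

Let good_setU E E' : good E -> good E' -> good (E `|` E').
Proof.
move=> [mE gE] [mE' gE']; split; first exact: measurableU.
move=> e e0; have e2 : 0 < e / 2 by rewrite divr_gt0.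
have [k [ck k01] kE] := gE _ e2; have [l [cl l01] lE] := gE' _ e2.
have mk : measurable_fun D k by exact: mA01.
have ml : measurable_fun D l by exact: mA01.
exists (fun x => Num.max (k x) (l x)); first split.
- by move=> x; apply: continuous_max; [exact: ck|exact: cl].
- by move=> x; rewrite le_max ge_max; have := k01 x; have := l01 x; case/andP=> -> ->; case/andP => -> ->.
apply: (@le_trans _ _ (sqint lambda D (fun x => \1_E x - k x)%R + sqint lambda D (fun x => \1_E' x - l x)%R)%E); last first.
  by rewrite [e]splitr EFinD leeD.
rewrite /sqint -ge0_integralD//; last 4 first.
- by move=> x _; rewrite lee_fin sqr_ge0.
- by apply: measurable_sqr; apply: measurable_funB => //; exact: mindic.
- by move=> x _; rewrite lee_fin sqr_ge0.
- by apply: measurable_sqr; apply: measurable_funB => //; exact: mindic.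
apply: ge0_le_integral => //.
- by move=> x _; rewrite lee_fin sqr_ge0.
- apply: measurable_sqr; apply: measurable_funB.
    by apply: mindic; exact: measurableU.
  exact: measurable_maxr.
- apply: emeasurable_funD; apply: measurable_sqr; apply: measurable_funB => //; exact: mindic.
- move=> x _; rewrite -EFinD lee_fin !indicE in_setU.
  by case: (x \in E); case: (x \in E') => /=; have := k01 x; have := l01 x; case: (leP (k x) (l x)); nra.
Qed.

Let good_bigcup (E : nat -> set (borel 'rV[R]_n)) : (forall i, good (E i)) -> good (\bigcup_i E i).
Proof.
move=> gE.
have gU N : good (\big[setU/set0]_(i < N) E i).
  elim: N => [|N IH]; last by rewrite big_ord_recr; exact: good_setU.
  rewrite big_ord0; have := good_ball 0 (0 : R).
  by rewrite (_ : ball _ _ = set0)// -subset0 -ball_normE => x /=; rewrite normr_lt0.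
apply: (@good_lim _ (fun N => \1_(\big[setU/set0]_(i < N) E i))).
- by apply: bigcup_measurable => i _; have [] := gE i.
- by move=> N; apply: mindic; have [] := gU N.
- by move=> N; have [] := gU N.
- by move=> N x; rewrite indicE; case: (_ \in _); rewrite /= ?lexx ?ler01.
- move=> x _; rewrite indicE; have [xE|xE] := pselect ((\bigcup_i E i) x).
    rewrite mem_set//; have [i _ Eix] := xE; apply: cvg_near_cst.
    exists i.+1 => // N /= iN; rewrite indicE mem_set//.
    by rewrite -bigcup_mkord; exists i.
  rewrite memNset//; apply: cvg_near_cst; apply: nearW => N.
  rewrite indicE memNset// => xN; apply: xE; move: xN.
  by rewrite -bigcup_mkord => -[i _ ?]; exists i.
Qed.

(** The good sets are closed under complements and countable unions, and an open set is good as a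
    countable union of balls. *)
Let good_measurable E : measurable E -> good E.
Proof.
apply: (@smallest_sub _ (sigma_algebra setT) (@open 'rV[R]_n) good).
  split.
  - have := good_ball 0 (0 : R).
    by rewrite (_ : ball _ _ = set0)// -subset0 -ball_normE => x /=; rewrite normr_lt0.
  - by move=> A gA; rewrite setTD; exact: good_setC.
  - exact: good_bigcup.
move=> V oV; have [c [P ->]] := open_rV_bigcup_ball oV.
pose F i := if unpickle i is Some k then
   (if P k then ball (c k) k.2.+1%:R^-1 else set0) else set0 : set (borel 'rV[R]_n).
rewrite (_ : \bigcup_k _ = \bigcup_i F i); last first.
  apply/seteqP; split => x [k _ xk].
    by exists (pickle k) => //; rewrite /F pickleK.
  by move: xk; rewrite /F; case: (unpickle k) => // k' xk'; exists k'.
have g0 : good set0.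
  have := good_ball 0 (0 : R).
  by rewrite (_ : ball _ _ = set0)// -subset0 -ball_normE => x /=; rewrite normr_lt0.
by apply: good_bigcup => i; rewrite /F; case: (unpickle i) => // k; case: ifP => _ //; exact: good_ball.
Qed.

Let C : set (borel 'rV[R]_n -> R) := [set k | continuous (k : 'rV[R]_n -> R)].

Let mC k : C k -> measurable_fun D k.
Proof. by move=> ck; apply: measurable_funTS; exact: continuous_measurable_rV. Qed.

Let CD k l : C k -> C l -> C (fun x => k x + l x).
Proof. by move=> ck cl x; apply: continuousD; [exact: ck|exact: cl]. Qed.

Let CZ k c : C k -> C (fun x => c * k x).
Proof. by move=> ck x; apply: continuousM; [exact: cst_continuous|exact: ck]. Qed.

Let nnsfun_dense (s : {nnsfun (borel 'rV[R]_n) >-> R}) : L2_approx lambda C D s.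
Proof.
have iE y : L2_approx lambda C D (fun x => y * \1_(s @^-1` [set y]) x).
  have mY : measurable (s @^-1` [set y]) by exact: measurable_sfunP.
  apply: (L2_approxZ mD mC CZ); first exact: mindic.
  by move=> e /((good_measurable mY).2 e)[k [ck _] ?]; exists k.
have H (r : seq R) : L2_approx lambda C D (fun x => \sum_(y <- r) y * \1_(s @^-1` [set y]) x).
  elim: r => [|y r IH].
    move=> e e0; exists (cst 0); first exact: cst_continuous.
    rewrite /sqint; under eq_integral do rewrite big_nil subrr expr0n/=.
    by rewrite integral0 lee_fin ltW.
  rewrite (_ : (fun x => _) = (fun x => y * \1_(s @^-1` [set y]) x + \sum_(z <- r) z * \1_(s @^-1` [set z]) x)); last first.
    by apply/funext => x; rewrite big_cons.
  apply: (L2_approxD mD mC CD) => //.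
    by apply: measurable_funM => //; apply: mindic; exact: measurable_sfunP.
  by apply: measurable_sum => z; apply: measurable_funM => //; apply: mindic; exact: measurable_sfunP.
rewrite (_ : (s : _ -> _) = fun x => \sum_(y <- finmap.enum_fset (fset_set (range s))) y * \1_(s @^-1` [set y]) x).
  exact: H.
by apply/funext => x; rewrite {1}(fimfunE s x) fsbig_finite.
Qed.

Let nonneg_dense f : measurable_fun D f -> (forall x, D x -> 0 <= f x) ->
  (sqint lambda D f < +oo)%E -> L2_approx lambda C D f.
Proof.
move=> mf f0 foo.
have mEf : measurable_fun D (EFin \o f) by exact/measurable_EFinP.
have [g [ndg cg]] := @approximation _ _ R D mD (EFin \o f) mEf f0.
have cg' x : D x -> (fun k => g k x) @ \oo --> f x.
  move=> Dx; have H : (EFin \o (fun k => g k x)) @ \oo --> (f x)%:E := cg x Dx.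
  exact: (fine_cvg H).
have mg k : measurable_fun D (g k) by exact: measurable_funTS.
apply: (L2_approx_lim mD mC mf mg (fun k => nnsfun_dense (g k))).
apply: (sqint_cvg0 mD mg mf mf foo cg') => k x Dx.
have gf : g k x <= f x.
  have nd : nondecreasing_seq (fun k => g k x) by move=> a b ab; have /lefP := ndg a b ab; apply.
  have := nondecreasing_cvgn_le nd (cvgP _ (cg' x Dx)) k.
  by rewrite (cvg_lim _ (cg' x Dx)).
have g0 : 0 <= g k x by exact: fun_ge0.
have fx0 := f0 x Dx; rewrite ler_norml (ger0_norm fx0); lra.
Qed.

Lemma continuous_dense_L2 f : measurable_fun D f -> (sqint lambda D f < +oo)%E ->
  forall e, 0 < e -> exists2 k, continuous (k : 'rV[R]_n -> R) &
    (sqint lambda D (fun x => f x - k x)%R <= e%:E)%E.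
Proof.
move=> mf foo.
have mp : measurable_fun D (fun x => Num.max (f x) 0) by exact: measurable_maxr.
have mm : measurable_fun D (fun x => Num.max (- f x) 0).
  by apply: measurable_maxr => //; exact: measurableT_comp.
suff H : L2_approx lambda C D (fun x => Num.max (f x) 0 + (- 1) * Num.max (- f x) 0).
  move=> e e0; have [k ck kf] := H e e0; exists k => //.
  apply: le_trans kf; rewrite le_eqVlt; apply/orP; left; apply/eqP.
  apply: eq_integral => x _; congr (_ ^+ 2)%:E; congr (_ - _).
  by case: (leP (f x) 0) => fx; [rewrite max_l ?oppr_ge0//|rewrite max_r ?oppr_le0 ?ltW//]; ring.
apply: (L2_approxD mD mC CD) => //; first exact: measurable_funM.
  apply: nonneg_dense => //; first by move=> x _; rewrite le_max lexx orbT.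
  apply: le_lt_trans foo; apply: sqint_le => // x _.
  by case: (leP (f x) 0) => fx; rewrite ?normr0.
apply: (L2_approxZ mD mC CZ) => //; apply: nonneg_dense => //; first by move=> x _; rewrite le_max lexx orbT.
apply: le_lt_trans foo; apply: sqint_le => // x _.
by case: (leP (- f x) 0) => fx; rewrite ?normr0 ?normrN.
Qed.

End continuous_density.

(** With m the mean of [h] for the probability density [w], the inequality says that the variance,
    the integral of (h - m)^2 w, is nonnegative. Integrability of h w comes from |h| <= 1 + h^2. *)
Lemma jensen_square d (T : measurableType d) (R : realType) (mu : {measure set T -> \bar R})
    (h w : T -> R) : measurable_fun setT h -> measurable_fun setT w ->
  (forall x, 0 <= w x) -> (\int[mu]_x (w x)%:E = 1)%E ->
  (\int[mu]_x (h x ^+ 2 * w x)%:E < +oo)%E ->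
  mu.-integrable setT (fun x => (h x * w x)%:E) /\
  (((\int[mu]_x (h x * w x)) ^+ 2)%:E <= \int[mu]_x (h x ^+ 2 * w x)%:E)%E.
Proof.
move=> mh mw w0 w1 hoo.
have mhw : measurable_fun setT (fun x => h x * w x) by exact: measurable_funM.
have mhhw : measurable_fun setT (fun x => h x ^+ 2 * w x).
  by apply: measurable_funM => //; exact: measurable_funX.
have iw : mu.-integrable setT (EFin \o w).
  apply/integrableP; split; first exact/measurable_EFinP.
  by under eq_integral => x _ do rewrite gee0_abs ?lee_fin//; rewrite w1 ltry.
have ihhw : mu.-integrable setT (EFin \o (fun x => h x ^+ 2 * w x)).
  apply/integrableP; split; first exact/measurable_EFinP.
  apply: le_lt_trans hoo; rewrite le_eqVlt; apply/orP; left; apply/eqP.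
  by apply: eq_integral => x _; rewrite /= ger0_norm// mulr_ge0// sqr_ge0.
have ihw : mu.-integrable setT (EFin \o (fun x => h x * w x)).
  apply: (@le_integrable _ _ _ mu setT measurableT _ (fun x => (w x + h x ^+ 2 * w x)%:E)).
  - exact/measurable_EFinP.
  - move=> x _; rewrite /= lee_fin normrM (ger0_norm (w0 x)) [leRHS]ger0_norm; last first.
      by rewrite addr_ge0// mulr_ge0// sqr_ge0.
    rewrite -[X in X + _]mul1r -mulrDl ler_wpM2r//.
    have := sqr_ge0 (`|h x| - 1); rewrite -[h x ^+ 2](real_normK (num_real _)).
    have := normr_ge0 (h x); nra.
  - rewrite (_ : (fun x => _) = (EFin \o w) \+ (EFin \o (fun x => h x ^+ 2 * w x)%R))%E.
      exact: integrableD.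
    by apply/funext.
split => //.
set m := (\int[mu]_x (h x * w x)).
have I2 : (\int[mu]_x (h x ^+ 2 * w x)%:E)%E = (\int[mu]_x (h x ^+ 2 * w x))%:E.
  by rewrite /Rintegral fineK//; exact: integrable_fin_num.
rewrite I2 lee_fin -subr_ge0.
have W1 : \int[mu]_x w x = 1 by rewrite /Rintegral w1.
have E : \int[mu]_x ((h x - m) ^+ 2 * w x) =
    \int[mu]_x (h x ^+ 2 * w x) - m ^+ 2.
  rewrite (@eq_Rintegral _ _ _ _ _ (fun x => (h x ^+ 2 * w x - (2 * m) * (h x * w x)) + m ^+ 2 * w x)); last first.
    by move=> x _; ring.
  rewrite RintegralD//; last 2 first.
  - rewrite (_ : _ \o _ = (EFin \o (fun x => h x ^+ 2 * w x)%R) \-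
      (fun x => (2 * m)%R%:E * (EFin \o (fun x => h x * w x)%R) x))%E.
      by apply: integrableB => //; exact: integrableZl.
    by apply/funext => x.
  - rewrite (_ : _ \o _ = (fun x => (m ^+ 2)%R%:E * (EFin \o w) x))%E; first exact: integrableZl.
    by apply/funext.
  rewrite RintegralB//; last first.
    rewrite (_ : _ \o _ = (fun x => (2 * m)%R%:E * (EFin \o (fun x => h x * w x)%R) x))%E; first exact: integrableZl.
    by apply/funext.
  by rewrite RintegralZl// RintegralZl// W1 -/m; ring.
by rewrite -E; apply: Rintegral_ge0 => x _; rewrite mulr_ge0// sqr_ge0.
Qed.

(** * Translations and their continuity in L^2 *)

Section translations.
Context {R : realType} {n : nat}.
Local Notation lambda := (lebesgue_rV R n).
Implicit Types (f : borel 'rV[R]_n -> R).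

Lemma measurable_shift (h : 'rV[R]_n) :
  measurable_fun setT ((fun x : 'rV[R]_n => x + h) : borel 'rV[R]_n -> borel 'rV[R]_n).
Proof.
apply: continuous_borel_fun; first exact: openT.
by move=> p _; apply: (@cvgD R 'rV[R]_n _ (nbhs p) _ id (cst h) p h); [exact: cvg_id|exact: cvg_cst].
Qed.

Lemma measurable_fun_shift f (h : 'rV[R]_n) : measurable_fun setT f ->
  measurable_fun setT (fun x : borel 'rV[R]_n => f ((x : 'rV[R]_n) + h)).
Proof. by move=> mf; apply: (measurableT_comp mf); exact: measurable_shift. Qed.

Lemma integral_rV_shift (h : 'rV[R]_n) (f : borel 'rV[R]_n -> \bar R) :
  measurable_fun setT f ->
  (\int[lambda]_x f ((x : 'rV[R]_n) + h)%R = \int[lambda]_x f x)%E.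
Proof.
move=> mf; rewrite [LHS]integralE [RHS]integralE; congr (_ - _)%E.
  rewrite -(ge0_integral_rV_shift h (measurable_funepos mf) (fun x => funepos_ge0 f x)).
  by apply: eq_integral => x _; rewrite !funeposE.
rewrite -(ge0_integral_rV_shift h (measurable_funeneg mf) (fun x => funeneg_ge0 f x)).
by apply: eq_integral => x _; rewrite !funenegE.
Qed.

Lemma box_norm (N : R) (x : 'rV[R]_n) : 0 <= N -> @box R n N x <-> `|x| <= N.
Proof.
move=> N0; rewrite [X in _ <-> X <= _]/Num.norm/= mx_normrE; split.
  by move=> H; apply: bigmax_le => // -[i j] _ /=; rewrite ord1.
move=> H i; apply: le_trans H.
exact: (le_bigmax _ (fun ij => `|x ij.1 ij.2|) (0, i)).
Qed.

Lemma sqint_shift_le f N (z : 'rV[R]_n) : 0 <= N -> measurable_fun setT f -> `|z| <= 1 ->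
  (sqint lambda (box N) (fun x => f ((x : 'rV[R]_n) + z)%R) <= sqint lambda (box (N + 1)) f)%E.
Proof.
move=> N0 mf z1; rewrite /sqint integral_mkcond [leRHS]integral_mkcond.
have mg : measurable_fun setT ((fun x => (f x ^+ 2)%:E) \_ (@box R n (N + 1))).
  apply/(measurable_restrictT _ _).1; first exact: measurable_box.
  by apply: measurable_sqr; exact: measurable_funTS.
rewrite -[leRHS](integral_rV_shift z mg).
apply: ge0_le_integral => //.
- by move=> x _; rewrite /patch; case: ifP => // _; rewrite lee_fin sqr_ge0.
- apply/(measurable_restrictT _ _).1; first exact: measurable_box.
  by apply: measurable_sqr; apply: measurable_funTS; exact: measurable_fun_shift.
- by apply: (measurableT_comp mg); exact: measurable_shift.
- move=> x _; rewrite /patch; case: ifPn => [|_]; last first.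
    by case: ifP => // _; rewrite lee_fin sqr_ge0.
  rewrite inE => /(box_norm _ N0) xN; rewrite mem_set//.
  apply/box_norm; first by rewrite addr_ge0.
  by rewrite (le_trans (ler_normD _ _))// lerD.
Qed.

Lemma compact_box (N : R) : compact (@box R n N : set 'rV[R]_n).
Proof.
apply: bounded_closed_compact; last exact: closed_box.
exists `|N|; split; first exact: num_real.
move=> M NM x /= xN; rewrite [leLHS]/Num.norm/= mx_normrE.
apply: bigmax_le; first by rewrite (le_trans _ (ltW NM)).
by move=> [i j] _ /=; rewrite ord1 (le_trans (xN j))// (le_trans (ler_norm _))// ltW.
Qed.

Lemma uniform_shift_continuous (k : 'rV[R]_n -> R) N e : continuous k -> 0 < e ->
  exists2 d : R, 0 < d & forall z x : 'rV[R]_n, `|z| <= d -> @box R n N x ->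
    `|k (x + z) - k x| <= e.
Proof.
move=> ck e0.
have /(_ 'rV[R]_n (nbhs (0 : 'rV[R]_n)) (fun z x => `|k (x + z) - k x| <= e) (nbhs_filter _)) :=
  (compact_near_coveringP (@box R n N : set 'rV[R]_n)).1 (@compact_box N).
have H : forall x, @box R n N x -> \forall x' \near x & z \near nbhs (0 : 'rV[R]_n), `|k (x' + z) - k x'| <= e.
  move=> x _.
  have e2 : 0 < e / 2 by rewrite divr_gt0.
  have /(@cvgrPdist_le R R 'rV[R]_n (nbhs x) (nbhs_filter x))/(_ _ e2)/nbhs_ballP[d /= d0 dk] := ck x.
  exists (ball x (d / 2), ball 0 (d / 2)).
    by split; apply: nbhsx_ballx; rewrite divr_gt0.
  move=> [x' z] /=; rewrite -!ball_normE /= sub0r normrN => -[xx' zd].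
  have k1 := dk x'; have k2 := dk (x' + z).
  have -> : k (x' + z) - k x' = (k x - k x') - (k x - k (x' + z)) by ring.
  rewrite (le_trans (ler_normB _ _))// [leRHS]splitr lerD//.
    by apply: k1; rewrite -ball_normE/= (lt_trans xx')// ltr_pdivrMr// mulr2n mulrDr mulr1 ltrDl.
  apply: k2; rewrite -ball_normE/= opprD addrA (le_lt_trans (ler_normB _ _))//.
  by rewrite [ltRHS]splitr ltrD.
move=> /(_ H)/nbhs_ballP[d /= d0 dP].
exists (d / 2); first by rewrite divr_gt0.
move=> z x zd xN; apply: dP => //.
rewrite -ball_normE/= sub0r normrN (le_lt_trans zd)// ltr_pdivrMr//.
by rewrite mulr2n mulrDr mulr1 ltrDl.
Qed.

(** For [k] continuous and L^2-close to [f], the increment of [f] splits into the translate of f -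
    k, the increment of [k], which is uniformly small on the box, and k - f. The box grows by 1
    because only shifts of norm at most 1 are used. *)
Lemma L2_translation_continuous f (N e : R) : 0 <= N -> measurable_fun setT f ->
  (sqint lambda (box (N + 1)) f < +oo)%E -> 0 < e ->
  exists2 d : R, 0 < d & forall z : 'rV[R]_n, `|z| <= d ->
    (sqint lambda (box N) (fun x => f ((x : 'rV[R]_n) + z) - f x)%R <= e%:E)%E.
Proof.
move=> N0 mf foo e0; have N1 : 0 <= N + 1 by rewrite addr_ge0.
have mb M := @measurable_box R n M.
(* The bound on the square of a sum is used twice, and 2 (2 (e/16 + e/16) + e/16) is below [e]. *)
have e16 : 0 < e / 16 by rewrite divr_gt0.
have boo : (lambda (@box R n (N + 1)) < +oo)%E by rewrite lebesgue_rV_box// ltry.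
have mfN M : measurable_fun (@box R n M) f by exact: measurable_funTS.
have [k ck kf] := continuous_dense_L2 (mb _) boo (mfN _) foo e16.
have mk : measurable_fun setT (k : borel 'rV[R]_n -> R) by exact: continuous_measurable_rV.
pose V := (N *+ 2) ^+ n; have V0 : 0 <= V by rewrite exprn_ge0// mulrn_wge0.
(* This makes c^2 times the volume [V] of the box at most e/16; adding 1 avoids a division by
   zero. *)
pose c := Num.sqrt (e / 16 / (V + 1)).
have Vp : 0 < V + 1 by rewrite ltr_wpDl.
have c0 : 0 < c by rewrite sqrtr_gt0 divr_gt0.
have [d d0 dk] := uniform_shift_continuous N ck c0.
exists (Num.min d 1); first by rewrite lt_min d0 ltr01.
move=> z; rewrite le_min => /andP[zd z1].
pose g1 (x : borel 'rV[R]_n) : R := f ((x : 'rV[R]_n) + z) - k ((x : 'rV[R]_n) + z).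
pose g2 (x : borel 'rV[R]_n) : R := k ((x : 'rV[R]_n) + z) - k x.
pose g3 (x : borel 'rV[R]_n) : R := (- 1) * (f x - k x).
have mfk : measurable_fun setT (fun x => f x - k x) by exact: measurable_funB.
have mg1 : measurable_fun setT g1 by exact: (measurable_fun_shift z mfk).
have mg2 : measurable_fun setT g2.
  by apply: measurable_funB => //; exact: (measurable_fun_shift z mk).
have mg3 : measurable_fun setT g3 by exact: measurable_funM.
have s1 : (sqint lambda (box N) g1 <= (e / 16)%:E)%E.
  exact: le_trans (sqint_shift_le N0 mfk z1) kf.
have s2 : (sqint lambda (box N) g2 <= (e / 16)%:E)%E.
  apply: (@le_trans _ _ (\int[lambda]_(x in box N) (cst (c ^+ 2)%:E x))%E).
    apply: ge0_le_integral => //.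
    - by move=> x _; rewrite lee_fin sqr_ge0.
    - by apply: measurable_sqr; exact: measurable_funTS.
    - move=> x xN; rewrite lee_fin -[g2 x ^+ 2](real_normK (num_real _)).
      by rewrite lerXn2r ?nnegrE ?(ltW c0)// dk.
  rewrite integral_cst// [X in (_ * X)%E](lebesgue_rV_box n N0) -EFinM lee_fin sqr_sqrtr; last first.
    by rewrite ltW// divr_gt0.
  by rewrite -/V mulrAC ler_pdivrMr// ler_wpM2l ?(ltW e16)// lerDl.
have s3 : (sqint lambda (box N) g3 <= (e / 16)%:E)%E.
  rewrite sqintZ//; last exact: measurable_funTS.
  rewrite sqrrN expr1n mul1e; apply: le_trans kf.
  apply: ge0_subset_integral => //.
  - by apply: measurable_sqr; exact: measurable_funTS.
  - by move=> x _; rewrite lee_fin sqr_ge0.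
  - by move=> x xN i; rewrite (le_trans (xN i))// lerDl.
have -> : sqint lambda (box N) (fun x => f ((x : 'rV[R]_n) + z) - f x) =
    sqint lambda (box N) (fun x => (g1 x + g2 x) + g3 x).
  by apply: eq_integral => x _; congr (_ ^+ 2)%:E; rewrite /g1 /g2 /g3; ring.
have mT (g : borel 'rV[R]_n -> R) : measurable_fun setT g -> measurable_fun (@box R n N) g by move=> ?; exact: measurable_funTS.
apply: le_trans (sqintD_le _ (mb N) (mT _ (measurable_funD mg1 mg2)) (mT _ mg3)) _.
apply: (@le_trans _ _ (2%:E * ((2%:E * ((e / 16)%:E + (e / 16)%:E)) + (e / 16)%:E))%E).
  rewrite lee_pmul2l// leeD//.
  apply: le_trans (sqintD_le _ (mb N) (mT _ mg1) (mT _ mg2)) _.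
  by rewrite lee_pmul2l// leeD.
by rewrite [leLHS](_ : _ = (2 * (2 * (e / 16 + e / 16) + e / 16))%R%:E)// lee_fin; lra.
Qed.

End translations.

Section bounded_multipliers.
Context d (T : measurableType d) (R : realType) (mu : {measure set T -> \bar R}).
Implicit Types (D : set T) (f g : T -> R).

Lemma integrable_EFinD D f g : measurable D -> mu.-integrable D (EFin \o f) ->
  mu.-integrable D (EFin \o g) -> mu.-integrable D (EFin \o (fun x => f x + g x)).
Proof.
move=> mD fi gi; rewrite (_ : _ \o _ = (EFin \o f) \+ (EFin \o g))%E; first exact: integrableD.
by apply/funext.
Qed.

Lemma integrable_EFinB D f g : measurable D -> mu.-integrable D (EFin \o f) ->
  mu.-integrable D (EFin \o g) -> mu.-integrable D (EFin \o (fun x => f x - g x)).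
Proof.
move=> mD fi gi; rewrite (_ : _ \o _ = (EFin \o f) \- (EFin \o g))%E; first exact: integrableB.
by apply/funext.
Qed.

Lemma integrable_EFinZ D f c : measurable D -> mu.-integrable D (EFin \o f) ->
  mu.-integrable D (EFin \o (fun x => c * f x)).
Proof.
move=> mD fi; rewrite (_ : _ \o _ = (fun x => c%:E * (EFin \o f) x)%E); first exact: integrableZl.
by apply/funext.
Qed.

Lemma integrable_mul_bounded D f g C : measurable D -> mu.-integrable D (EFin \o f) ->
  measurable_fun D g -> (forall x, D x -> `|g x| <= C) ->
  mu.-integrable D (EFin \o (fun x => f x * g x)).
Proof.
move=> mD fi mg gC.
have mf : measurable_fun D f by apply/measurable_EFinP; exact: measurable_int fi.
apply: (@le_integrable _ _ _ mu D mD _ (fun x => (C%:E * (EFin \o f) x)%E)).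
- by apply/measurable_EFinP; exact: measurable_funM.
- move=> x Dx /=; rewrite lee_fin normrM mulrC normrM ler_wpM2r//.
  by rewrite (le_trans (gC x Dx))// ler_norm.
- exact: integrableZl.
Qed.

Lemma Rintegral_mul_le D f g C : measurable D -> mu.-integrable D (EFin \o f) ->
  measurable_fun D g -> (forall x, D x -> `|g x| <= C) ->
  `|\int[mu]_(x in D) (f x * g x)| <= C * \int[mu]_(x in D) `|f x|.
Proof.
move=> mD fi mg gC.
have fgi := integrable_mul_bounded mD fi mg gC.
have nfi : mu.-integrable D (EFin \o (fun x => `|f x|)).
  by rewrite (_ : _ \o _ = abse \o (EFin \o f)); [exact: integrable_abse|apply/funext].
apply: le_trans (le_normr_Rintegral _ _) _ => //.
rewrite -RintegralZl//; apply: le_Rintegral => //.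
- by rewrite (_ : _ \o _ = abse \o (EFin \o (fun x => f x * g x))); [exact: integrable_abse|apply/funext].
- by rewrite (_ : _ \o _ = (fun x => C%:E * (EFin \o (fun x => `|f x|%R)) x)%E); [exact: integrableZl|apply/funext].
- by move=> x Dx; rewrite normrM mulrC ler_wpM2r// gC.
Qed.

End bounded_multipliers.

(** * Test functions and bumps *)

Section test_functions.
Context {R : realType} {n : nat}.
Implicit Types (U : set 'rV[R]_n) (psi : 'rV[R]_n -> R).

Lemma tsupport_out {T : topologicalType} (f : T -> R) x : ~ tsupport f x -> f x = 0.
Proof. by move=> xs; apply/eqP/negPn/negP => fx; apply: xs; exact: subset_closure. Qed.

Lemma tsupport_sub {T : topologicalType} (f : T -> R) (K : set T) : closed K ->
  (forall x, ~ K x -> f x = 0) -> tsupport f `<=` K.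
Proof.
move=> cK fK; rewrite ((closure_id K).1 cK); apply: closureS => x /= fx.
by apply: contrapT => /fK fx0; move: fx; rewrite fx0 eqxx.
Qed.

Lemma partial_tsupport_out psi i p : ~ tsupport psi p -> partial i psi p = 0.
Proof.
move=> ps.
have [_ ] : is_derive p (delta_mx 0 i : 'rV[R]_n) psi 0; last exact.
apply: (@is_derive_near_eq R _ _ (~` tsupport psi) (cst 0)) => //.
- by apply: closed_openC; exact: closed_closure.
- by move=> q; rewrite inE => /tsupport_out ->.
Qed.

Lemma test_function_partial U psi i : test_function U psi -> test_function U (partial i psi).
Proof.
move=> [spsi cpsi psiU].
have sub : tsupport (partial i psi) `<=` tsupport psi.
  by apply: tsupport_sub; [exact: closed_closure|move=> x; exact: partial_tsupport_out].
split; first exact: smooth_on_partial.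
- by apply: subclosed_compact sub => //; exact: closed_closure.
- exact: subset_trans sub psiU.
Qed.

Lemma test_function_continuous U psi : test_function U psi -> continuous psi.
Proof. by move=> [spsi _ _] p; exact: smooth_on_continuous spsi _. Qed.

Lemma compact_continuous_bounded {T : topologicalType} (K : set T) (f : T -> R) :
  compact K -> {within K, continuous f} -> exists C, forall x, K x -> `|f x| <= C.
Proof.
move=> cK cf; have := continuous_compact cf cK.
move=> /compact_bounded[C [_ /(_ (C + 1))]]; rewrite ltrDl => /(_ ltr01) H.
by exists (C + 1) => x Kx; apply: H; exists x.
Qed.

Lemma test_function_bounded U psi : test_function U psi -> exists C, forall p, `|psi p| <= C.
Proof.
move=> tpsi; have [_ cpsi _] := tpsi.
have [C CP] := compact_continuous_bounded cpsi
  (continuous_subspaceT (test_function_continuous tpsi)).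
exists `|C| => p; have [ps|ps] := pselect (tsupport psi p).
  by rewrite (le_trans (CP _ ps))// ler_norm.
by rewrite (tsupport_out ps) normr0.
Qed.

Lemma ler_coord_norm (h : 'rV[R]_n) i : `|h 0 i| <= `|h|.
Proof.
rewrite [leRHS]/Num.norm/= mx_normrE.
exact: (le_bigmax _ (fun ij => `|h ij.1 ij.2|) (0, i)).
Qed.

Lemma test_function_lipschitz U psi : test_function U psi ->
  exists2 L, 0 <= L & forall p h, `|psi (p + h) - psi p| <= L * `|h|.
Proof.
move=> tpsi; have [spsi _ _] := tpsi.
have [C CP] : exists C : 'I_n -> R, forall i p, `|partial i psi p| <= C i.
  have := @choice _ _ (fun i c => forall p, `|partial i psi p| <= c).
  case=> [i|C CP]; last by exists C.
  exact: (test_function_bounded (test_function_partial i tpsi)).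
have C0 i : 0 <= C i by apply: le_trans (CP i 0).
exists (\sum_i C i); first by rewrite sumr_ge0.
move=> p h.
have df q : differentiable psi q by exact: (smooth_on_differentiable openT spsi).
have [t _|c _ ->] := @mean_value_line R _ psi p h; first exact: diff_derivable.
rewrite deriveE// diff_partial// (le_trans (ler_norm_sum _ _ _))// mulr_suml ler_sum// => i _.
by rewrite normrM mulrC ler_pM// ler_coord_norm.
Qed.

(** A product over the coordinates, so that the bump lives on a ball of the sup norm, which is the
    norm of row vectors. *)
Definition bump (c : 'rV[R]_n) (r : R) (p : 'rV[R]_n) : R :=
  \prod_(i < n) flat_exp 0 (r ^+ 2 - (p 0 i - c 0 i) ^+ 2).

Lemma bump_ge0 c r p : 0 <= bump c r p.
Proof. by apply: prodr_ge0 => i _; exact: flat_exp_ge0. Qed.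

Lemma bump_gt0 c r p : `|p - c| < r -> 0 < bump c r p.
Proof.
move=> pr; apply: prodr_gt0 => i _; apply: flat_exp_gt0.
have := le_lt_trans (ler_coord_norm (p - c) i) pr; rewrite !mxE => H.
rewrite subr_gt0 -[X in X < _](real_normK (num_real _)) ltrXn2r ?nnegrE//.
Qed.

Lemma bump_out c r p : 0 <= r -> r < `|p - c| -> bump c r p = 0.
Proof.
move=> r0 rp; apply/eqP; rewrite prodf_seq_eq0; apply/hasP.
have [i ri] : exists i, r < `|(p - c) 0 i|.
  apply: contrapT => H; move: rp; rewrite ltNge => /negP; apply.
  rewrite [leLHS]/Num.norm/= mx_normrE; apply: bigmax_le => // -[j i] _ /=.
  by rewrite ord1 leNgt; apply/negP => ri; apply: H; exists i.
exists i; first exact: mem_index_enum.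
rewrite /flat_exp subr_gt0 ltNge -[X in _ <= X](real_normK (num_real _)).
by move: ri; rewrite !mxE => ri; rewrite lerXn2r ?nnegrE ?(ltW ri)//= eqxx.
Qed.

Lemma smooth_on_bump c r : smooth_on setT (bump c r).
Proof.
apply: smooth_on_prod => [|i]; first exact: openT.
apply: smooth_on_flat_exp; first exact: openT.
have sx : smooth_on setT (fun p : 'rV[R]_n => p 0 i + - c 0 i).
  apply: smooth_onD; [exact: openT| |apply: smooth_on_cst; exact: openT].
  by apply: smooth_on_coord; exact: openT.
apply: (@smooth_on_algebra R n setT); first exact: openT.
rewrite (_ : (fun p => _) = (fun p : 'rV[R]_n => r ^+ 2 + (- 1) * ((p 0 i + - c 0 i) * (p 0 i + - c 0 i)))).
  apply: algebra_add; first exact: algebra_cst.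
  apply: algebra_mul; first exact: algebra_cst.
  by apply: algebra_mul; exact: algebra_gen.
by apply/funext => p; ring.
Qed.

Lemma tsupport_bump c r : 0 <= r -> tsupport (bump c r) `<=` [set p | `|p - c| <= r].
Proof.
move=> r0; apply: tsupport_sub.
  apply: (@preimage_closed _ _ (fun p : 'rV[R]_n => `|p - c|) [set t | t <= r]); last exact: closed_le.
  move=> p _; apply: (@continuous_comp _ _ _ (fun x : 'rV[R]_n => x - c) (@Num.norm R 'rV[R]_n)); last exact: norm_continuous.
  by apply: (@continuousB R 'rV[R]_n); [exact: cvg_id|exact: cst_continuous].
by move=> p /= /negP; rewrite -ltNge; exact: bump_out.
Qed.

Lemma test_function_bump U c r : 0 <= r -> [set p | `|p - c| <= r] `<=` U ->
  test_function U (bump c r).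
Proof.
move=> r0 cU; split; first exact: smooth_on_bump.
- apply: bounded_closed_compact; last exact: closed_closure.
  exists (r + `|c|); split; first exact: num_real.
  move=> M rM p /(tsupport_bump r0)/= pr.
  by rewrite -[p](subrK c) (le_trans (ler_normD _ _))// (le_trans _ (ltW rM))// lerD2r.
- exact: subset_trans (tsupport_bump r0) cU.
Qed.

Lemma test_function_pos U p : open U -> U p -> exists psi,
  [/\ test_function U psi, forall q, 0 <= psi q & 0 < psi p].
Proof.
move=> oU Up; have /nbhs_ballP[r /= r0 rU] : nbhs p U by exact: open_nbhs_nbhs.
have r2 : 0 < r / 2 by rewrite divr_gt0.
exists (bump p (r / 2)); split.
- apply: test_function_bump; first exact: ltW.
  move=> q /= qr; apply: rU; rewrite -ball_normE/= distrC (le_lt_trans qr)//.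
  by rewrite ltr_pdivrMr// mulr2n mulrDr mulr1 ltrDl.
- exact: bump_ge0.
- by apply: bump_gt0; rewrite subrr normr0.
Qed.

End test_functions.

(** * Mollifiers *)

Section mollification.
Context {R : realType} {n : nat}.
Local Notation lambda := (lebesgue_rV R n).
Implicit Types (psi eta : 'rV[R]_n -> R) (f : borel 'rV[R]_n -> R).

(** A correlation rather than a convolution: y -> psi (y - x) can serve directly as a test function
    for weak derivatives. This is why a minus sign appears when differentiating in [x]. *)
Definition moll f psi (x : 'rV[R]_n) : R :=
  \int[lambda]_y (f y * psi ((y : 'rV[R]_n) - x)).

Section smoothness.
Context (f : borel 'rV[R]_n -> R).
Hypothesis fi : lambda.-integrable setT (EFin \o f).
Local Notation test := (@test_function R n setT).

Let measurable_tf psi x : test psi ->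
  measurable_fun setT (fun y : borel 'rV[R]_n => psi ((y : 'rV[R]_n) - x)).
Proof.
move=> /test_function_continuous tpsi.
exact: (measurable_fun_shift (- x) (continuous_measurable_rV tpsi)).
Qed.

Lemma moll_integrable psi x : test psi ->
  lambda.-integrable setT (EFin \o (fun y => f y * psi ((y : 'rV[R]_n) - x))).
Proof.
move=> tpsi; have [C CP] := test_function_bounded tpsi.
apply: (integrable_mul_bounded measurableT fi (measurable_tf x tpsi)) => y _; exact: CP.
Qed.

Let A := \int[lambda]_y `|f y|.
Let A0 : 0 <= A. Proof. exact: Rintegral_ge0. Qed.

Lemma moll_continuous psi : test psi -> continuous (moll f psi).
Proof.
move=> tpsi x; have [L L0 LP] := test_function_lipschitz tpsi.
have lip x' : `|moll f psi x - moll f psi x'| <= L * `|x' - x| * A.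
  rewrite /moll -RintegralB//; [|exact: moll_integrable..].
  rewrite (@eq_Rintegral _ _ _ _ _ (fun y => f y * (psi ((y : 'rV[R]_n) - x) - psi ((y : 'rV[R]_n) - x')))); last first.
    by move=> y _; rewrite mulrBr.
  apply: Rintegral_mul_le => //.
    by apply: measurable_funB; exact: measurable_tf.
  move=> y _; have := LP (y - x') (x' - x).
  by rewrite addrA subrK.
have e1 e : 0 < e -> 0 < e / (L * A + 1).
  by move=> e0; rewrite divr_gt0// ltr_wpDl// mulr_ge0.
apply/(@cvgrPdist_le R R 'rV[R]_n (nbhs x) (nbhs_filter x)) => e e0.
apply/nbhs_ballP; exists (e / (L * A + 1)); first exact: e1.
move=> x' /=; rewrite -ball_normE/= distrC => xx'.
apply: le_trans (lip x') _; rewrite mulrAC.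
apply: (@le_trans _ _ ((L * A + 1) * `|x' - x|)).
  by rewrite ler_wpM2r// lerDl.
by rewrite mulrC -ler_pdivlMr ?ltW// ltr_wpDl// mulr_ge0.
Qed.

(** The difference quotient of [psi] in the shift differs from minus its partial derivative by at
    most L |h|, uniformly, where [L] is a Lipschitz constant of that partial derivative; integration
    against |f| keeps the bound. *)
Lemma moll_is_derive psi x i : test psi ->
  is_derive x (delta_mx 0 i) (moll f psi) (- moll f (partial i psi) x).
Proof.
move=> tpsi; have tpi := test_function_partial i tpsi.
have [L L0 LP] := test_function_lipschitz tpi.
have [spsi _ _] := tpsi.
pose e_ : 'rV[R]_n := delta_mx 0 i.
have ne : `|e_| <= 1.
  rewrite [leLHS]/Num.norm/= mx_normrE; apply: bigmax_le => // -[a b] _ /=.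
  by rewrite mxE; case: (_ && _); rewrite ?normr1 ?normr0.
have D1 (a : 'rV[R]_n) (h : R) : h != 0 ->
    `|h^-1 * (psi (a - h *: e_) - psi a) + partial i psi a| <= L * `|h|.
  move=> h0; have dp q : derivable psi q e_ by have [] := smooth_on_is_derive i spsi (Logic.I : setT q).
  have dr q : is_derive q (- h *: e_) psi (- h *: partial i psi q).
    by apply: is_derive_dirZ; exact/derivableP/dp.
  have [t _|c /andP[c0 c1]] := @mean_value_line R _ psi a (- h *: e_); first by have [] := dr (a + t *: (- h *: e_)).
  have [_ ->] := dr (a + c *: (- h *: e_)); rewrite scaleNr => ->.
  rewrite [_ *: _]mulNr mulrN mulKf// addrC.
  rewrite -opprB normrN; apply: le_trans (LP a (c *: - (h *: e_))) _.
  rewrite ler_wpM2l// normrZ normrN normrZ (ger0_norm c0).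
  rewrite -[leRHS]mul1r ler_pM// ?mulr_ge0// -[leRHS]mulr1 ler_wpM2l//.
suff H : (fun h : R => h^-1 *: (moll f psi (h *: e_ + x) - moll f psi x)) @ 0^' --> - moll f (partial i psi) x.
  by split; [apply/cvg_ex; exists (- moll f (partial i psi) x)|exact/cvg_lim].
have B h : h != 0 -> `|h^-1 *: (moll f psi (h *: e_ + x) - moll f psi x) + moll f (partial i psi) x|
    <= L * `|h| * A.
  move=> h0.
  have ip := @moll_integrable psi _ tpsi.
  have iB : lambda.-integrable setT (EFin \o (fun y : borel 'rV[R]_n =>
      f y * psi ((y : 'rV[R]_n) - (h *: e_ + x)) - f y * psi ((y : 'rV[R]_n) - x))).
    exact: (integrable_EFinB measurableT (ip _) (ip _)).
  have E1 : h^-1 *: (moll f psi (h *: e_ + x) - moll f psi x) =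
      \int[lambda]_y (h^-1 * (f y * psi ((y : 'rV[R]_n) - (h *: e_ + x)) - f y * psi ((y : 'rV[R]_n) - x))).
    rewrite (RintegralZl _ measurableT iB) [LHS]/(h^-1 * _); congr (h^-1 * _).
    by rewrite (RintegralB measurableT (ip _) (ip _)).
  rewrite E1 /moll.
  rewrite -RintegralD//; [|exact: integrable_EFinZ|exact: moll_integrable].
  rewrite (@eq_Rintegral _ _ _ _ _ (fun y => f y *
      (h^-1 * (psi (((y : 'rV[R]_n) - x) - h *: e_) - psi ((y : 'rV[R]_n) - x)) +
       partial i psi ((y : 'rV[R]_n) - x)))); last first.
    by move=> y _; rewrite (_ : y - (h *: e_ + x) = y - x - h *: e_) ?opprD ?addrA ?[_ - _ - x]addrAC//; ring.
  apply: Rintegral_mul_le => //; last by move=> y _; exact: D1.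
  apply: measurable_funD; last exact: measurable_tf.
  apply: measurable_funM => //; apply: measurable_funB; last exact: measurable_tf.
  rewrite (_ : (fun y => _) = (fun y : borel 'rV[R]_n => psi ((y : 'rV[R]_n) - (x + h *: e_)))).
    exact: measurable_tf.
  by apply/funext => y; rewrite opprD addrA.
apply/cvgrPdist_le => e e0.
have LA : 0 < L * A + 1 by rewrite ltr_wpDl// mulr_ge0.
near=> h; have h0 : h != 0 by near: h; exact: nbhs_dnbhs_neq.
rewrite -opprD normrN addrC; apply: le_trans (B h h0) _.
rewrite mulrAC; apply: (@le_trans _ _ ((L * A + 1) * `|h|)); first by rewrite ler_wpM2r// lerDl.
rewrite mulrC -ler_pdivlMr//.
near: h; apply: (@cvg_within _ (nbhs (0 : R))).
apply/nbhs_ballP; exists (e / (L * A + 1)); first by rewrite /= divr_gt0.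
by move=> y; rewrite -ball_normE/= sub0r normrN => /ltW.
Unshelve. all: by end_near. Qed.

(** The mollifications of [f] by all test functions are closed, up to sign, under partial
    derivatives. *)
Lemma smooth_on_moll psi : test psi -> smooth_on setT (moll f psi).
Proof.
move=> tpsi.
refine (@algebra_smooth R n setT [set g | exists2 p, test p & g = moll f p] openT _ _ _ _).
- by move=> _ [p tp ->] x _; exact: moll_continuous.
- move=> _ i [p tp ->]; exists (fun x => (- 1) * moll f (partial i p) x).
    apply: algebra_mul; first exact: algebra_cst.
    by apply: algebra_gen; exists (partial i p) => //; exact: test_function_partial.
  by move=> x _; rewrite mulN1r; exact: moll_is_derive.
- by apply: algebra_gen; exists psi.
Qed.

Lemma partial_moll psi i : test psi ->
  partial i (moll f psi) = fun x => - moll f (partial i psi) x.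
Proof. by move=> tpsi; apply/funext => x; have [_ <-] := moll_is_derive x i tpsi. Qed.

End smoothness.

Definition mollifier (d : R) eta := [/\ test_function setT eta, forall x, 0 <= eta x,
  forall x, d < `|x| -> eta x = 0 & (\int[lambda]_x (eta x)%:E = 1)%E].

Lemma mollifier_exists (d : R) : 0 < d -> exists eta, mollifier d eta.
Proof.
move=> d0; pose b := @bump R n 0 d.
have tb : test_function setT b by apply: test_function_bump; [exact: ltW|].
have cb : measurable_fun setT (b : borel 'rV[R]_n -> R).
  by apply: continuous_measurable_rV; exact: test_function_continuous tb.
have bout (x : 'rV[R]_n) : d < `|x| -> b x = 0.
  by move=> dx; rewrite /b bump_out ?subr0// ltW.
have [C CP] := test_function_bounded tb.
have C0 : 0 <= C by apply: le_trans (CP 0).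
pose I := (\int[lambda]_x (b x)%:E)%E.
have b0 (x : borel 'rV[R]_n) : (0 <= (b x)%:E)%E by rewrite lee_fin bump_ge0.
have mbE : measurable_fun setT (fun x : borel 'rV[R]_n => (b x)%:E) by exact/measurable_EFinP.
have Ifin : (I < +oo)%E.
  apply: (@le_lt_trans _ _ (\int[lambda]_x (C%:E * (\1_(@box R n d) x)%:E))%E).
    apply: ge0_le_integral => //.
    - by apply: emeasurable_funM => //; apply/measurable_EFinP; apply: measurable_indic; exact: measurable_box.
    - move=> x _; rewrite indicE -EFinM lee_fin; have [xd|xd] := leP `|x : 'rV[R]_n| d.
        rewrite mem_set ?mulr1; last by apply/box_norm; rewrite // ltW.
        by rewrite (le_trans (ler_norm _) (CP x)).
      by rewrite bout// mulr_ge0.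
  rewrite ge0_integralZl//; last first.
    by apply/measurable_EFinP; apply: measurable_indic; exact: measurable_box.
  rewrite integral_indic//; last exact: measurable_box.
  by rewrite setIT [X in (_ * X)%E]lebesgue_rV_box ?(ltW d0)// -EFinM ltry.
(* A zero integral would make [b] vanish almost everywhere, but [b] is positive on the box of
   half-width d/2, whose measure d^n is not 0. *)
have I0 : (0 < I)%E.
  rewrite lt_neqAle integral_ge0// andbT eq_sym; apply/eqP => IE.
    have d2 : 0 < d / 2 by rewrite divr_gt0.
  have bp x : @box R n (d / 2) x -> 0 < b x.
    move=> /(box_norm _ (ltW d2)) xd; apply: bump_gt0; rewrite subr0 (le_lt_trans xd)//.
    by rewrite ltr_pdivrMr// mulr2n mulrDr mulr1 ltrDl.
  have : lambda.-negligible (@box R n (d / 2)).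
    have : ae_eq lambda setT (fun x : borel 'rV[R]_n => (b x)%:E) (cst 0%E).
      apply/(ae_eq_integral_abs lambda measurableT mbE).
      by under eq_integral => x _ do rewrite gee0_abs//.
    move=> [N [mN N0 sN]]; exists N; split => // x /bp bx; apply: sN => /= /(_ Logic.I) [] bx0.
    by move: bx; rewrite bx0 ltxx.
  move=> /(negligibleP lambda (measurable_box (d / 2))).
  rewrite [X in X = _ -> _]lebesgue_rV_box ?(ltW d2)// => -[] /eqP; rewrite expf_eq0 => /andP[_].
  by rewrite mulrn_eq0/= gt_eqF.
have If : I = (fine I)%:E by rewrite fineK// ge0_fin_numE// ltW.
have fI0 : 0 < fine I by rewrite fine_gt0// I0.
exists (fun x => (fine I)^-1 * b x); split.
- have [sb kb _] := tb.
  have sub : tsupport (fun x => (fine I)^-1 * b x) `<=` tsupport b.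
    by apply: tsupport_sub; [exact: closed_closure|move=> x /tsupport_out ->; rewrite mulr0].
  split; [|exact: (subclosed_compact (@closed_closure _ _) kb sub)|by []].
  exact: (smooth_onM openT (smooth_on_cst _ openT) sb).
- by move=> x; rewrite mulr_ge0 ?bump_ge0// invr_ge0 ltW.
- by move=> x /bout ->; rewrite mulr0.
- under eq_integral do rewrite EFinM.
  rewrite ge0_integralZl//; last by rewrite lee_fin invr_ge0 ltW.
  by rewrite -/I If -EFinM mulVf// gt_eqF.
Qed.

End mollification.

Section mollification_L2.
Context {R : realType} {n : nat}.
Local Notation lambda := (lebesgue_rV R n).
Implicit Types (f : borel 'rV[R]_n -> R).

Lemma measurable_add_rV : measurable_fun setT
  (fun p : borel 'rV[R]_n * borel 'rV[R]_n => ((p.2 : 'rV[R]_n) + (p.1 : 'rV[R]_n) : borel 'rV[R]_n)).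
Proof.
apply: measurable_fun_rV => // i.
rewrite (_ : (fun x => _) = (fun p : borel 'rV[R]_n * borel 'rV[R]_n =>
    (p.2 : 'rV[R]_n) 0 i + (p.1 : 'rV[R]_n) 0 i)); last by apply/funext => p; rewrite mxE.
apply: measurable_funD.
  exact: (measurableT_comp (measurable_coord i) measurable_snd).
exact: (measurableT_comp (measurable_coord i) measurable_fst).
Qed.

(** Since [eta] has integral 1, the left side is the square of an average of f (z + x) - f x, and
    Jensen's inequality applies; if the right side is infinite there is nothing to prove. *)
Lemma moll_sub_sqr_le f eta d x : measurable_fun setT f -> @mollifier R n d eta ->
  (((moll f eta x - f x) ^+ 2)%:E <=
   \int[lambda]_z ((f ((z : 'rV[R]_n) + x) - f x) ^+ 2 * eta z)%:E)%E.
Proof.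
move=> mf [teta eta0 etad eta1].
have ceta := test_function_continuous teta.
have meta : measurable_fun setT (eta : borel 'rV[R]_n -> R) by exact: continuous_measurable_rV.
have mfx : measurable_fun setT (fun z : borel 'rV[R]_n => f ((z : 'rV[R]_n) + x)).
  exact: measurable_fun_shift.
have [hoo|] := ltP (\int[lambda]_z ((f ((z : 'rV[R]_n) + x) - f x) ^+ 2 * eta z)%:E)%E +oo%E; last first.
  by rewrite leye_eq => /eqP ->; rewrite leey.
have mh : measurable_fun setT (fun z : borel 'rV[R]_n => f ((z : 'rV[R]_n) + x) - f x).
  exact: measurable_funB.
have [ihw] := jensen_square mh meta eta0 eta1 hoo.
suff -> : \int[lambda]_z ((f ((z : 'rV[R]_n) + x) - f x) * eta z) = moll f eta x - f x by [].
have ieta : lambda.-integrable setT (EFin \o (eta : borel 'rV[R]_n -> R)).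
  apply/integrableP; split; first exact/measurable_EFinP.
  by under eq_integral => z _ do rewrite gee0_abs ?lee_fin//; rewrite eta1 ltry.
have E : moll f eta x = \int[lambda]_z ((f ((z : 'rV[R]_n) + x) - f x) * eta z + f x * eta z).
  rewrite /moll /Rintegral; congr fine.
  rewrite -(integral_rV_shift x); last first.
    apply/measurable_EFinP; apply: measurable_funM => //.
    exact: (measurable_fun_shift (- x) meta).
  by apply: eq_integral => z _; congr EFin; rewrite addrK; ring.
rewrite E RintegralD//; last exact: (integrable_EFinZ (f x) measurableT ieta).
rewrite (RintegralZl (f x) measurableT ieta) /Rintegral eta1 mulr1.
by rewrite addrK.
Qed.

(** The pointwise Jensen bound is integrated over the box and the two integrals are exchanged by
    Tonelli: what remains is an average, over |z| <= d', of translation errors of [f]. *)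
Lemma moll_L2 f (N e : R) : 0 <= N -> measurable_fun setT f ->
  lambda.-integrable setT (EFin \o f) -> (sqint lambda setT f < +oo)%E -> 0 < e ->
  exists2 d : R, 0 < d & forall d' eta, d' <= d -> mollifier d' eta ->
    (sqint lambda (box N) (fun x => moll f eta x - f x)%R <= e%:E)%E.
Proof.
move=> N0 mf fi foo e0.
have mb M := @measurable_box R n M.
have foo' : (sqint lambda (box (N + 1)) f < +oo)%E.
  apply: le_lt_trans foo; apply: ge0_subset_integral => //.
  - exact: measurable_sqr.
  - by move=> x _; rewrite lee_fin sqr_ge0.
have [d d0 dP] := L2_translation_continuous N0 mf foo' e0.
exists d => // d' eta d'd meta; have [teta eta0 etad eta1] := meta.
have ceta := test_function_continuous teta.
have mmeta : measurable_fun setT (eta : borel 'rV[R]_n -> R) by exact: continuous_measurable_rV.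
have mmoll : measurable_fun setT (moll f eta : borel 'rV[R]_n -> R).
  by apply: continuous_measurable_rV; exact: moll_continuous.
pose G (p : borel 'rV[R]_n * borel 'rV[R]_n) : \bar R :=
  (\1_(@box R n N) p.1 * ((f ((p.2 : 'rV[R]_n) + (p.1 : 'rV[R]_n)) - f p.1) ^+ 2 * eta p.2))%:E.
have mG : measurable_fun setT G.
  apply/measurable_EFinP; apply: measurable_funM.
    by apply: measurableT_comp => //; exact: measurable_indic.
  apply: measurable_funM; last by apply: measurableT_comp.
  apply: measurable_funX; apply: measurable_funB; last exact: measurableT_comp.
  by apply: (measurableT_comp mf); exact: measurable_add_rV.
have G0 p : (0 <= G p)%E.
  rewrite /G lee_fin indicE; apply: mulr_ge0; first exact: ler0n.
  by apply: mulr_ge0; [exact: sqr_ge0|exact: eta0].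
apply: (@le_trans _ _ (\int[lambda]_x \int[lambda]_z G (x, z))%E).
  rewrite /sqint integral_mkcond; apply: ge0_le_integral => //.
  - by move=> x _; rewrite /patch; case: ifP => // _; rewrite lee_fin sqr_ge0.
  - have mB : measurable_fun (@box R n N) (fun x : borel 'rV[R]_n => moll f eta x - f x).
      by apply: measurable_funTS; exact: measurable_funB.
    exact: (measurable_restrictT _ (mb N)).1 (measurable_sqr mB).
  - exact: (measurable_fun_fubini_tonelli_F G mG G0).
  - move=> x _; rewrite /patch; case: ifPn => xN; last first.
      by apply: integral_ge0 => z _; exact: G0.
    apply: le_trans (moll_sub_sqr_le x mf meta) _.
    rewrite le_eqVlt; apply/orP; left; apply/eqP; apply: eq_integral => z _.
    by rewrite /G/= indicE xN mul1r.
rewrite fubini_tonelli//.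
apply: (@le_trans _ _ (\int[lambda]_z ((eta z)%:E * e%:E))%E); last first.
  rewrite ge0_integralZr//; [|exact/measurable_EFinP|by move=> z _; rewrite lee_fin|by rewrite lee_fin ltW].
  by rewrite eta1 mul1e.
apply: ge0_le_integral => //.
- by move=> z _; apply: integral_ge0 => x _; exact: G0.
- exact: (measurable_fun_fubini_tonelli_G G mG G0).
- by apply: emeasurable_funM => //; exact/measurable_EFinP.
- move=> z _; have [zd|zd] := leP `|z : 'rV[R]_n| d'; last first.
    rewrite (etad _ zd) mul0e integral0_eq// => x _.
    by rewrite /G/= (etad _ zd) !mulr0.
  apply: (@le_trans _ _ ((eta z)%:E * sqint lambda (box N) (fun x => f ((x : 'rV[R]_n) + z) - f x)%R)%E).
    rewrite /sqint integral_mkcond -ge0_integralZl//.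
    - rewrite le_eqVlt; apply/orP; left; apply/eqP; apply: eq_integral => x _.
      rewrite /G/= indicE /patch; case: ifP => _; last by rewrite mul0r mule0.
      by rewrite mul1r -EFinM (addrC (z : 'rV[R]_n)) mulrC.
    - have mB : measurable_fun (@box R n N) (fun x : borel 'rV[R]_n => f ((x : 'rV[R]_n) + z) - f x).
        by apply: measurable_funTS; apply: measurable_funB => //; exact: measurable_fun_shift.
      exact: (measurable_restrictT _ (mb N)).1 (measurable_sqr mB).
    - by move=> x _; rewrite /patch; case: ifP => // _; rewrite lee_fin sqr_ge0.
    by rewrite lee_fin.
  rewrite lee_wpmul2l ?lee_fin//; apply: dP; exact: le_trans zd d'd.
Qed.

End mollification_L2.

Section L2_summable.
Local Open Scope ereal_scope.
Context d (T : measurableType d) (R : realType) (mu : {measure set T -> \bar R}).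

Lemma nneseries_lt_pinfty_cvg0 (u : nat -> R) : (forall k, 0 <= u k)%R ->
  \sum_(0 <= k <oo) (u k)%:E < +oo -> u @ \oo --> 0%R.
Proof.
move=> u0 uoo.
have ut := nneseries_tail_cvg uoo (fun k _ => (_ : 0 <= (u k)%:E)).
have {}ut : (fun N => \sum_(N <= k <oo) (u k)%:E) @ \oo --> 0 by apply: ut => k; rewrite lee_fin.
have H : (EFin \o u) @ \oo --> 0%:E.
  apply: (squeeze_cvge _ (cvg_cst 0) ut).
  apply: nearW => N; rewrite /= lee_fin u0/=.
  rewrite (_ : (u N)%:E = \sum_(N <= k < N.+1) (u k)%:E); last by rewrite big_nat1.
  by apply: nneseries_lim_ge => k _; rewrite lee_fin.
exact: (fine_cvg H).
Qed.

(** The squared errors have summable integrals, so their sum is finite almost everywhere and its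
    terms tend to 0. The whole sequence converges, without passing to a subsequence. *)
Lemma sqint_summable_ae_cvg D (f_ : nat -> T -> R) (f : T -> R) : measurable D ->
  (forall k, measurable_fun D (f_ k)) -> measurable_fun D f ->
  (forall k, sqint mu D (fun x => f_ k x - f x)%R <= (1 / (2 ^ (k + 1))%:R)%R%:E) ->
  {ae mu, forall x, D x -> (f_ ^~ x) @ \oo --> f x}.
Proof.
move=> mD mf_ mf fl.
have mh k : measurable_fun D (fun x => ((f_ k x - f x) ^+ 2)%:E).
  by apply: measurable_sqr; exact: measurable_funB.
have h0 k x : D x -> 0 <= ((f_ k x - f x) ^+ 2)%:E by rewrite lee_fin sqr_ge0.
have S0 x : D x -> 0 <= \sum_(0 <= k <oo) ((f_ k x - f x) ^+ 2)%:E.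
  by move=> Dx; apply: nneseries_ge0 => k _ _; exact: h0.
have Si : mu.-integrable D (fun x => \sum_(0 <= k <oo) ((f_ k x - f x) ^+ 2)%:E).
  apply/integrableP; split.
    by apply: ge0_emeasurable_sum => // k x Dx _; exact: h0.
  under eq_integral => x xD.
    rewrite gee0_abs; last by apply: S0; rewrite inE in xD.
    over.
  rewrite integral_nneseries//.
  apply: (@le_lt_trans _ _ (\sum_(0 <= k <oo) ((1 / (2 ^ (k + 1))%:R)%R%:E))).
    by apply: lee_nneseries => [k _ _|k _]; [exact: sqint_ge0|exact: fl].
  have := @cvg_geometric_eseries_half R 1 0.
  move=> /cvg_lim => H; rewrite (_ : limn _ = (1 / 2 ^+ 0)%R%:E) ?ltry//.
  by rewrite -[RHS]H.
have := integrable_ae mD Si; apply: filterS => x Sx Dx.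
have : (fun k => (f_ k x - f x) ^+ 2)%R @ \oo --> 0%R.
  apply: nneseries_lt_pinfty_cvg0; first by move=> k; exact: sqr_ge0.
  by rewrite -ge0_fin_numE ?S0// Sx.
move=> /cvgrPdist_lt H; apply/cvgrPdist_lt => e e0.
have := H _ (exprn_gt0 2 e0); apply: filterS => k; rewrite sub0r normrN ger0_norm ?sqr_ge0//.
rewrite -[((f_ k x - f x) ^+ 2)%R](real_normK (num_real _)) distrC.
by rewrite ltr_pXn2r ?nnegrE ?(ltW e0).
Qed.

End L2_summable.

(** * Smooth approximation of Sobolev functions *)

Section W12_approximation.
Context {R : realType} {n : nat}.
Local Notation lambda := (lebesgue_rV R n).
Implicit Types (U K : set 'rV[R]_n) (f : 'rV[R]_n -> R) (a : 'rV[R]_n -> 'cV[R]_n).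

(** The margin [d] is room for a mollifier: averages at points of [K] only see values in [K']. *)
Lemma compact_thickening K U : compact K -> open U -> K `<=` U ->
  exists d : R, 0 < d /\ exists K' : set 'rV[R]_n, [/\ compact K', K' `<=` U &
    forall x z, K x -> `|z| <= d -> K' (x + z)].
Proof.
move=> cK oU KU.
have /(_ 'rV[R]_n (nbhs (0 : 'rV[R]_n)) (fun z x => U (x + z)) (nbhs_filter _)) :=
  (compact_near_coveringP K).1 cK.
have H : forall x, K x -> \forall x' \near x & z \near nbhs (0 : 'rV[R]_n), U (x' + z).
  move=> x /KU Ux.
  have /nbhs_ballP[d /= d0 dU] : nbhs x U by exact: open_nbhs_nbhs.
  exists (ball x (d / 2), ball 0 (d / 2)).
    by split; apply: nbhsx_ballx; rewrite divr_gt0.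
  move=> [x' z] /=; rewrite -!ball_normE /= sub0r normrN => -[xx' zd]; apply: dU.
  rewrite -ball_normE/= opprD addrA (le_lt_trans (ler_normB _ _))//.
  by rewrite [ltRHS]splitr ltrD.
move=> /(_ H)/nbhs_ballP[d /= d0 dP].
have d2 : 0 < d / 2 by rewrite divr_gt0.
exists (d / 2); split=> //.
exists ((fun p : 'rV[R]_n * 'rV[R]_n => p.1 + p.2) @` (K `*` @box R n (d / 2))); split.
- apply: continuous_compact; last by apply: compact_setX => //; exact: compact_box.
  by apply: continuous_subspaceT => p; exact: (@add_continuous 'rV[R]_n).
- move=> _ [[x z] /= [Kx /(box_norm _ (ltW d2)) zd] <-]; apply: dP => //.
  rewrite -ball_normE/= sub0r normrN (le_lt_trans zd)// ltr_pdivrMr//.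
  by rewrite mulr2n mulrDr mulr1 ltrDl.
- by move=> x z Kx zd; exists (x, z) => //; split => //=; apply/box_norm => //; exact: ltW.
Qed.

Lemma partial_translate (psi : 'rV[R]_n -> R) x i y :
  partial i (fun y => psi (y - x)) y = partial i psi (y - x).
Proof.
have E : (fun h : R => h^-1 *: (((fun y0 : 'rV[R]_n => psi (y0 - x)) \o shift y) (h *: delta_mx 0 i) - psi (y - x))) =
    (fun h : R => h^-1 *: ((psi \o shift (y - x)) (h *: delta_mx 0 i) - psi (y - x))).
  by apply/funext => h /=; rewrite addrA.
by rewrite /partial /derive E.
Qed.

Lemma test_function_translate U psi (x : 'rV[R]_n) (d : R) : test_function setT psi ->
  (forall z, d < `|z| -> psi z = 0) -> 0 <= d -> (forall z, `|z| <= d -> U (x + z)) ->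
  test_function U (fun y => psi (y - x)).
Proof.
move=> [spsi _ _] psid d0 xU.
have sub : tsupport (fun y : 'rV[R]_n => psi (y - x)) `<=` [set p | `|p - x| <= d].
  apply: tsupport_sub.
    apply: (@preimage_closed _ _ (fun p : 'rV[R]_n => `|p - x|) [set t | t <= d]); last exact: closed_le.
    move=> p _; apply: (@continuous_comp _ _ _ (fun y : 'rV[R]_n => y - x) (@Num.norm R 'rV[R]_n)); last exact: norm_continuous.
    by apply: (@continuousB R 'rV[R]_n); [exact: cvg_id|exact: cst_continuous].
  by move=> y /= /negP; rewrite -ltNge => /psid.
split.
- refine (@smooth_on_comp_row R n n setT setT (fun y => y - x) psi openT openT _ spsi (fun _ _ => Logic.I)) => j.
  rewrite (_ : (fun p => _) = (fun p : 'rV[R]_n => p 0 j + (- x 0 j))); last by apply/funext => p; rewrite !mxE.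
  exact: (smooth_onD openT (smooth_on_coord j openT) (smooth_on_cst _ openT)).
- apply: bounded_closed_compact; last exact: closed_closure.
  exists (d + `|x|); split; first exact: num_real.
  move=> M rM p /sub/= pr.
  by rewrite -[p](subrK x) (le_trans (ler_normD _ _))// (le_trans _ (ltW rM))// lerD2r.
- by move=> y /sub /= yx; rewrite -(subrKC x y); exact: xU.
Qed.

(** [f] and its weak derivatives are cut off to a compact neighbourhood [K'] of [K] and mollified.
    At points of [K] a narrow mollifier does not see the cut, so differentiation commutes with
    mollification there. Nonnegativity survives because mollifiers are nonnegative. *)
Lemma W12_approx U f a K e : open U -> W12loc_rV U f a -> (forall x, U x -> 0 <= f x) ->
  compact K -> K `<=` U -> 0 < e ->
  exists F : 'rV[R]_n -> R, [/\ smooth_on setT F, forall x, 0 <= F x,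
    (sqint lambda K (fun x => F x - f x)%R <= e%:E)%E &
    forall i, (sqint lambda K (fun x => partial i F x - a x i 0)%R <= e%:E)%E].
Proof.
move=> oU [mf f2 aP] f0 cK KU e0.
have [d [d0 [K' [cK' K'U KK']]]] := compact_thickening cK oU KU.
have mK : measurable (K : set (borel 'rV[R]_n)) by apply: borel_compact => //; exact: norm_hausdorff.
have mK' : measurable (K' : set (borel 'rV[R]_n)) by apply: borel_compact => //; exact: norm_hausdorff.
have mU : measurable (U : set (borel 'rV[R]_n)) by exact: borel_open.
have K'oo : (lambda K' < +oo)%E by exact: lebesgue_rV_compact_lt_pinfty.
pose cut (h : borel 'rV[R]_n -> R) : borel 'rV[R]_n -> R := h \_ K'.
have cutP (h : borel 'rV[R]_n -> R) : measurable_fun (U : set (borel 'rV[R]_n)) h -> L1loc lambda U (fun p => h p ^+ 2) ->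
    [/\ measurable_fun setT (cut h), lambda.-integrable setT (EFin \o cut h) &
        (sqint lambda setT (cut h) < +oo)%E].
  move=> mh h2.
  have mh' : measurable_fun (K' : set (borel 'rV[R]_n)) h by exact: measurable_funS mh.
  have /integrableP[mh2 h2oo] := h2 K' cK' K'U.
  have mc : measurable_fun setT (cut h) by exact: (measurable_restrictT _ mK').1 mh'.
  split => //.
    rewrite (_ : EFin \o cut h = (EFin \o h) \_ K'); last by rewrite /cut restrict_EFin.
    apply/(integrable_mkcond _ mK').1.
    apply: (@le_integrable _ _ _ lambda K' mK' _ (fun x => (1 + h x ^+ 2)%:E)).
    - exact/measurable_EFinP.
    - move=> x _; rewrite /= lee_fin [leRHS]ger0_norm; last by rewrite addr_ge0// sqr_ge0.
      have := sqr_ge0 (`|h x| - 1); rewrite -[h x ^+ 2](real_normK (num_real _)).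
      by have := normr_ge0 (h x); nra.
    - apply: integrable_EFinD => //; last exact: h2.
      apply/integrableP; split; first exact/measurable_EFinP.
      rewrite (_ : (\int[_]_(x in _) _)%E = (\int[lambda]_(x in K') cst 1 x)%E).
        by rewrite integral_cst// mul1e.
      by apply: eq_integral => x _ /=; rewrite normr1.
  rewrite (_ : sqint _ _ _ = sqint lambda K' h).
    apply: le_lt_trans h2oo; rewrite le_eqVlt; apply/orP; left; apply/eqP.
    by apply: eq_integral => x _ /=; rewrite ger0_norm// sqr_ge0.
  rewrite /sqint [RHS]integral_mkcond; apply: eq_integral => x _.
  by rewrite /cut /patch; case: ifP => _ //; rewrite expr0n.
have [mcf icf cf2] := cutP _ mf f2.
pose ai i (p : borel 'rV[R]_n) : R := a p i 0.
have acut i : [/\ measurable_fun setT (cut (ai i)),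
    lambda.-integrable setT (EFin \o cut (ai i)) &
    (sqint lambda setT (cut (ai i)) < +oo)%E].
  by have [ma a2 _] := aP i; exact: cutP.
have [N N0 KN] : exists2 N : R, 0 <= N & K `<=` @box R n N.
  have [N [_ /(_ (N + 1))]] := compact_bounded cK.
  rewrite ltrDl => /(_ ltr01) KN; exists `|N + 1| => // x /KN /= xN.
  by apply/box_norm => //; rewrite (le_trans xN)// ler_norm.
have [df df0 dfP] := moll_L2 N0 mcf icf cf2 e0.
have [da daP] : exists da : 'I_n -> R, forall i, 0 < da i /\ forall d' eta, d' <= da i -> mollifier d' eta ->
    (sqint lambda (box N) (fun x => moll (cut (ai i)) eta x - cut (ai i) x)%R <= e%:E)%E.
  have := @choice _ _ (fun i (c : R) => 0 < c /\ forall d' eta, d' <= c -> mollifier d' eta ->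
    (sqint lambda (box N) (fun x => moll (cut (ai i)) eta x - cut (ai i) x)%R <= e%:E)%E).
  case=> [i|da daP]; last by exists da.
  by have [ma ia a2] := acut i; have [c c0 cP] := moll_L2 N0 ma ia a2 e0; exists c.
(* One radius for [f] and all its derivatives, since the same [F] has to approximate all of them. *)
pose r := \big[Num.min/Num.min d df]_(i < n) da i.
have r0 : 0 < r.
  by apply: lt_bigmin => [|i _]; [rewrite lt_min d0 df0|have [] := daP i].
have rd : r <= Num.min d df by exact: bigmin_le_id.
have rda i : r <= da i by exact: bigmin_le.
have [eta meta] := @mollifier_exists R n r r0; have [teta eta0 etar eta1] := meta.
have cutE h x : K x -> cut h x = h x.
  move=> Kx; rewrite /cut /patch mem_set//.
  by have := KK' x 0 Kx; rewrite normr0 addr0; apply; exact: ltW.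
have le_min_d : r <= d by move: rd; rewrite le_min => /andP[].
have le_min_df : r <= df by move: rd; rewrite le_min => /andP[].
exists (moll (cut f) eta); split.
- exact: smooth_on_moll.
- move=> x; apply: Rintegral_ge0 => y _; rewrite mulr_ge0// /cut /patch.
  by case: ifPn => //; rewrite inE => /K'U/f0.
- apply: le_trans (dfP r eta le_min_df meta).
  rewrite (_ : sqint _ _ _ = sqint lambda K (fun x => moll (cut f) eta x - cut f x)); last first.
    by apply: eq_integral => x; rewrite inE => Kx; rewrite cutE.
  apply: ge0_subset_integral => //; first exact: measurable_box.
    apply: measurable_sqr; apply: measurable_funTS; apply: measurable_funB => //.
    by apply: continuous_measurable_rV; exact: moll_continuous.
  by move=> x _; rewrite lee_fin sqr_ge0.
- move=> i; have [ma ia a2] := acut i; have [_ daPi] := daP i.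
  apply: le_trans (daPi r eta (rda i) meta).
  rewrite (_ : sqint _ _ _ = sqint lambda K (fun x => moll (cut (ai i)) eta x - cut (ai i) x)); last first.
    apply: eq_integral => x; rewrite inE => Kx; rewrite (cutE (ai i))//.
    congr ((_ - _) ^+ 2)%:E.
    rewrite partial_moll//.
    (* This translate of [eta] is admissible in the definition of the weak derivative; the sign of
       the integration by parts cancels that of the correlation. *)
    have tx : test_function U (fun y : 'rV[R]_n => eta (y - x)).
      by apply: (test_function_translate teta etar (ltW r0)) => z zr; apply: K'U; apply: KK' => //; exact: le_trans zr le_min_d.
    have out (y : 'rV[R]_n) : ~ K' y -> eta (y - x) = 0 /\ partial i eta (y - x) = 0.
      move=> yK'; have ryx : r < `|y - x|.
        by rewrite ltNge; apply/negP => yx; apply: yK'; rewrite -(subrKC x y); apply: KK' => //; exact: le_trans yx le_min_d.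
      split; first exact: etar.
      apply: partial_tsupport_out => yxs; move: ryx; rewrite ltNge => /negP; apply.
      move: yxs; apply: (@tsupport_sub R 'rV[R]_n eta [set z | `|z| <= r]).
        apply: (@preimage_closed _ _ (@Num.norm R 'rV[R]_n) [set t | t <= r]); last exact: closed_le.
        by move=> p _; exact: norm_continuous.
      by move=> z /= /negP; rewrite -ltNge => /etar.
    have E (h : borel 'rV[R]_n -> R) (k : 'rV[R]_n -> R) : (forall y, ~ K' y -> k y = 0) ->
        (\int[lambda]_(y in U) (h y * k y)%:E = \int[lambda]_y (cut h y * k y)%:E)%E.
      move=> k0; rewrite integral_mkcond; apply: eq_integral => y _.
      rewrite /cut /patch; case: ifPn => yU; case: ifPn => yK //.
      - by rewrite k0 ?mulr0// => ?; move: yK; rewrite mem_set.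
      - by exfalso; move: yU; rewrite mem_set//; apply: K'U; rewrite inE in yK.
      - by rewrite mul0r.
    have [_ _ /(_ _ tx)] := aP i.
    rewrite (E f) => [|y /out[_]]; last by rewrite partial_translate.
    rewrite (E (ai i)) => [|y /out[]//].
    under eq_integral do rewrite partial_translate.
    rewrite /moll /Rintegral => ->.
    by rewrite fineN opprK.
  apply: ge0_subset_integral => //; first exact: measurable_box.
    apply: measurable_sqr; apply: measurable_funTS; apply: measurable_funB => //.
    by apply: continuous_measurable_rV; exact: moll_continuous.
  by move=> x _; rewrite lee_fin sqr_ge0.
Qed.

End W12_approximation.

(** * Weak subsolutions in a chart *)

Section integral_bounds.
Context d (T : measurableType d) (R : realType) (mu : {measure set T -> \bar R}).
Implicit Types (D : set T) (f g : T -> R).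

Lemma L1_sqint D f : measurable_fun D f ->
  (sqint mu D f < +oo)%E <-> mu.-integrable D (EFin \o (fun x => f x ^+ 2)).
Proof.
move=> mf; rewrite /sqint; have E : (\int[mu]_(x in D) `|(EFin \o (fun x => f x ^+ 2)%R) x| =
    \int[mu]_(x in D) (f x ^+ 2)%:E)%E.
  by apply: eq_integral => x _ /=; rewrite ger0_norm// sqr_ge0.
split=> [foo|/integrableP[_]]; last by rewrite E.
by apply/integrableP; split; [exact: measurable_sqr|rewrite E].
Qed.

Lemma integrable_EFin_sum D n (h : 'I_n -> T -> R) : measurable D ->
  (forall i, mu.-integrable D (EFin \o h i)) ->
  mu.-integrable D (EFin \o (fun x => \sum_i h i x)).
Proof.
move=> mD hi; have : forall r : seq 'I_n, mu.-integrable D (EFin \o (fun x => \sum_(i <- r) h i x)).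
  elim=> [|i r IH].
    rewrite (_ : _ \o _ = cst 0%E); first exact: integrable0.
    by apply/funext => x /=; rewrite big_nil.
  rewrite (_ : _ \o _ = EFin \o (fun x => h i x + \sum_(j <- r) h j x)); first exact: integrable_EFinD.
  by apply/funext => x /=; rewrite big_cons.
exact.
Qed.

Lemma Rintegral_sumr D n (h : 'I_n -> T -> R) : measurable D ->
  (forall i, mu.-integrable D (EFin \o h i)) ->
  \int[mu]_(x in D) (\sum_i h i x) = \sum_i \int[mu]_(x in D) h i x.
Proof.
move=> mD hi; have : forall r : seq 'I_n, mu.-integrable D (EFin \o (fun x => \sum_(i <- r) h i x)) /\
   \int[mu]_(x in D) (\sum_(i <- r) h i x) = \sum_(i <- r) \int[mu]_(x in D) h i x.
  elim=> [|i r [IH1 IH2]].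
    split.
      rewrite (_ : _ \o _ = cst 0%E); first exact: integrable0.
      by apply/funext => x /=; rewrite big_nil.
    rewrite big_nil (@eq_Rintegral _ _ _ _ _ (cst 0)) => [|x _]; last by rewrite big_nil.
    by rewrite /Rintegral integral0.
  rewrite (_ : (fun x => \sum_(j <- i :: r) h j x) = (fun x => h i x + \sum_(j <- r) h j x)); last first.
    by apply/funext => x; rewrite big_cons.
  by split; [exact: integrable_EFinD|rewrite RintegralD// IH2 big_cons].
by move=> /(_ (index_enum _))[].
Qed.

Lemma integrable_EFin_le D f g : measurable D -> measurable_fun D f ->
  (forall x, D x -> `|f x| <= g x) -> mu.-integrable D (EFin \o g) -> mu.-integrable D (EFin \o f).
Proof.
move=> mD mf fg gi; apply: (le_integrable mD _ _ gi); first exact/measurable_EFinP.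
by move=> x Dx; rewrite /= lee_fin (le_trans (fg x Dx))// ler_norm.
Qed.

End integral_bounds.

Section weak_subsolution.
Context {R : realType} {n : nat}.
Local Notation lambda := (lebesgue_rV R n).

(* The vector field [V] is tested against [w * g (F_k)], where the smooth [F_k]
   approximate [f]: only the convergence of [partial i F_k] in L^2 is needed. *)
Lemma weak_integrand_le0 (U : set 'rV[R]_n) (f : 'rV[R]_n -> R) (a : 'rV[R]_n -> 'cV[R]_n)
    (V : 'I_n -> 'rV[R]_n -> R) (w : 'rV[R]_n -> R) (g g' : R -> R) (C : R) :
  open U -> W12loc_rV U f a -> (forall x, U x -> 0 <= f x) ->
  (forall i, measurable_fun (U : set (borel 'rV[R]_n)) (V i)) ->
  (forall i, L1loc lambda U (fun p => V i p ^+ 2)) ->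
  (forall phi, test_function U phi -> (forall p, 0 <= phi p) ->
     (\int[lambda]_(p in U) (\sum_i partial i phi p * V i p)%:E <= 0)%E) ->
  test_function U w -> (forall p, 0 <= w p) ->
  (forall F : 'rV[R]_n -> R, smooth_on setT F -> (forall p, 0 <= F p) -> smooth_on setT (g \o F)) ->
  (forall t : R, 0 <= t -> is_derive t 1 g (g' t)) ->
  (forall t : R, 0 <= t -> {for t, continuous g'}) ->
  (forall t : R, 0 <= t -> 0 <= g t <= C) -> (forall t : R, 0 <= t -> `|g' t| <= C) ->
  lambda.-integrable U (EFin \o (fun p =>
     \sum_i (g (f p) * partial i w p + w p * g' (f p) * a p i 0) * V i p)) /\
  (\int[lambda]_(p in U) (\sum_i (g (f p) * partial i w p + w p * g' (f p) * a p i 0) * V i p)%:E <= 0)%E.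
Proof.
move=> oU fW f0 mV V2 HV tw w0 sg dg cg' gC g'C.
have [mf f2 aP] := fW; have [sw cK KU] := tw.
have C0 : 0 <= C by have /andP[] := gC 0 (lexx 0); exact: le_trans.
set K := tsupport w in cK KU.
have mK : measurable (K : set (borel 'rV[R]_n)) by apply: borel_compact => //; exact: norm_hausdorff.
have mU : measurable (U : set (borel 'rV[R]_n)) by exact: borel_open.
have Koo : (lambda K < +oo)%E by exact: lebesgue_rV_compact_lt_pinfty.
have mUK (h : borel 'rV[R]_n -> R) : measurable_fun (U : set (borel 'rV[R]_n)) h -> measurable_fun (K : set (borel 'rV[R]_n)) h.
  by move=> mh; exact: measurable_funS mh.
have out p : ~ K p -> w p = 0 /\ forall i, partial i w p = 0.
  by move=> Kp; split; [exact: tsupport_out|move=> i; exact: partial_tsupport_out].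
have [W [W0 WP WdP]] : exists W, [/\ 0 <= W, forall p, `|w p| <= W & forall i p, `|partial i w p| <= W].
  have [W1 W1P] := test_function_bounded tw.
  have [W2 W2P] : exists W2 : 'I_n -> R, forall i p, `|partial i w p| <= W2 i.
    have := @choice _ _ (fun i c => forall p, `|partial i w p| <= c).
    case=> [i|W2 W2P]; last by exists W2.
    exact: (test_function_bounded (test_function_partial i tw)).
  have W20 i : 0 <= W2 i by apply: le_trans (W2P i 0).
  have W10 : 0 <= W1 by apply: le_trans (W1P 0).
  exists (W1 + \sum_i W2 i); split.
  - by rewrite addr_ge0// sumr_ge0.
  - by move=> p; rewrite (le_trans (W1P p))// lerDl sumr_ge0.
  - move=> i p; rewrite (le_trans (W2P i p))// (bigD1 i)//= addrCA lerDl.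
    by rewrite addr_ge0// sumr_ge0.
(* Errors of order 2^-k are summable, which yields convergence almost everywhere along the whole
   sequence. *)
have [F FP] : exists F : nat -> 'rV[R]_n -> R, forall k, [/\ smooth_on setT (F k), forall x, 0 <= F k x,
    (sqint lambda K (fun x => F k x - f x)%R <= (1 / (2 ^ (k + 1))%:R)%R%:E)%E &
    forall i, (sqint lambda K (fun x => partial i (F k) x - a x i ord0)%R <= (1 / (2 ^ (k + 1))%:R)%R%:E)%E].
  have e0 k : 0 < 1 / (2 ^ (k + 1))%:R :> R by rewrite divr_gt0// ltr0n expn_gt0.
  exists (fun k => projT1 (cid (W12_approx oU fW f0 cK KU (e0 k)))) => k.
  by case: (cid _).
have sF k := let: And4 h _ _ _ := FP k in h.
have F0 k x : 0 <= F k x by have [_ + _ _] := FP k; apply.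
have mF k : measurable_fun setT (F k : borel 'rV[R]_n -> R).
  by apply: continuous_measurable_rV => x; exact: smooth_on_continuous (sF k) _.
have mdF k i : measurable_fun setT (partial i (F k) : borel 'rV[R]_n -> R).
  apply: continuous_measurable_rV => x.
  exact: (smooth_on_continuous (smooth_on_partial i (sF k)) (Logic.I : setT x)).
have mw : measurable_fun setT (w : borel 'rV[R]_n -> R).
  by apply: continuous_measurable_rV; exact: test_function_continuous tw.
have mdw i : measurable_fun setT (partial i w : borel 'rV[R]_n -> R).
  by apply: continuous_measurable_rV; exact: (test_function_continuous (test_function_partial i tw)).
(* [g] and [g'] are controlled only for t >= 0; precomposition with the positive part makes them
   continuous on the line, which settles measurability. *)
have cmax (h : R -> R) : (forall t : R, 0 <= t -> {for t, continuous h}) -> continuous (fun t : R => h (Num.max t 0)).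
  move=> ch t; apply: (@continuous_comp _ _ _ (fun t : R => Num.max t 0) h).
    by apply: (@continuous_max R R (fun t => t) (cst 0)); [exact: cvg_id|exact: cst_continuous].
  by apply: ch; rewrite le_max lexx orbT.
have cg (t : R) : 0 <= t -> {for t, continuous g}.
  by move=> t0; apply: differentiable_continuous; apply/derivable1_diffP; have [] := dg t t0.
have mcomp (h : R -> R) (u : borel 'rV[R]_n -> R) : (forall t : R, 0 <= t -> {for t, continuous h}) ->
    measurable_fun (K : set (borel 'rV[R]_n)) u -> (forall x, K x -> 0 <= u x) ->
    measurable_fun (K : set (borel 'rV[R]_n)) (h \o u).
  move=> ch mu u0; apply: (eq_measurable_fun ((fun t : R => h (Num.max t 0)) \o u)).
    by move=> x; rewrite inE => Kx /=; rewrite max_l// u0.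
  apply: (measurableT_comp _ mu); apply: continuous_measurable_fun; exact: cmax.
have fK0 x : K x -> 0 <= f x by move=> /KU/f0.
have mgf := mcomp g f cg (mUK _ mf) fK0.
have mg'f := mcomp g' f cg' (mUK _ mf) fK0.
have mTK (h : borel 'rV[R]_n -> R) : measurable_fun setT h -> measurable_fun (K : set (borel 'rV[R]_n)) h.
  by move=> mh; exact: measurable_funTS.
have mgF k := mcomp g (F k) cg (mTK _ (mF k)) (fun x _ => F0 k x).
have mg'F k := mcomp g' (F k) cg' (mTK _ (mF k)) (fun x _ => F0 k x).
pose ai i (p : borel 'rV[R]_n) : R := a p i 0.
have maK i : measurable_fun (K : set (borel 'rV[R]_n)) (ai i) by apply: mUK; have [] := aP i.
have mVK i : measurable_fun (K : set (borel 'rV[R]_n)) (V i) by exact: mUK.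
have a2K i : lambda.-integrable K (EFin \o (fun p => ai i p ^+ 2)).
  by have [_ a2 _] := aP i; exact: a2.
have V2K i : lambda.-integrable K (EFin \o (fun p => V i p ^+ 2)) by exact: V2.
have i1 : lambda.-integrable K (EFin \o cst (1 : R)).
  apply/integrableP; split; first exact/measurable_EFinP.
  rewrite (_ : (\int[_]_(x in _) _)%E = (\int[lambda]_(x in K) cst 1 x)%E).
    by rewrite integral_cst// mul1e.
  by apply: eq_integral => x _ /=; rewrite normr1.
(* A single dominating function for all arguments of [g] and [g'], from (1 + |a|) |V| <= 1 + 2 V^2 +
   a^2. *)
pose dom x := \sum_i (C * W) * (1 + (2 * V i x ^+ 2 + ai i x ^+ 2)).
have idom : lambda.-integrable K (EFin \o dom).
  apply: integrable_EFin_sum => // i; apply: integrable_EFinZ => //.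
  exact: (integrable_EFinD mK i1 (integrable_EFinD mK (integrable_EFinZ 2 mK (V2K i)) (a2K i))).
(* The weak gradient [a] of [f] is kept even when [u] is an approximant, so only the arguments of
   [g] and [g'] vary and convergence almost everywhere under domination suffices. *)
pose Hf (u : 'rV[R]_n -> R) p : R :=
  \sum_i (g (u p) * partial i w p + w p * g' (u p) * ai i p) * V i p.
have Hdom u x : 0 <= u x -> `|Hf u x| <= dom x.
  move=> u0; apply: le_trans (ler_norm_sum _ _ _) _; apply: ler_sum => i _.
  rewrite normrM; have /andP[g0 gCx] := gC _ u0; have g'Cx := g'C _ u0.
  have A1 : `|g (u x) * partial i w x| <= C * W.
    by rewrite normrM ler_pM// ger0_norm.
  have A2 : `|w x * g' (u x) * ai i x| <= C * W * `|ai i x|.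
    by rewrite normrM ler_wpM2r// normrM mulrC ler_pM.
  apply: (@le_trans _ _ ((C * W + C * W * `|ai i x|) * `|V i x|)).
    by rewrite ler_wpM2r// (le_trans (ler_normD _ _))// lerD.
  rewrite -[X in (X + _) * _]mulr1 -mulrDr -mulrA ler_wpM2l ?mulr_ge0//.
  rewrite -(real_normK (num_real (V i x))) -(real_normK (num_real (ai i x))).
  have := normr_ge0 (V i x); have := normr_ge0 (ai i x).
  have := sqr_ge0 (`|V i x| - 1); have := sqr_ge0 (`|V i x| - `|ai i x|).
  nra.
have mH (u : 'rV[R]_n -> R) : measurable_fun (K : set (borel 'rV[R]_n)) (g \o u) ->
    measurable_fun (K : set (borel 'rV[R]_n)) (g' \o u) -> measurable_fun (K : set (borel 'rV[R]_n)) (Hf u).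
  move=> mgu mg'u; apply: measurable_sum => i; apply: measurable_funM => //.
  apply: measurable_funD; apply: measurable_funM => //; try exact: mTK.
  by apply: measurable_funM => //; exact: mTK.
have iHf : lambda.-integrable K (EFin \o Hf f).
  by apply: (integrable_EFin_le mK (mH f mgf mg'f) _ idom) => x Kx; apply: Hdom; exact: fK0.
have UK (h : borel 'rV[R]_n -> R) : (forall p, ~ K p -> h p = 0) ->
    ((\int[lambda]_(p in U) (h p)%:E = \int[lambda]_(p in K) (h p)%:E)%E) /\
    (lambda.-integrable K (EFin \o h) -> lambda.-integrable U (EFin \o h)).
  move=> h0; have E : (EFin \o h) \_ U = (EFin \o h) \_ K.
    apply/funext => p; rewrite /patch; case: ifPn => pU; case: ifPn => pK //.
      by rewrite /= h0// => ?; move: pK; rewrite mem_set.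
    by exfalso; move: pU; rewrite mem_set//; apply: KU; rewrite inE in pK.
  split.
    by rewrite integral_mkcond [RHS]integral_mkcond; apply: eq_integral => p _; rewrite -[LHS]/((_ \_ _) p) E.
  by move=> /(integrable_mkcond _ mK); rewrite -E => /(integrable_mkcond _ mU).
have Hf_out p : ~ K p -> Hf f p = 0.
  move=> /out[wp dwp]; rewrite /Hf big1// => i _.
  by rewrite wp dwp mulr0 !mul0r addr0 mul0r.
have [UE Ui] := UK _ Hf_out.
split; first exact: Ui.
rewrite UE; clear UE Ui.
(* The error of putting [a] in place of the gradient of [F k]; here the L^2 convergence of the
   gradients is spent. *)
pose Ek k p : R := \sum_i (w p * g' (F k p)) * (partial i (F k) p - ai i p) * V i p.
have mE k : measurable_fun (K : set (borel 'rV[R]_n)) (Ek k).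
  apply: measurable_sum => i; apply: measurable_funM => //; apply: measurable_funM.
    by apply: measurable_funM; [exact: mTK|exact: mg'F].
  by apply: measurable_funB => //; exact: mTK.
have s2 k i : lambda.-integrable K (EFin \o (fun p => (partial i (F k) p - ai i p) ^+ 2)).
  apply/L1_sqint; first by apply: measurable_funB => //; exact: mTK.
  by have [_ _ _ /(_ i)] := FP k; move=> /le_lt_trans; apply; rewrite ltry.
(* Young's inequality with a free weight [c]: after integration the first term vanishes as [k] grows
   with [c] fixed, and the second as [c] tends to 0. *)
have Ebound k c p : 0 < c -> `|Ek k p| <=
   \sum_i ((C * W / c) * (partial i (F k) p - ai i p) ^+ 2 + (C * W * c) * V i p ^+ 2).
  move=> c0; apply: le_trans (ler_norm_sum _ _ _) _; apply: ler_sum => i _.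
  set u := partial i (F k) p - ai i p; set v := V i p.
  have A : `|w p * g' (F k p)| <= C * W by rewrite normrM mulrC ler_pM// g'C.
  rewrite !normrM -normrM; apply: (@le_trans _ _ (C * W * `|u| * `|v|)).
    by rewrite ler_wpM2r// ler_wpM2r.
  rewrite (_ : _ + _ = C * W * (c^-1 * u ^+ 2 + c * v ^+ 2)); last by ring.
  rewrite -[leLHS]mulrA ler_wpM2l ?mulr_ge0//.
  rewrite -(real_normK (num_real u)) -(real_normK (num_real v)).
  have -> : c^-1 * `|u| ^+ 2 + c * `|v| ^+ 2 = c * ((`|u| / c - `|v|) ^+ 2) + 2 * (`|u| * `|v|).
    by field; exact: lt0r_neq0.
  have : 0 <= c * (`|u| / c - `|v|) ^+ 2 by rewrite mulr_ge0 ?sqr_ge0// ltW.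
  have : 0 <= `|u| * `|v| by rewrite mulr_ge0.
  by lra.
have iEb k c : lambda.-integrable K (EFin \o (fun p =>
   \sum_i ((C * W / c) * (partial i (F k) p - ai i p) ^+ 2 + (C * W * c) * V i p ^+ 2))).
  by apply: integrable_EFin_sum => // i; apply: integrable_EFinD => //; exact: integrable_EFinZ.
have iE k : lambda.-integrable K (EFin \o Ek k).
  by apply: (integrable_EFin_le mK (mE k) _ (iEb k 1)) => x _; exact: Ebound.
have iHF k : lambda.-integrable K (EFin \o Hf (F k)).
  by apply: (integrable_EFin_le mK (mH _ (mgF k) (mg'F k)) _ idom) => x _; exact: Hdom.
pose S := \sum_i \int[lambda]_(x in K) (V i x ^+ 2).
have S0 : 0 <= S by apply: sumr_ge0 => i _; apply: Rintegral_ge0 => x _; exact: sqr_ge0.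
have HFle k c : 0 < c -> \int[lambda]_(x in K) Hf (F k) x <=
    (C * W / c) *+ n * (1 / (2 ^ (k + 1))%:R) + C * W * c * S.
  move=> c0.
  have sgF := sg _ (sF k) (F0 k).
  have dgF i p : is_derive p (delta_mx 0 i) (g \o F k) (g' (F k p) * partial i (F k) p).
    apply: is_derive_comp_dir; first exact: dg.
    exact: smooth_on_is_derive (sF k) _.
  have dphi i p : partial i (fun p => w p * (g \o F k) p) p =
      g (F k p) * partial i w p + w p * g' (F k p) * partial i (F k) p.
    have D := is_deriveM (smooth_on_is_derive i sw (Logic.I : setT p)) (dgF i p).
    apply: (@etrans _ _ _ _ (@derive_val _ _ _ _ _ _ _ D)).
    by rewrite /GRing.scale/=; ring.
  have tphi : test_function U (fun p => w p * (g \o F k) p).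
    have sub : tsupport (fun p => w p * (g \o F k) p) `<=` K.
      by apply: tsupport_sub; [exact: closed_closure|move=> x /out[-> _]; rewrite mul0r].
    split; first exact: (smooth_onM openT sw sgF).
      exact: (subclosed_compact (@closed_closure _ _) cK sub).
    exact: subset_trans sub KU.
  have := HV _ tphi (fun p => mulr_ge0 (w0 p) (proj1 (andP (gC _ (F0 k p))))).
  have HE p : \sum_i partial i (fun p => w p * (g \o F k) p) p * V i p = Hf (F k) p + Ek k p.
    by rewrite /Hf /Ek -big_split/=; apply: eq_bigr => i _; rewrite dphi; ring.
  under eq_integral do rewrite HE.
  have o p : ~ K p -> Hf (F k) p + Ek k p = 0.
    by move=> /out[wp dwp]; rewrite /Hf /Ek !big1 ?addr0// => i _; rewrite wp ?dwp; ring.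
  have [-> _] := UK _ o.
  have -> : (\int[lambda]_(p in K) (Hf (F k) p + Ek k p)%:E)%E =
      (\int[lambda]_(p in K) (Hf (F k) p + Ek k p))%:E.
    rewrite /Rintegral fineK//; apply: integrable_fin_num => //; exact: integrable_EFinD.
  rewrite lee_fin RintegralD// => H1.
  have H2 : `|\int[lambda]_(x in K) Ek k x| <= (C * W / c) *+ n * (1 / (2 ^ (k + 1))%:R) + C * W * c * S.
    apply: le_trans (le_normr_Rintegral mK (iE k)) _.
    apply: (@le_trans _ _ (\int[lambda]_(p in K) \sum_i
        ((C * W / c) * (partial i (F k) p - ai i p) ^+ 2 + (C * W * c) * V i p ^+ 2))).
      apply: le_Rintegral => //; last by move=> x _; exact: Ebound.
      rewrite (_ : _ \o _ = abse \o (EFin \o Ek k)); [exact: integrable_abse|exact/funext].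
    rewrite Rintegral_sumr//; last first.
      by move=> i; apply: integrable_EFinD => //; exact: integrable_EFinZ.
    rewrite (eq_bigr (fun i =>
        C * W / c * \int[lambda]_(x in K) ((partial i (F k) x - ai i x) ^+ 2) +
        C * W * c * \int[lambda]_(x in K) (V i x ^+ 2))); last first.
      by move=> i _; rewrite RintegralD ?RintegralZl//; exact: integrable_EFinZ.
    rewrite big_split/= -!mulr_sumr lerD//.
    rewrite mulrnAl -mulrnAr ler_wpM2l ?divr_ge0 ?mulr_ge0 ?(ltW c0)//.
    rewrite -[n in leRHS]card_ord -sumr_const; apply: ler_sum => i _.
    have [_ _ _ /(_ i)] := FP k; rewrite /sqint => H.
    by rewrite -lee_fin /Rintegral fineK//; apply: integrable_fin_num => //; exact: s2.
  have := ler_norm (- \int[lambda]_(x in K) Ek k x); rewrite normrN => H3.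
  apply: le_trans H2; apply: le_trans H3; rewrite -subr_ge0; move: H1; rewrite -oppr_ge0.
  by rewrite opprD addrC.
have cvgH : (fun k => \int[lambda]_(x in K) Hf (F k) x) @ \oo --> \int[lambda]_(x in K) Hf f x.
  have mHF k : measurable_fun (K : set (borel 'rV[R]_n)) (fun x => (Hf (F k) x)%:E).
    by apply/measurable_EFinP; apply: mH; [exact: mgF|exact: mg'F].
  have aeF := sqint_summable_ae_cvg mK (fun k => mTK _ (mF k)) (mUK _ mf)
    (fun k => let: And4 _ _ h _ := FP k in h).
  have [||||_ _ H] := @dominated_convergence _ _ _ lambda K mK
     (fun k x => (Hf (F k) x)%:E) (fun x => (Hf f x)%:E) (fun x => (dom x)%:E) mHF.
  - by apply/measurable_EFinP; apply: mH.
  - apply: filterS aeF => x Fx Kx; have {}Fx := Fx Kx.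
    apply: cvg_EFin; first exact: nearW.
    rewrite [X in X @ _](_ : _ = (fun k => Hf (F k) x))//.
    apply: cvg_big => [|i _]; first exact: add_continuous.
    have fx0 := fK0 x Kx.
    have c1 : (fun k => g (F k x)) @ \oo --> g (f x) by apply: (cvg_comp _ _ Fx); exact: cg.
    have c2 : (fun k => g' (F k x)) @ \oo --> g' (f x) by apply: (cvg_comp _ _ Fx); exact: cg'.
    apply: cvgM; last exact: cvg_cst.
    apply: cvgD; first by apply: cvgM => //; exact: cvg_cst.
    by apply: cvgM; [apply: cvgM => //; exact: cvg_cst|exact: cvg_cst].
  - exact: idom.
  - by apply: aeW => x k Kx; rewrite /= lee_fin; exact: Hdom.
  move: H; rewrite (_ : (\int[lambda]_(x in K) (Hf f x)%:E)%E = (\int[lambda]_(x in K) Hf f x)%:E).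
    exact: fine_cvg.
  by rewrite /Rintegral fineK//; exact: integrable_fin_num.
have -> : (\int[lambda]_(p in K) (Hf f p)%:E)%E = (\int[lambda]_(p in K) Hf f p)%:E.
  by rewrite /Rintegral fineK//; exact: integrable_fin_num.
rewrite lee_fin.
have Hc c : 0 < c -> \int[lambda]_(x in K) Hf f x <= C * W * c * S.
  move=> c0; rewrite -[leRHS]add0r -[X in X + _](mulr0 ((C * W / c) *+ n)).
  apply: (ler_cvg_to cvgH _ (nearW _ (fun k => HFle k c c0))).
  apply: cvgD; last exact: cvg_cst.
  apply: cvgM; first exact: cvg_cst.
  have := @cvg_geometric R (1 / 2) (1 / 2) _; rewrite ger0_norm//= => H.
  have : (geometric (1 / 2 : R) (1 / 2)) @ \oo --> 0 by apply: H; lra.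
  apply: cvg_trans; apply: near_eq_cvg; apply: nearW => k /=.
  by rewrite /geometric/= natrX addn1 exprS expr_div_n expr1n; field; rewrite ?expf_neq0.
apply/ler_addgt0Pr => e e0; rewrite add0r.
(* This weight makes C W c S at most [e]; the 1 keeps the denominator positive. *)
have c0 : 0 < e / (C * W * S + 1) by rewrite divr_gt0// ltr_wpDl// !mulr_ge0.
apply: le_trans (Hc _ c0) _.
rewrite mulrAC mulrA ler_pdivrMr ?ltr_wpDl ?mulr_ge0// mulrC ler_wpM2l ?(ltW e0)//.
by rewrite lerDl.
Qed.

End weak_subsolution.

(** * Minkowski norms and their Legendre transform *)

Section strict_convexity.
Context {R : realType} {n : nat}.
Implicit Types (U : set 'rV[R]_n) (f : 'rV[R]_n -> R).

Definition hessian f p : 'M[R]_n := \matrix_(i, j) partial i (partial j f) p.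

Lemma smooth_on_is_derive_line U f (z v : 'rV[R]_n) (t : R) : open U -> smooth_on U f ->
  U (z + t *: v) ->
  is_derive t 1 (fun s : R => f (z + s *: v)) (\sum_i v 0 i * partial i f (z + t *: v)).
Proof.
move=> oU fU Uz; have df := smooth_on_differentiable oU fU Uz.
apply: (proj1 (is_derive_lineP f z v t _)).
by split; [exact: diff_derivable|rewrite deriveE// diff_partial].
Qed.

Lemma hessian_form f (p v : 'rV[R]_n) :
  (v *m hessian f p *m v^T) 0 0 = \sum_j v 0 j * (\sum_i v 0 i * partial i (partial j f) p).
Proof.
rewrite mxE; apply: eq_bigr => j _; rewrite !mxE mulrC; congr (_ * _).
by apply: eq_bigr => i _; rewrite mxE.
Qed.

(** The mean value theorem on the two halves of the segment gives slopes at interior points c2 < c1;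
    applied once more between them, it shows that the slope has increased. *)
Lemma strict_midpoint_convex U f (z v : 'rV[R]_n) : open U -> smooth_on U f -> v != 0 ->
  (forall s : R, -1 <= s <= 1 -> U (z + s *: v) /\ pos_def (hessian f (z + s *: v))) ->
  2 * f z < f (z + v) + f (z - v).
Proof.
move=> oU fU v0 H.
pose f0 (s : R) := f (z + s *: v).
pose f1 (s : R) := \sum_j v 0 j * partial j f (z + s *: v).
pose f2 (s : R) := \sum_j v 0 j * (\sum_i v 0 i * partial i (partial j f) (z + s *: v)).
have d0 (s : R) : -1 <= s <= 1 -> is_derive s 1 f0 (f1 s).
  by move=> /H[Us _]; exact: smooth_on_is_derive_line fU Us.
have d1 (s : R) : -1 <= s <= 1 -> is_derive s 1 f1 (f2 s).
  move=> /H[Us _].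
  rewrite /f1 (_ : (fun _ => _) = \sum_j (fun s : R => v 0 j * partial j f (z + s *: v))).
    apply: is_derive_sum => j; apply: is_deriveZ.
    exact: (smooth_on_is_derive_line oU (smooth_on_partial j fU) Us).
  by apply/funext => t; rewrite fct_sumE.
have p2 (s : R) : -1 <= s <= 1 -> 0 < f2 s.
  by move=> /H[_ /(_ v v0)]; rewrite hessian_form.
have mvt (g g' : R -> R) (a b : R) : -1 <= a -> b <= 1 -> a < b -> (forall s : R, -1 <= s <= 1 -> is_derive s 1 g (g' s)) ->
    exists2 c : R, a < c < b & g b - g a = g' c * (b - a).
  move=> a1 b1 ab dg; have [|| c] := @MVT R g g' a b ab.
  - by move=> x; rewrite in_itv/= => /andP[ax xb]; apply: dg; rewrite (le_trans a1 (ltW ax)) (le_trans (ltW xb)).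
  - apply: derivable_within_continuous => x; rewrite in_itv/= => /andP[ax xb].
    by have [] := dg x _; rewrite ?(le_trans a1 ax) ?(le_trans xb).
  - by rewrite in_itv/= => cab E; exists c.
have [||| c1 /andP[c10 c11] E1] := mvt f0 f1 0 1 _ _ _ d0; [lra|lra|lra|].
have [||| c2 /andP[c20 c21] E2] := mvt f0 f1 (-1) 0 _ _ _ d0; [lra|lra|lra|].
have [||| c /andP[ca cb] E] := mvt f1 f2 c2 c1 _ _ _ d1; [lra|lra|lra|].
have := @mulr_gt0 R (f2 c) (c1 - c2) (p2 c _) _; rewrite -E => /(_ _ _).
move: E1 E2; rewrite /f0 scale1r scale0r scaleN1r addr0 => E1 E2 P.
suff : 0 < f1 c1 - f1 c2 by lra.
by apply: P; lra.
Qed.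

End strict_convexity.

Section minkowski_norms.
Context {R : realType} {n : nat}.
Implicit Types (N : 'rV[R]_n -> R) (a : 'cV[R]_n) (y z : 'rV[R]_n).

(** The fibrewise content of a Finsler structure, isolated so that duality becomes a matter of one
    vector space. *)
Definition minkowski_norm N : Prop := [/\ forall y, 0 <= N y,
  forall (k : R) y, 0 <= k -> N (k *: y) = k * N y,
  smooth_on [set y | y != 0] N &
  forall y, y != 0 -> pos_def (hessian (fun z => N z ^+ 2 / 2) y)].

Definition couple a y : R := (y *m a) 0 0.

Definition legendre_of N a y := forall z, z <> y ->
  couple a z - N z ^+ 2 / 2 < couple a y - N y ^+ 2 / 2.

Lemma coupleZ a (k : R) y : couple a (k *: y) = k * couple a y.
Proof. by rewrite /couple -scalemxAl mxE. Qed.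

Lemma coupleD a y z : couple a (y + z) = couple a y + couple a z.
Proof. by rewrite /couple mulmxDl mxE. Qed.

Lemma coupleN a y : couple a (- y) = - couple a y.
Proof. by rewrite /couple mulNmx mxE. Qed.

Lemma open_neq0 : open [set y : 'rV[R]_n | y != 0].
Proof.
rewrite (_ : [set _ | _] = ~` [set 0]); last first.
  by apply/seteqP; split => y /= /eqP.
apply: closed_openC; apply: accessible_closed_set1; apply: hausdorff_accessible.
exact: norm_hausdorff.
Qed.

Lemma minkowski0 N : minkowski_norm N -> N 0 = 0.
Proof. by move=> [_ NZ _ _]; rewrite -[0 in LHS](scale0r (0 : 'rV[R]_n)) NZ// mul0r. Qed.

(** The segment has to avoid the origin, where N^2 need not be twice differentiable. *)
Lemma minkowski_sqr_midpoint N z v : minkowski_norm N -> v != 0 ->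
  (forall s : R, -1 <= s <= 1 -> z + s *: v != 0) ->
  N z ^+ 2 < N (z + v) ^+ 2 / 2 + N (z - v) ^+ 2 / 2.
Proof.
move=> [N0 NZ sN pdN] v0 zv.
have sE : smooth_on [set y : 'rV[R]_n | y != 0] (fun y => N y ^+ 2 / 2).
  apply: smooth_onM; [exact: open_neq0| |by apply: smooth_on_cst; exact: open_neq0].
  by apply: smooth_onM => //; exact: open_neq0.
have := @strict_midpoint_convex _ _ _ _ z v open_neq0 sE v0.
have -> : 2 * (N z ^+ 2 / 2) = N z ^+ 2 by field.
by apply => s s1; split; [exact: zv|apply: pdN; exact: zv].
Qed.

(** Positivity follows from convexity and homogeneity: a zero at [y] would give zeros at y, 2 y and
    3 y, against strict convexity along that ray. *)
Lemma minkowski_gt0 N y : minkowski_norm N -> y != 0 -> 0 < N y.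
Proof.
move=> mN y0; have [N0 NZ _ _] := mN; rewrite lt0r N0 andbT; apply/eqP => Ny.
have := @minkowski_sqr_midpoint N (2 *: y) y mN y0; rewrite ltNge.
have E (k : R) : 0 <= k -> N (k *: y) = 0 by move=> k0; rewrite NZ// Ny mulr0.
have -> : 2 *: y - y = (1 : R) *: y by rewrite -{2}[y]scale1r -scalerBl; congr (_ *: _); lra.
have -> : 2 *: y + y = (3 : R) *: y by rewrite -{2}[y]scale1r -scalerDl; congr (_ *: _); lra.
rewrite !E ?ler01 ?ler0n// expr0n/= mul0r addr0 lexx => /(_ _)/negP; apply => // s /andP[s1 _].
rewrite -[X in _ + _ *: X]scale1r scalerA -scalerDl scaler_eq0 negb_or y0 andbT; lra.
Qed.

Section maximizer.
Variables (N : 'rV[R]_n -> R) (a : 'cV[R]_n) (y : 'rV[R]_n).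
Hypothesis mN : minkowski_norm N.
Hypothesis ymax : forall z, couple a z - N z ^+ 2 / 2 <= couple a y - N y ^+ 2 / 2.

(** Along the ray t y the objective is t <a, y> - t^2 N(y)^2 / 2, and its maximum over t >= 0 sits
    at t = 1. *)
Lemma maximizer_dual : couple a y = N y ^+ 2.
Proof.
have [N0 NZ _ _] := mN.
have H (t : R) : 0 <= t -> t * couple a y - (t * N y) ^+ 2 / 2 <= couple a y - N y ^+ 2 / 2.
  by move=> t0; have := ymax (t *: y); rewrite coupleZ NZ.
have [Ny0|Ny0] := eqVneq (N y) 0.
  have := H 2 (ler0n _ _); have := H 0 (lexx _); rewrite Ny0; lra.
have p : 0 < N y ^+ 2 by rewrite exprn_gt0// lt0r Ny0 N0.
have D0 : 0 <= couple a y by have := H 0 (lexx _); have := sqr_ge0 (N y); lra.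
(* This is the vertex of the parabola; comparison with t = 1 gives (A - b)^2 <= 0. *)
have := H (couple a y / N y ^+ 2) (divr_ge0 D0 (ltW p)).
set A := couple a y; set b := N y ^+ 2 in p *.
rewrite exprMn -/b; have b0 := lt0r_neq0 p; clearbody A b; clear Ny0.
have -> : A / b * A - (A / b) ^+ 2 * b / 2 = A ^+ 2 / (2 * b) by field.
rewrite -subr_le0 => H1.
have : (A - b) ^+ 2 <= 0.
  rewrite -(pmulr_lle0 _ (_ : 0 < (2 * b)^-1)) ?invr_gt0 ?mulr_gt0//.
  apply: le_trans H1; rewrite le_eqVlt; apply/orP; left; apply/eqP; by field.
move=> H2; apply/eqP; rewrite -subr_eq0 -sqrf_eq0 eq_le H2; exact: sqr_ge0.
Qed.

(** [y] is compared with the multiple of [z] on which the objective is largest, namely <a, z> /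
    N(z)^2 times [z]; for <a, z> <= 0 the bound is immediate. *)
Lemma maximizer_cauchy z : couple a z <= N y * N z.
Proof.
have [N0 NZ _ _] := mN.
have [->|z0] := eqVneq z 0; first by rewrite /couple mul0mx mxE mulr_ge0.
have Nz := minkowski_gt0 mN z0.
have [az|az] := leP (couple a z) 0; first by apply: le_trans az _; rewrite mulr_ge0.
set A := couple a z in az *.
have := ymax ((A / N z ^+ 2) *: z).
rewrite maximizer_dual coupleZ NZ -/A; last by rewrite divr_ge0 ?ltW// exprn_gt0.
have -> : A / N z ^+ 2 * A - (A / N z ^+ 2 * N z) ^+ 2 / 2 = (A / N z) ^+ 2 / 2.
  by field; exact: lt0r_neq0.
have -> : N y ^+ 2 - N y ^+ 2 / 2 = N y ^+ 2 / 2 by field.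
by rewrite ler_pM2r ?invr_gt0// ler_sqr ?nnegrE ?(divr_ge0 (ltW az) (ltW Nz))// ler_pdivrMr.
Qed.

End maximizer.

(** A second maximizer has the same pairing with [a] and the same norm as [y]. If y != 0, the
    pairing is a positive constant on the segment between them, so the segment avoids 0 and strict
    convexity makes its midpoint better; if y = 0, the second maximizer has norm 0. *)
Lemma legendre_of_maximizer N a y : minkowski_norm N ->
  (forall z, couple a z - N z ^+ 2 / 2 <= couple a y - N y ^+ 2 / 2) -> legendre_of N a y.
Proof.
move=> mN ymax z zy; rewrite lt_neqAle ymax andbT; apply/eqP => zE.
have zmax x : couple a x - N x ^+ 2 / 2 <= couple a z - N z ^+ 2 / 2 by rewrite zE.
have dy := maximizer_dual mN ymax; have dz := maximizer_dual mN zmax.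
have NE : N z ^+ 2 = N y ^+ 2 by move: zE; rewrite dy dz; lra.
have [y0|y0] := eqVneq y 0.
  have : z != 0 by apply/eqP => z0; apply: zy; rewrite z0 y0.
  by move=> /(minkowski_gt0 mN) /lt0r_neq0; rewrite -sqrf_eq0 NE y0 (minkowski0 mN) expr0n/= eqxx.
have Ny := minkowski_gt0 mN y0.
pose mid := 2^-1 *: (y + z); pose v := 2^-1 *: (y - z).
have v0 : v != 0.
  by rewrite scaler_eq0 negb_or invr_neq0 ?pnatr_eq0// subr_eq0; apply/eqP => /esym.
have mvy : mid + v = y.
  by apply/matrixP => i j; rewrite !mxE; field.
have mvz : mid - v = z.
  by apply/matrixP => i j; rewrite !mxE; field.
have dm : couple a mid = N y ^+ 2 by rewrite coupleZ coupleD dy dz NE; field.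
have dv : couple a v = 0 by rewrite coupleZ coupleD coupleN dy dz NE subrr mulr0.
have := @minkowski_sqr_midpoint N mid v mN v0.
rewrite mvy mvz NE => H.
have : N mid ^+ 2 < N y ^+ 2 / 2 + N y ^+ 2 / 2.
  apply: H => s _; apply/eqP => /(congr1 (couple a)); rewrite coupleD coupleZ dm dv mulr0 addr0.
  rewrite /couple mul0mx mxE => /eqP; rewrite sqrf_eq0 => /eqP Ny0; by rewrite Ny0 ltxx in Ny.
have := ymax mid; rewrite dm dy; lra.
Qed.

Lemma legendre_of_uniq N a y z : legendre_of N a y -> legendre_of N a z -> y = z.
Proof.
move=> Hy Hz; apply/eqP; apply: contraT => /eqP yz.
by have := lt_trans (Hy z (fun E => yz (esym E))) (Hz y yz); rewrite ltxx.
Qed.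

Lemma legendre_of_le N a y z : legendre_of N a y ->
  couple a z - N z ^+ 2 / 2 <= couple a y - N y ^+ 2 / 2.
Proof. by move=> Hy; have [->//|/eqP/Hy/ltW] := eqVneq z y. Qed.

(** For y != 0 the supremum is attained at y / N(y). For y = 0 the pairing with [a] vanishes
    identically and the supremum is that of {0} or, in dimension 0, of the empty set; both are 0. *)
Lemma legendre_of_polar N a y : minkowski_norm N -> legendre_of N a y ->
  sup [set couple a z | z in [set z | N z = 1]] = N y.
Proof.
move=> mN ly; have ymax z := legendre_of_le z ly; have [N0 NZ _ _] := mN.
set A := [set _ | _ in _].
have [y0|y0] := eqVneq y 0; last first.
  have Ny := minkowski_gt0 mN y0.
  have NE : N ((N y)^-1 *: y) = 1 by rewrite NZ ?invr_ge0// mulVf ?lt0r_neq0.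
  have AN : A (N y).
    exists ((N y)^-1 *: y) => //.
    by rewrite coupleZ (maximizer_dual mN ymax) expr2 mulKf ?lt0r_neq0.
  have ub : ubound A (N y).
    by move=> _ [z /= Nz <-]; have := maximizer_cauchy mN ymax z; rewrite Nz mulr1.
  apply/eqP; rewrite eq_le; apply/andP; split.
    by apply: ge_sup => //; exists (N y).
  by apply: ub_le_sup => //; exists (N y).
rewrite y0 (minkowski0 mN).
have a0 z : couple a z = 0.
  have h x : couple a x <= 0 by have := maximizer_cauchy mN ymax x; rewrite y0 (minkowski0 mN) mul0r.
  by apply/eqP; rewrite eq_le h -oppr_le0 -coupleN h.
have [A0|/set0P [r Ar]] := eqVneq A set0; first by rewrite A0 sup0.
have -> : A = [set 0].
  apply/seteqP; split => [_ [z _ <-]|_ ->]; first by rewrite a0.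
  by move: Ar => [z Nz _]; exists z.
exact: sup1.
Qed.

End minkowski_norms.

Section row_limits.
Context {R : realType} {T : Type} (F : set_system T) {FF : Filter F}.

Lemma cvg_row k (h : T -> 'rV[R]_k) (l : 'rV[R]_k) :
  (forall j, (fun t => h t 0 j) @ F --> l 0 j) -> h @ F --> l.
Proof.
move=> hl; apply/cvg_ballP => e e0.
have : \forall t \near F, forall j, ball (l 0 j) e (h t 0 j).
  apply: filter_forall => j; have /cvg_ballP := hl j; exact.
by apply: filterS => t ht; split=> // i j; rewrite ord1.
Qed.

Lemma cvg_coord k (h : T -> 'rV[R]_k) (l : 'rV[R]_k) j :
  h @ F --> l -> (fun t => h t 0 j) @ F --> l 0 j.
Proof. by move=> hl; exact: (cvg_comp _ _ hl (@coord_continuous R 1 k 0 j l)). Qed.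

Lemma cvg_row_mx n k (p : T -> 'rV[R]_n) (y : T -> 'rV[R]_k) (p0 : 'rV[R]_n) (y0 : 'rV[R]_k) :
  p @ F --> p0 -> y @ F --> y0 -> (fun t => row_mx (p t) (y t)) @ F --> row_mx p0 y0.
Proof.
move=> cp cy; apply: cvg_row => j; rewrite mxE.
under eq_fun do rewrite mxE.
by case: (fintype.split j) => i; exact: cvg_coord.
Qed.

Lemma cvg_couple n (a : T -> 'cV[R]_n) (y : T -> 'rV[R]_n) (a0 : 'cV[R]_n) (y0 : 'rV[R]_n) :
  (forall i, (fun t => a t i 0) @ F --> a0 i 0) -> y @ F --> y0 ->
  (fun t => couple (a t) (y t)) @ F --> couple a0 y0.
Proof.
move=> ca cy; rewrite /couple mxE; under eq_fun do rewrite mxE.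
apply: cvg_big => [|i _]; first exact: add_continuous.
by apply: cvgM; [exact: cvg_coord|exact: ca].
Qed.

(** The l^1 norm, dual to the sup norm of row vectors. *)
Definition abs_sum n (a : 'cV[R]_n) : R := \sum_i `|a i 0|.

Lemma cvg_abs_sum n (a : T -> 'cV[R]_n) (a0 : 'cV[R]_n) :
  (forall i, (fun t => a t i 0) @ F --> a0 i 0) -> (fun t => abs_sum (a t)) @ F --> abs_sum a0.
Proof.
move=> ca; apply: cvg_big => [|i _]; first exact: add_continuous.
exact: cvg_norm.
Qed.

Lemma abs_sum_ge0 n (a : 'cV[R]_n) : 0 <= abs_sum a. Proof. exact: sumr_ge0. Qed.

End row_limits.

(** * Minkowski norms depending continuously on a point *)

Section minkowski_fields.
Context {R : realType} {n : nat} (U : set 'rV[R]_n) (N : 'rV[R]_n -> 'rV[R]_n -> R).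
Hypothesis mN : forall p, U p -> minkowski_norm (N p).
Hypothesis cN : forall z : 'rV[R]_(n + n), U (lsubmx z) ->
  {for z, continuous (fun z => N (lsubmx z) (rsubmx z))}.
Hypothesis oU : open U.

Lemma cvg_norm_field {T : Type} (F : set_system T) {FF : Filter F} (p y : T -> 'rV[R]_n)
    (p0 y0 : 'rV[R]_n) : U p0 -> p @ F --> p0 -> y @ F --> y0 -> (fun t => N (p t) (y t)) @ F --> N p0 y0.
Proof.
move=> Up cp cy; have c := @cvg_row_mx _ _ F FF _ _ _ _ _ _ cp cy.
have Uz : U (lsubmx (row_mx p0 y0)) by rewrite row_mxKl.
have := cvg_comp _ _ c (cN Uz); rewrite row_mxKl row_mxKr; apply: cvg_trans.
by apply: near_eq_cvg; apply: nearW => t /=; rewrite row_mxKl row_mxKr.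
Qed.

(** On the compact unit sphere [N p0] stays above a positive constant, and by continuity so does
    [N p] for [p] near [p0]; homogeneity extends the bound to all vectors. *)
Lemma norm_field_growth p0 : U p0 ->
  exists2 c : R, 0 < c & \forall p \near p0, U p /\ forall y, c * `|y| <= N p y.
Proof.
move=> Up0; pose S := [set y : 'rV[R]_n | `|y| = 1].
have cS : compact S.
  apply: (subclosed_compact _ (@compact_box R n 1)).
    have -> : S = (fun y : 'rV[R]_n => `|y|) @^-1` [set 1] by [].
    apply: preimage_closed; last exact: closed_eq.
    by move=> y _; exact: norm_continuous.
  by move=> y /= Sy; apply/box_norm; rewrite ?Sy ?ler01.
have := (compact_near_coveringP S).1 cS _ (filter_prod (nbhs p0) (at_right (0 : R)))
  (fun pc y => pc.2 < N pc.1 y) _.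
case.
- move=> y /= Sy.
  have y0 : y != 0 by rewrite -normr_eq0 Sy oner_eq0.
  have N0 := minkowski_gt0 (mN Up0) y0.
  have h : \forall t \near filter_prod (nbhs y) (filter_prod (nbhs p0) (at_right (0 : R))),
      N p0 y / 2 < N t.2.1 t.1.
    have c : (fun t => N t.2.1 t.1) @ filter_prod (nbhs y) (filter_prod (nbhs p0) (at_right (0 : R))) --> N p0 y.
      apply: cvg_norm_field => //; last exact: cvg_fst.
      by apply: cvg_comp cvg_snd cvg_fst.
    apply: (cvgr_gt _ c); rewrite ltr_pdivrMr ?ltr_pMr ?ltr1n//.
  have h2 : \forall t \near filter_prod (nbhs y) (filter_prod (nbhs p0) (at_right (0 : R))),
      t.2.2 < N p0 y / 2.
    have : \forall c \near at_right (0 : R), c < N p0 y / 2.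
      by apply: nbhs_right_lt; rewrite divr_gt0.
    move=> H; have cs : t.2.2 @[t --> filter_prod (nbhs y) (filter_prod (nbhs p0) (at_right (0 : R)))] `=>` at_right (0 : R).
      exact: (cvg_comp snd snd cvg_snd cvg_snd).
    exact: (cs _ H).
  by apply: filterS2 h h2 => t /= t1 t2; exact: lt_trans t1.
- move=> [A B] /= [pA cB] AB.
  have [c [c0 Bc]] : exists c : R, 0 < c /\ B c.
    have : \forall c \near at_right (0 : R), 0 < c /\ B c.
      apply: filterI => //; exact: nbhs_right_gt.
    by move=> /filter_ex.
  exists c => //; near=> p.
  have Up : U p by near: p; exact: open_nbhs_nbhs.
  split=> // y; have [->|y0] := eqVneq y 0; first by rewrite normr0 mulr0; have [] := mN Up.
  have Ap : A p by near: p.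
  have ny : 0 < `|y| by rewrite normr_gt0.
  have /(_ (`|y|^-1 *: y)) := AB (p, c) (conj Ap Bc).
  have [_ NZ _ _] := mN Up.
  rewrite /S/= normrZ normfV normr_id mulVf ?gt_eqF// => /(_ erefl)/ltW.
  by rewrite NZ ?invr_ge0// mulrC ler_pdivlMr.
Unshelve. all: by end_near. Qed.


Lemma couple_le (a : 'cV[R]_n) y : couple a y <= abs_sum a * `|y|.
Proof.
rewrite /couple mxE /abs_sum mulr_suml; apply: ler_sum => i _.
apply: le_trans (ler_norm _) _; rewrite normrM mulrC ler_wpM2l//.
exact: ler_coord_norm.
Qed.


(** From c^2 |y|^2 <= N(y)^2 = <a, y> <= |a| |y|, with |a| the l^1 norm. *)
Lemma legendre_of_bound p a y (c : R) : U p -> 0 < c -> (forall y, c * `|y| <= N p y) ->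
  legendre_of (N p) a y -> `|y| <= abs_sum a / c ^+ 2.
Proof.
move=> Up c0 cN' ly; have := maximizer_dual (mN Up) (fun z => legendre_of_le z ly).
have := couple_le a y => h1 h2.
have [->|y0] := eqVneq y 0; first by rewrite normr0 divr_ge0 ?abs_sum_ge0// exprn_ge0// ltW.
have ny : 0 < `|y| by rewrite normr_gt0.
rewrite ler_pdivlMr ?exprn_gt0// -(ler_pM2r ny); apply: le_trans h1; rewrite h2.
rewrite (_ : _ * _ * _ = (c * `|y|) ^+ 2); last by ring.
rewrite ler_sqr ?nnegrE ?mulr_ge0 ?(ltW c0)//; by have [+ _ _ _] := mN Up; exact.
Qed.

Lemma legendre_of_exists p a : U p -> exists y, legendre_of (N p) a y.
Proof.
move=> Up; have [c c0 /nbhs_singleton [_ cN']] := norm_field_growth Up.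
have [N0 _ _ _] := mN Up.
pose f z := couple a z - N p z ^+ 2 / 2.
(* Beyond this radius c^2 |z|^2 / 2 dominates <a, z>, so the objective is at most 0, its value at
   the origin. *)
pose rho := abs_sum a * 2 / c ^+ 2.
have rho0 : 0 <= rho by rewrite !divr_ge0 ?mulr_ge0 ?abs_sum_ge0 ?exprn_ge0// ltW.
have cf (F : set_system 'rV[R]_n) (FF : Filter F) (z : 'rV[R]_n) : F --> z -> f @ F --> f z.
  move=> Fz; apply: cvgB.
    by apply: cvg_couple => [i|]; [exact: cvg_cst|exact: Fz].
  apply: cvgM; last exact: cvg_cst.
  by apply: cvgM; apply: cvg_norm_field => //; exact: cvg_cst.
have [||y yb ymax] := @EVT_max_rV R n f (@box R n rho) _ (@compact_box R n rho).
- by exists 0; apply/box_norm; rewrite ?normr0.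
- by apply: continuous_subspaceT => z; exact: (cf _ (nbhs_filter z)).
exists y; apply: legendre_of_maximizer; first exact: mN.
move=> z; have [zr|zr] := leP `|z| rho; first by apply: ymax; rewrite inE; apply/box_norm.
apply: (@le_trans _ _ (f 0)); last first.
  by apply: ymax; rewrite inE; apply/box_norm; rewrite ?normr0.
rewrite /f (minkowski0 (mN Up)) [couple a 0]/couple mul0mx mxE expr0n/= mul0r subr0 subr_le0.
apply: le_trans (couple_le a z) _.
have z0 : 0 < `|z| by exact: le_lt_trans zr.
apply: (@le_trans _ _ ((c * `|z|) ^+ 2 / 2)); last first.
  rewrite ler_pM2r ?invr_gt0// ler_sqr ?nnegrE ?mulr_ge0 ?(ltW c0)//.
move: zr; rewrite /rho ltr_pdivrMr ?exprn_gt0// => /ltW zr.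
rewrite ler_pdivlMr// exprMn [X in _ <= _ * X]expr2 mulrA mulrAC ler_pM2r//.
by rewrite [leRHS]mulrC.
Qed.

Definition legendre_field p a : 'rV[R]_n := xget 0 (legendre_of (N p) a).

Lemma legendre_fieldP p a : U p -> legendre_of (N p) a (legendre_field p a).
Proof.
move=> Up; have [y ly] := legendre_of_exists a Up.
exact: (@xgetI _ 0 (legendre_of (N p) a) y ly).
Qed.

(* The maximizers for nearby data lie in a fixed compact set, on which, away from
   the strict maximizer [y0], the value stays below the value at [y0]. *)
Lemma legendre_field_continuous (z0 : 'rV[R]_(n + n)) : U (lsubmx z0) ->
  {for z0, continuous (fun z => legendre_field (lsubmx z) (rsubmx z)^T)}.
Proof.
move=> Uz0; set p0 := lsubmx z0 in Uz0 *; set a0 := (rsubmx z0)^T.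
have [c c0 gc] := norm_field_growth Uz0.
pose y0 := legendre_field p0 a0.
have cl : (lsubmx z : 'rV[R]_n) @[z --> z0] --> p0 by exact: continuous_lsubmx.
have cr i : ((rsubmx z)^T : 'cV[R]_n) i 0 @[z --> z0] --> a0 i 0.
  rewrite /a0 !mxE; under eq_fun do rewrite !mxE; exact: coord_continuous.
apply/(@cvgrPdist_lt R 'rV[R]_n 'rV[R]_(n + n) (nbhs z0) (nbhs_filter z0)) => e e0.
rewrite -/p0 -/a0 -/y0.
(* Covectors near [a0] have l^1 norm below |a0| + 1, so their maximizers lie in the box of this
   radius. *)
pose rho := (abs_sum a0 + 1) / c ^+ 2.
pose K := (@box R n rho : set 'rV[R]_n) `&` [set y : 'rV[R]_n | e <= `|y - y0|].
have cK : compact K.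
  apply: compact_closedI; first exact: compact_box.
  rewrite (_ : [set y : 'rV[R]_n | e <= `|y - y0|] = ~` ball y0 e).
    by apply: open_closedC; exact: ball_open.
  apply/seteqP; split => y; rewrite -ball_normE /= distrC leNgt; first by move/negP.
  by move=> h; apply/negP.
have H : \forall z \near z0, K `<=` (fun y => couple (rsubmx z)^T y - N (lsubmx z) y ^+ 2 / 2 <
    couple (rsubmx z)^T y0 - N (lsubmx z) y0 ^+ 2 / 2).
  apply: ((compact_near_coveringP K).1 cK _ (nbhs z0)) => y [_ /= ye].
  have yy0 : y <> y0 by move=> yE; move: ye; rewrite yE subrr normr0 leNgt e0.
  have := legendre_fieldP Uz0 yy0; rewrite -/y0 => lt.
  pose FF := filter_prod (nbhs y) (nbhs z0).
  have c1 : (lsubmx t.2 : 'rV[R]_n) @[t --> FF] --> p0 by exact: (cvg_comp _ _ cvg_snd cl).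
  have c2 i : ((rsubmx t.2)^T : 'cV[R]_n) i 0 @[t --> FF] --> a0 i 0 by exact: (cvg_comp _ _ cvg_snd (cr i)).
  have cc (h : 'rV[R]_n * 'rV[R]_(n + n) -> 'rV[R]_n) h0 : h @ FF --> h0 ->
      (fun t => couple (rsubmx t.2)^T (h t) - N (lsubmx t.2) (h t) ^+ 2 / 2) @ FF -->
      couple a0 h0 - N p0 h0 ^+ 2 / 2.
    move=> ch; apply: cvgB; first exact: cvg_couple.
    by apply: cvgM; [apply: cvgM; exact: cvg_norm_field|exact: cvg_cst].
  have d1 := cc fst y cvg_fst.
  have d2 := cc (cst y0) y0 (cvg_cst _).
  have fF : Filter FF by exact: filter_prod_filter.
  have d := @cvgB _ _ _ FF fF _ _ _ _ (d2 fF) (d1 (nbhs_filter z0)).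
  rewrite -subr_gt0 in lt.
  have := @cvgr_gt _ _ FF fF _ _ d _ lt; apply: filterS => -[y' z] /=; by rewrite subr_gt0.
have b1 : \forall z \near z0, abs_sum (rsubmx z)^T < abs_sum a0 + 1.
  have : abs_sum (rsubmx z)^T @[z --> z0] --> abs_sum a0.
    exact: (@cvg_abs_sum _ _ _ (nbhs_filter z0)).
  by move/cvgr_lt; apply; rewrite ltrDl.
have b2 := cl _ gc.
near=> z.
have [Uz cz] : U (lsubmx z) /\ forall y, c * `|y| <= N (lsubmx z) y by near: z; exact: b2.
have lz := @legendre_fieldP _ (rsubmx z)^T Uz.
set y := legendre_field _ _ in lz *.
rewrite distrC ltNge; apply/negP => ye.
have Ky : K y.
  split=> //; apply/box_norm; first by rewrite divr_ge0 ?addr_ge0 ?abs_sum_ge0 ?exprn_ge0// ltW.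
  apply: le_trans (legendre_of_bound Uz c0 cz lz) _.
  rewrite ler_pM2r ?invr_gt0 ?exprn_gt0//; apply: ltW; near: z; exact: b1.
have Hz : K `<=` (fun y => couple (rsubmx z)^T y - N (lsubmx z) y ^+ 2 / 2 <
    couple (rsubmx z)^T y0 - N (lsubmx z) y0 ^+ 2 / 2) by near: z; exact: H.
by have := lt_le_trans (Hz y Ky) (legendre_of_le y0 lz); rewrite ltxx.
Unshelve. all: by end_near. Qed.

End minkowski_fields.

Lemma sqr_sum_le {R : realFieldType} n (b : 'I_n -> R) :
  (\sum_i b i) ^+ 2 <= n%:R * \sum_i b i ^+ 2.
Proof.
have -> : n%:R * \sum_i b i ^+ 2 = \sum_(i < n) \sum_(j < n) (b i ^+ 2 + b j ^+ 2) / 2.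
  have -> : \sum_(i < n) \sum_(j < n) (b i ^+ 2 + b j ^+ 2) / 2 =
      \sum_(i < n) (n%:R * (b i ^+ 2 / 2) + \sum_(j < n) b j ^+ 2 / 2).
    apply: eq_bigr => i _; under eq_bigr do rewrite mulrDl.
    by rewrite big_split/= sumr_const card_ord mulr_natl.
  rewrite big_split/= sumr_const card_ord -mulr_sumr -!mulr_suml -[X in _ + X]mulr_natl.
  by field.
rewrite expr2 mulr_suml; apply: ler_sum => i _; rewrite mulr_sumr; apply: ler_sum => j _.
by have := sqr_ge0 (b i - b j); nra.
Qed.

Lemma open_lsubmx {R : realType} {n k : nat} (U : set 'rV[R]_n) :
  open U -> open [set z : 'rV[R]_(n + k) | U (lsubmx z)].
Proof.
move=> oU; have -> : [set z : 'rV[R]_(n + k) | U (lsubmx z)] =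
    setT `&` (fun z : 'rV[R]_(n + k) => lsubmx z : 'rV[R]_n) @^-1` U by rewrite setTI.
by apply: (open_preimage_for openT _ oU) => z _; exact: continuous_lsubmx.
Qed.

Section legendre_integrability.
Context {R : realType} {n : nat} (U : set 'rV[R]_n) (N : 'rV[R]_n -> 'rV[R]_n -> R).
Hypothesis mN : forall p, U p -> minkowski_norm (N p).
Hypothesis cN : forall z : 'rV[R]_(n + n), U (lsubmx z) ->
  {for z, continuous (fun z => N (lsubmx z) (rsubmx z))}.
Hypothesis oU : open U.
Local Notation lambda := (lebesgue_rV R n).
Local Notation L := (legendre_field N).

Lemma norm_field_growth_compact (K : set 'rV[R]_n) : compact K -> K `<=` U ->
  exists2 c : R, 0 < c & forall p y, K p -> c * `|y| <= N p y.
Proof.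
move=> cK KU.
have H : \forall c \near at_right (0 : R), K `<=` (fun p => forall y, c * `|y| <= N p y).
  apply: ((compact_near_coveringP K).1 cK _ (at_right (0 : R)) (fun c p => forall y, c * `|y| <= N p y)) => p /KU Up.
  have [c c0 gc] := norm_field_growth mN cN oU Up.
  exists ([set q | forall y, c * `|y| <= N q y], [set t | t < c]).
    split=> /=; first by apply: filterS gc => q [].
    exact: nbhs_right_lt.
  move=> [q t] /= [gq tc] y; apply: le_trans (gq y); rewrite ler_wpM2r//; exact: ltW.
have : \forall c \near at_right (0 : R), 0 < c /\ K `<=` (fun p => forall y, c * `|y| <= N p y).
  by apply: filterI => //; exact: nbhs_right_gt.
by move=> /filter_ex[c [c0 cK']]; exists c => // p y Kp; exact: cK'.
Qed.

Lemma cvg_legendre_field {T : Type} (F : set_system T) {FF : Filter F} (p : T -> 'rV[R]_n)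
    (a : T -> 'cV[R]_n) (p0 : 'rV[R]_n) (a0 : 'cV[R]_n) : U p0 -> p @ F --> p0 ->
  (forall i, (fun t => a t i 0) @ F --> a0 i 0) -> (fun t => L (p t) (a t)) @ F --> L p0 a0.
Proof.
move=> Up cp ca.
have cat : (fun t => (a t)^T) @ F --> a0^T.
  by apply: cvg_row => j; rewrite mxE; under eq_fun do rewrite mxE; exact: ca.
have c := @cvg_row_mx _ _ F FF _ _ _ _ _ _ cp cat.
have Uz : U (lsubmx (row_mx p0 a0^T)) by rewrite row_mxKl.
have := cvg_comp _ _ c (legendre_field_continuous mN cN oU Uz); rewrite row_mxKl row_mxKr trmxK.
by apply: cvg_trans; apply: near_eq_cvg; apply: nearW => t /=; rewrite row_mxKl row_mxKr trmxK.
Qed.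

(** The Legendre transform is continuous in the pair (p, a), and p -> (p, a p) is measurable because
    its coordinates are. *)
Lemma measurable_legendre_field (a : 'rV[R]_n -> 'cV[R]_n) i :
  (forall j, measurable_fun (U : set (borel 'rV[R]_n)) (fun p => a p j 0)) ->
  measurable_fun (U : set (borel 'rV[R]_n)) (fun p => L p (a p) 0 i).
Proof.
move=> ma; pose W := [set z : 'rV[R]_(n + n) | U (lsubmx z)].
have oW : open W by exact: open_lsubmx.
pose g (z : borel 'rV[R]_(n + n)) : R := L (lsubmx z) (rsubmx z)^T 0 i.
have mg : measurable_fun (W : set (borel 'rV[R]_(n + n))) g.
  apply: (continuous_borel_real oW) => z Wz.
  exact: (cvg_comp _ _ (legendre_field_continuous mN cN oU Wz) (@coord_continuous R 1 n 0 i _)).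
have mU : measurable (U : set (borel 'rV[R]_n)) by exact: borel_open.
pose h (p : borel 'rV[R]_n) : borel 'rV[R]_(n + n) := row_mx (p : 'rV[R]_n) (a p)^T.
have mh : measurable_fun (U : set (borel 'rV[R]_n)) h.
  apply: measurable_fun_rV => // j; rewrite /h.
  under eq_fun do rewrite mxE.
  case: (fintype.split j) => k; last by under eq_fun do rewrite mxE; exact: ma.
  by apply: measurable_funTS; exact: measurable_coord.
have -> : (fun p => L p (a p) 0 i) = g \o h.
  by apply/funext => p; rewrite /g /h /= row_mxKl row_mxKr trmxK.
apply: (@measurable_comp _ _ _ _ _ _ (W : set (borel 'rV[R]_(n + n)))) => //; first exact: borel_open.
by move=> _ [p Up <-]; rewrite /W /h /= row_mxKl.
Qed.

(** On a compact set the maximizer is bounded by a constant times the l^1 norm of [a], and [sigma]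
    is bounded, so square integrability passes from [a] to the field. *)
Lemma legendre_field_sqr_L1loc (a : 'rV[R]_n -> 'cV[R]_n) (sigma : 'rV[R]_n -> R) i :
  (forall j, measurable_fun (U : set (borel 'rV[R]_n)) (fun p => a p j 0)) ->
  (forall j, L1loc lambda U (fun p => a p j 0 ^+ 2)) -> smooth_on U sigma ->
  measurable_fun (U : set (borel 'rV[R]_n)) (fun p => sigma p * L p (a p) 0 i) /\
  L1loc lambda U (fun p => (sigma p * L p (a p) 0 i) ^+ 2).
Proof.
move=> ma a2 ss; have mL := measurable_legendre_field i ma.
have cs p : U p -> {for p, continuous sigma} by exact: smooth_on_continuous.
have ms : measurable_fun (U : set (borel 'rV[R]_n)) sigma by exact: continuous_borel_real.
have mV : measurable_fun (U : set (borel 'rV[R]_n)) (fun p => sigma p * L p (a p) 0 i).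
  exact: measurable_funM.
split=> // K cK KU.
have mK : measurable (K : set (borel 'rV[R]_n)) by apply: borel_compact => //; exact: norm_hausdorff.
have [c c0 gc] := norm_field_growth_compact cK KU.
have [C CP] : exists C : R, forall p, K p -> `|sigma p| <= C.
  by apply: compact_continuous_bounded => //; apply: continuous_in_subspaceT => p /set_mem/KU/cs.
(* The factor [n] comes from bounding the square of the l^1 norm by n times the sum of squares. *)
pose B := C ^+ 2 * (c ^+ 2)^-1 ^+ 2 * n%:R.
pose G (p : borel 'rV[R]_n) : R := \sum_j B * a p j 0 ^+ 2.
pose f (p : borel 'rV[R]_n) : R := (sigma p * L p (a p) 0 i) ^+ 2.
apply: (@integrable_EFin_le _ _ _ lambda (K : set (borel 'rV[R]_n)) f G mK); rewrite /f /G.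
- apply: measurable_funX; apply: measurable_funS mV => //; exact: borel_open.
- move=> p Kp; rewrite ger0_norm ?sqr_ge0// exprMn -mulr_sumr.
  have Up := KU p Kp.
  have b := legendre_of_bound mN Up c0 (fun y => gc p y Kp) (legendre_fieldP mN cN oU Up).
  have b1 : `|L p (a p) 0 i| <= abs_sum (a p) / c ^+ 2 by apply: le_trans (b _); exact: ler_coord_norm.
  have s1 : sigma p ^+ 2 <= C ^+ 2.
    have C0 := le_trans (normr_ge0 _) (CP p Kp).
    by rewrite -(real_normK (num_real (sigma p))) ler_sqr ?nnegrE ?CP.
  have s2 : L p (a p) 0 i ^+ 2 <= (c ^+ 2)^-1 ^+ 2 * abs_sum (a p) ^+ 2.
    rewrite -(real_normK (num_real (L p (a p) 0 i))) -exprMn mulrC.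
    by rewrite ler_sqr ?nnegrE// divr_ge0 ?abs_sum_ge0// exprn_ge0// ltW.
  apply: le_trans (ler_pM (sqr_ge0 _) (sqr_ge0 _) s1 s2) _.
  rewrite mulrA /B -[leRHS]mulrA (ler_wpM2l (mulr_ge0 (sqr_ge0 _) (sqr_ge0 _)))//.
  apply: le_trans (sqr_sum_le _) _; rewrite ler_wpM2l//.
  by apply: ler_sum => j _; rewrite real_normK// num_real.
- apply: integrable_EFin_sum => // j.
  apply: (integrable_EFinZ B mK); exact: a2.
Qed.

End legendre_integrability.

(** * Finsler manifolds in charts *)

Section charts.
Context {R : realType} {n : nat} {M : manifold R n}.
Implicit Types (c : chart R n M) (x : M) (p : 'rV[R]_n).

Lemma chart_continuous c x : is_chart c -> cdom c x -> {for x, continuous (cmap c)}.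
Proof.
by move=> [oD _ + _ _] Dx; rewrite continuous_open_subspace// => /(_ x (mem_set Dx)).
Qed.

Lemma chart_inv_continuous c p : is_chart c -> cimage c p -> {for p, continuous (cinv c)}.
Proof.
by move=> [_ oU _ + _] Up; rewrite continuous_open_subspace// => /(_ p (mem_set Up)).
Qed.

Lemma cinvK c p : is_chart c -> cimage c p -> cmap c (cinv c p) = p.
Proof. by move=> [_ _ _ _ K] [x Dx <-]; rewrite K. Qed.

Lemma cinv_dom c p : is_chart c -> cimage c p -> cdom c (cinv c p).
Proof. by move=> [_ _ _ _ K] [x Dx <-]; rewrite K. Qed.

Lemma cimage_setI c (A : set M) : is_chart c ->
  cmap c @` (cdom c `&` A) = cimage c `&` cinv c @^-1` A.
Proof.
move=> hc; have [_ _ _ _ K] := hc; apply/seteqP; split => [_ [x [Dx Ax] <-]|p [Up Ap]].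
  by split; [exists x|rewrite /= K].
by exists (cinv c p); [split=> //; exact: cinv_dom|exact: cinvK].
Qed.

Lemma open_cimage_setI c (A : set M) : is_chart c -> open A -> open (cmap c @` (cdom c `&` A)).
Proof.
move=> hc oA; rewrite cimage_setI//; have [_ oU _ _ _] := hc.
by apply: (open_preimage_for oU _ oA) => p Up; exact: chart_inv_continuous.
Qed.

Section transitions.
Variables (c c' : chart R n M) (p : 'rV[R]_n).
Hypotheses (hc : atlas c) (hc' : atlas c') (Up : cimage c p) (Dp : cdom c' (cinv c p)).
Let W : set 'rV[R]_n := cmap c @` (cdom c `&` cdom c').
Let tau := transition c c'.

Lemma transition_open : open W.
Proof.
have [oD' _ _ _ _] := atlas_chart hc'; apply: open_cimage_setI => //; exact: atlas_chart.
Qed.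

Lemma transition_mem : W p.
Proof. by rewrite /W cimage_setI//; exact: atlas_chart. Qed.

Lemma transition_differentiable : differentiable tau p.
Proof.
apply: differentiable_rowP => j.
apply: (smooth_on_differentiable transition_open _ transition_mem).
exact: (atlas_smooth hc hc').
Qed.

Lemma jacobian_transition i j : jacobian tau p i j = partial i (fun q => tau q 0 j) p.
Proof. by rewrite jacobian_partial//; exact: transition_differentiable. Qed.

Lemma cinv_transition q : W q -> cinv c' (tau q) = cinv c q.
Proof.
rewrite /W cimage_setI; last exact: atlas_chart.
by move=> [Uq Dq]; have [_ _ _ _ K] := atlas_chart hc'; rewrite /tau /transition /= K.
Qed.

Lemma transition_cimage : cimage c' (tau p).
Proof. by exists (cinv c p). Qed.

Lemma partial_transition (f : M -> R) i : differentiable (f \o cinv c') (tau p) ->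
  is_derive p (delta_mx 0 i) (f \o cinv c)
    (\sum_j jacobian tau p i j * partial j (f \o cinv c') (tau p)).
Proof.
move=> df; have := is_derive_comp_row i df transition_differentiable.
rewrite (eq_bigr (fun j => jacobian tau p i j * partial j (f \o cinv c') (tau p))); last first.
  by move=> j _; rewrite jacobian_transition.
apply: (is_derive_near_eq transition_open transition_mem) => q; rewrite inE => Wq.
by rewrite /= cinv_transition.
Qed.

End transitions.

(** The chain rule is applied to the coordinate functions of [c] read in [c']; read in [c] they are
    the coordinates themselves, with partial derivatives 0 or 1. *)
Lemma transition_jacobian_mul (c c' : chart R n M) p : atlas c -> atlas c' -> cimage c p ->
  cdom c' (cinv c p) ->
  jacobian (transition c c') p *m jacobian (transition c' c) (transition c c' p) = 1%:M.
Proof.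
move=> hc hc' Up Dp; have K := cinv_transition hc hc' (transition_mem hc Up Dp).
have Up' := @transition_cimage c c' p Dp.
have Dp' : cdom c (cinv c' (transition c c' p)) by rewrite K; apply: cinv_dom => //; exact: atlas_chart.
apply/matrixP => i k; rewrite !mxE.
have sk := atlas_smooth hc' hc k.
have df := smooth_on_differentiable (transition_open hc' hc) sk (transition_mem hc' Up' Dp').
have D := @partial_transition c c' p hc hc' Up Dp (fun x => cmap c x 0 k) i df.
have [_ oU _ _ _] := atlas_chart hc.
have E : {in cimage c, (fun x => cmap c x 0 k) \o cinv c =1 (fun q : 'rV[R]_n => q 0 k)}.
  by move=> q; rewrite inE => Uq /=; rewrite cinvK//; exact: atlas_chart.
have D' := is_derive_near_eq oU Up E D.
rewrite -(partial_coord i k p) /partial (@derive_val _ _ _ _ _ _ _ D').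
by apply: eq_bigr => j _; rewrite -(jacobian_transition hc' hc Up' Dp').
Qed.

Lemma to_preferred_unit c p : atlas c -> cimage c p -> to_preferred c p \in unitmx.
Proof.
move=> hc Up; apply: (mulmx1_unit (transition_jacobian_mul hc (chart_at_atlas _) Up _)).1.
exact: chart_at_dom.
Qed.

Lemma chart_atK x : cinv (chart_at x) (cmap (chart_at x) x) = x.
Proof. by have [_ _ _ _ K] := atlas_chart (chart_at_atlas x); rewrite K//; exact: chart_at_dom. Qed.

Lemma chart_at_cimage x : cimage (chart_at x) (cmap (chart_at x) x).
Proof. by exists x => //; exact: chart_at_dom. Qed.

Lemma to_preferred_chart_at x : to_preferred (chart_at x) (cmap (chart_at x) x) = 1%:M.
Proof.
rewrite /to_preferred chart_atK; set c := chart_at x.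
have hc : atlas c by exact: chart_at_atlas.
have Up := chart_at_cimage x; rewrite -/c in Up *.
have Dx : cdom c (cinv c (cmap c x)) by rewrite chart_atK; exact: chart_at_dom.
have [_ oU _ _ _] := atlas_chart hc.
apply/matrixP => i k; rewrite (jacobian_transition hc hc Up Dx) mxE -(partial_coord i k (cmap c x)).
apply: near_eq_derive; near=> q; rewrite /transition /= cinvK//; first exact: atlas_chart.
by near: q; exact: open_nbhs_nbhs.
Unshelve. all: by end_near. Qed.

Lemma covector_in_differential c (u : M -> R) p i : atlas c -> smooth_fun u -> cimage c p ->
  covector_in c (differential u) p i 0 = partial i (u \o cinv c) p.
Proof.
move=> hc su Up; set x := cinv c p; set c' := chart_at x.
have hc' : atlas c' by exact: chart_at_atlas.
have Dp : cdom c' (cinv c p) by exact: chart_at_dom.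
have [_ oU' _ _ _] := atlas_chart hc'.
have df := smooth_on_differentiable oU' (su c' hc') (@transition_cimage c c' p Dp).
rewrite [RHS](@derive_val _ _ _ _ _ _ _ (@partial_transition c c' p hc hc' Up Dp u i df)).
by rewrite /covector_in mxE; apply: eq_bigr => j _; rewrite [X in _ * X]mxE.
Qed.

End charts.

Section finsler_charts.
Context {R : realType} {n : nat} {M : manifold R n}.
Variable F : forall x : M, tangent x -> R.
Hypothesis hF : finsler_structure F.
Implicit Types (c : chart R n M) (x : M) (p y : 'rV[R]_n).

Lemma F_in_minkowski c p : atlas c -> cimage c p -> minkowski_norm (F_in F c p).
Proof.
move=> hc Up; have [F0 _ sF FZ pF] := hF; split.
- by move=> y; exact: F0.
- by move=> k y k0; rewrite /F_in /tangent_of -scalemxAl; exact: FZ.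
- have [_ oU _ _ _] := atlas_chart hc.
  pose V := [set z : 'rV[R]_(n + n) | cimage c (lsubmx z) /\ rsubmx z != 0].
  have oV : open V.
    have -> : V = [set z : 'rV[R]_(n + n) | cimage c (lsubmx z)] `&` [set z | rsubmx z != 0] by [].
    apply: openI; first exact: open_lsubmx.
    have -> : [set z : 'rV[R]_(n + n) | rsubmx z != 0] =
      setT `&` (fun z : 'rV[R]_(n + n) => rsubmx z : 'rV[R]_n) @^-1` [set y | y != 0] by rewrite setTI.
    by apply: (open_preimage_for openT _ open_neq0) => z _; exact: continuous_rsubmx.
  have sG := @smooth_on_comp_row R n (n + n) [set y | y != 0] V (fun y => row_mx p y) _ open_neq0 oV _ (sF c hc) _.
  have -> : F_in F c p = (fun z => F_in F c (lsubmx z) (rsubmx z)) \o (fun y => row_mx p y).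
    by apply/funext => y /=; rewrite row_mxKl row_mxKr.
  apply: sG => [j|y y0].
    rewrite (_ : (fun y => _) = fun y => match fintype.split j with inl k => p 0 k | inr k => y 0 k end).
      by case: (fintype.split j) => k; [apply: smooth_on_cst|apply: smooth_on_coord]; exact: open_neq0.
    by apply/funext => y; rewrite mxE.
  by split; rewrite ?row_mxKl ?row_mxKr.
- by move=> y y0; exact: (pF c hc p y Up y0).
Qed.

Lemma F_in_continuous c (z : 'rV[R]_(n + n)) : atlas c -> cimage c (lsubmx z) ->
  {for z, continuous (fun z => F_in F c (lsubmx z) (rsubmx z))}.
Proof.
move=> hc Uz; have [_ cF _ _ _] := hF; have [_ oU _ _ _] := atlas_chart hc.
have := cF c hc; rewrite continuous_open_subspace.
  by move=> /(_ z (mem_set Uz)).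
exact: open_lsubmx.
Qed.

Lemma F_minkowski x : minkowski_norm (@F x : 'rV[R]_n -> R).
Proof.
have := F_in_minkowski (chart_at_atlas x) (chart_at_cimage x).
suff -> : F_in F (chart_at x) (cmap (chart_at x) x) = @F x by [].
apply/funext => y; rewrite /F_in /tangent_of to_preferred_chart_at mulmx1.
(* The type of tangent vectors depends on the point, and [cinv] after [cmap] returns [x] only up to
   a proved equality; quantifying over [x'] allows the substitution. *)
have G : forall x' : M, x' = x -> @F x' (y : 'rV[R]_n) = @F x (y : 'rV[R]_n) by move=> x' ->.
exact/G/chart_atK.
Qed.

Local Notation L c := (legendre_field (F_in F c)).

Lemma F_in_legendreP c p a : atlas c -> cimage c p -> legendre_of (F_in F c p) a (L c p a).
Proof.
move=> hc Up; have [_ oU _ _ _] := atlas_chart hc.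
apply: (@legendre_fieldP _ _ (cimage c)) => //; first by move=> q; exact: F_in_minkowski.
by move=> z; exact: F_in_continuous.
Qed.

(** The invertible matrix [to_preferred] transports the pairing and the norm, and with them the
    strict maximizer. *)
Lemma legendre_chart c p (alpha : forall x, cotangent x) : atlas c -> cimage c p ->
  legendre F (alpha (cinv c p)) = tangent_of c p (L c p (covector_in c alpha p)) /\
  legendre_of (@F (cinv c p) : 'rV[R]_n -> R) (alpha (cinv c p)) (legendre F (alpha (cinv c p))).
Proof.
move=> hc Up; set a := covector_in c alpha p; set y := L c p a; set J := to_preferred c p.
have ly : legendre_of (F_in F c p) a y by exact: F_in_legendreP.
have uJ : J \in unitmx by exact: to_preferred_unit.
suff H : legendre_of (@F (cinv c p) : 'rV[R]_n -> R) (alpha (cinv c p)) (y *m J).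
  suff E : legendre F (alpha (cinv c p)) = y *m J by rewrite E.
  apply: xget_unique; first exact: H.
  by move=> z lz; apply: (legendre_of_uniq lz H).
move=> z zy; rewrite -(mulmxKV uJ z).
have zy' : z *m invmx J <> y by move=> E; apply: zy; rewrite -E mulmxKV.
by have := ly _ zy'; rewrite /couple /a /covector_in !mulmxA.
Qed.

Lemma legendreP x (a : cotangent x) : legendre_of (@F x : 'rV[R]_n -> R) a (legendre F a).
Proof.
have [_] := legendre_chart (fun=> a) (chart_at_atlas x) (chart_at_cimage x).
have G : forall x' : M, x' = x ->
  legendre_of (@F x' : 'rV[R]_n -> R) a (@legendre R n M F x' (a : 'cV[R]_n)) ->
  legendre_of (@F x : 'rV[R]_n -> R) a (@legendre R n M F x a) by move=> x' ->.
exact/G/chart_atK.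
Qed.

Lemma polarE x (a : cotangent x) : polar F a = @F x (legendre F a).
Proof. exact: (legendre_of_polar (F_minkowski x) (@legendreP x a)). Qed.

(** This turns Drho(grad rho) into F*(Drho)^2 in the energy. *)
Lemma pairing_legendre x (a : cotangent x) : pairing a (legendre F a) = polar F a ^+ 2.
Proof.
rewrite polarE; apply: (maximizer_dual (F_minkowski x)) => z.
exact: (legendre_of_le z (@legendreP x a)).
Qed.

Lemma pairing_le x (a : cotangent x) (y : tangent x) : pairing a y <= polar F a * @F x y.
Proof.
rewrite polarE; apply: (maximizer_cauchy (F_minkowski x)) => z.
exact: (legendre_of_le z (@legendreP x a)).
Qed.

Lemma polar_ge0 x (a : cotangent x) : 0 <= polar F a.
Proof. by rewrite polarE; have [F0 _ _ _ _] := hF. Qed.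

Lemma polar0 x : @polar R n M F x (0 : 'cV[R]_n) = 0.
Proof.
apply/eqP; rewrite -sqrf_eq0 -(pairing_legendre (x := x)) /pairing mulmx0 mxE//.
Qed.

Lemma pairing_chart c p (alpha beta : forall x, cotangent x) : atlas c -> cimage c p ->
  pairing (beta (cinv c p)) (legendre F (alpha (cinv c p))) =
  \sum_i covector_in c beta p i 0 * L c p (covector_in c alpha p) 0 i.
Proof.
move=> hc Up; have [-> _] := legendre_chart alpha hc Up.
rewrite /pairing /tangent_of -mulmxA mxE; apply: eq_bigr => i _.
by rewrite mulrC.
Qed.

Lemma polar_chart c p (alpha : forall x, cotangent x) : atlas c -> cimage c p ->
  polar F (alpha (cinv c p)) = F_in F c p (L c p (covector_in c alpha p)).
Proof. by move=> hc Up; rewrite polarE; have [-> _] := legendre_chart alpha hc Up. Qed.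

(** The preferred chart may change abruptly with the point, so continuity is read in one fixed
    chart, where the Legendre transform of smooth partial derivatives appears. It serves to bound
    F*(Du) on the support of [u]. *)
Lemma polar_differential_continuous (u : M -> R) x : smooth_fun u ->
  {for x, continuous (fun x => polar F (differential u x))}.
Proof.
move=> su; set c := chart_at x; have hc : atlas c by exact: chart_at_atlas.
have [oD oU _ _ _] := atlas_chart hc.
have Dx : cdom c x by exact: chart_at_dom.
pose f p := F_in F c p (L c p (covector_in c (differential u) p)).
have Up : cimage c (cmap c x) by exact: chart_at_cimage.
have cf : {for cmap c x, continuous f}.
  have cN z : cimage c (lsubmx z) -> {for z, continuous (fun z => F_in F c (lsubmx z) (rsubmx z))}.
    by move=> Uz; exact: F_in_continuous.
  have mN p : cimage c p -> minkowski_norm (F_in F c p) by move=> ?; exact: F_in_minkowski.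
  apply: (@cvg_norm_field _ _ (cimage c) _ cN _ _ (nbhs_filter (cmap c x))) => //.
  apply: (@cvg_legendre_field _ _ (cimage c) _ mN cN oU _ _ (nbhs_filter (cmap c x))) => // i.
  have cd : {for cmap c x, continuous (partial i (u \o cinv c))}.
    by apply: (smooth_on_continuous (smooth_on_partial i (su c hc)) Up).
  apply: (continuous_near_eq oU Up _ cd) => p; rewrite inE => Uq.
  by rewrite covector_in_differential.
have cc : {for x, continuous (f \o cmap c)}.
  by apply: continuous_comp; [exact: (chart_continuous (atlas_chart hc) Dx)|exact: cf].
apply: (continuous_near_eq oD Dx _ cc) => z; rewrite inE => Dz /=.
have Uz : cimage c (cmap c z) by exists z.
rewrite /f -(polar_chart (differential u) hc Uz).
by have [_ _ _ _ K] := atlas_chart hc; rewrite K.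
Qed.

End finsler_charts.

(** * Transfer of integrals from the manifold to a chart *)

Section change_of_variables.
Import HBNNSimple.
Context d d' (T : measurableType d) (T' : measurableType d') (R : realType).
Variables (m : {measure set T -> \bar R}) (lam : {measure set T' -> \bar R}).
Variables (E : set T) (phi : T -> T') (D : set T') (s : T' -> R).
Hypotheses (mE : measurable E) (mphi : measurable_fun E phi) (mD : measurable D)
  (ms : measurable_fun D s) (s0 : forall p, D p -> 0 <= s p)
  (phiD : forall x, E x -> D (phi x))
  (density : forall A, measurable A ->
     m (E `&` phi @^-1` A) = (\int[lam]_(p in A `&` D) (s p)%:E)%E).

(** The hypothesis [density] is the formula for sets; simple functions, monotone limits and positive
    and negative parts will extend it to real functions. *)
Lemma change_of_variables_indic (A : set T') (k : R) : measurable A -> 0 <= k ->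
  (\int[m]_(x in E) (k * \1_A (phi x))%:E = \int[lam]_(p in D) (k * \1_A p * s p)%:E)%E.
Proof.
move=> mA k0; have mEA : measurable (E `&` phi @^-1` A) by exact: mphi.
transitivity (\int[m]_(x in E) (k%:E * (\1_(E `&` phi @^-1` A) x)%:E))%E.
  apply: eq_integral => x; rewrite inE => Ex; rewrite EFinM !indicE; congr (_ * (_%:R)%:E)%E.
  by congr nat_of_bool; apply/idP/idP; rewrite !inE; [move=> Ax|case].
rewrite (@ge0_integralZl _ _ _ m E mE (fun x => (\1_(E `&` phi @^-1` A) x)%:E)%E); last 3 first.
  - by apply/measurable_EFinP; apply: measurable_funTS; exact: measurable_indic.
  - by move=> x _; rewrite lee_fin.
  - by rewrite lee_fin.
rewrite integral_indic// -setIA [phi @^-1` A `&` E]setIC setIA setIid density//.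
rewrite setIC integral_mkcondr.
transitivity (\int[lam]_(p in D) (k%:E * ((EFin \o s) \_ A) p))%E.
  rewrite ge0_integralZl//.
  - apply: (proj1 (measurable_restrict _ mA mD)); apply: (measurable_funS mD _ (proj2 (measurable_EFinP _ _) ms)).
    exact: subIsetl.
  - by move=> p Dp; rewrite patchE; case: ifP => // _; rewrite lee_fin s0.
apply: eq_integral => p _; rewrite patchE indicE; case: (p \in A) => /=.
  by rewrite mulr1 EFinM.
by rewrite mulr0 mul0r mule0.
Qed.

Lemma change_of_variables_nnsfun (f : {nnsfun T' >-> R}) :
  (\int[m]_(x in E) (f (phi x))%:E = \int[lam]_(p in D) (f p * s p)%:E)%E.
Proof.
have mf r : measurable (f @^-1` [set r]) by [].
have [N [k fE]] : exists N (k : 'I_N -> R), forall p, f p = \sum_i k i * \1_(f @^-1` [set k i]) p.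
  by eexists; eexists => p; exact: fimfunEord.
have ge0 i p : 0 <= k i * \1_(f @^-1` [set k i]) p.
  rewrite indicE; case: (boolP (p \in _)) => [|_]; last by rewrite mulr0.
  by rewrite inE /= => <-; rewrite mulr1.
have mi i : measurable_fun setT (\1_(f @^-1` [set k i]) : T' -> R) by exact: measurable_indic.
under eq_integral do rewrite fE -sumEFin.
under [RHS]eq_integral do rewrite fE mulr_suml -sumEFin.
rewrite !ge0_integral_sum//.
- apply: eq_bigr => i _; have [k0|k0] := leP 0 (k i); first exact: change_of_variables_indic.
  have -> : f @^-1` [set k i] = set0.
    by apply/seteqP; split => // p /= fp; move: k0; rewrite -fp ltNge fun_ge0.
  by rewrite !integral0_eq// => p _; rewrite indic0 mulr0 ?mul0r.
- move=> i; apply/measurable_EFinP; apply: measurable_funM => //.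
  by apply: measurable_funM => //; exact: measurable_funTS.
- by move=> i p Dp; rewrite lee_fin mulr_ge0// s0.
- move=> i; apply/measurable_EFinP; apply: measurable_funM => //.
  by apply: (measurable_comp (F := setT)).
- by move=> i x _; rewrite lee_fin.
Qed.

Lemma ge0_change_of_variables (g : T' -> \bar R) : measurable_fun setT g -> (forall p, (0 <= g p)%E) ->
  (\int[m]_(x in E) g (phi x) = \int[lam]_(p in D) (g p * (s p)%:E))%E.
Proof.
move=> mg g0; pose f := nnsfun_approx measurableT mg.
have nd k l p : (k <= l)%N -> f k p <= f l p by move=> kl; exact/lefP/nd_nnsfun_approx.
have cf p : ((f k p)%:E @[k --> \oo] --> g p)%E by exact: cvg_nnsfun_approx.
transitivity (limn (fun k => \int[m]_(x in E) (f k (phi x))%:E))%E.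
  rewrite -monotone_convergence//.
  - by apply: eq_integral => x _; apply/esym/cvg_lim => //; exact: cf.
  - by move=> k; apply/measurable_EFinP; apply: (measurable_comp (F := setT)).
  - by move=> k x _; rewrite lee_fin.
  - by move=> x _ k l kl; rewrite lee_fin; exact: nd.
transitivity (limn (fun k => \int[lam]_(p in D) (f k p * s p)%:E))%E.
  by congr (limn _); apply/funext => k; exact: change_of_variables_nnsfun.
rewrite -monotone_convergence//.
- apply: eq_integral => p; rewrite inE => Dp; apply/cvg_lim => //.
  rewrite (_ : (fun k => _) = (fun k => (f k p)%:E * (s p)%:E)%E)//.
  by apply: cvgeMr => //; exact: cf.
- move=> k; apply/measurable_EFinP; apply: measurable_funM => //; exact: measurable_funTS.
- by move=> k p Dp; rewrite lee_fin mulr_ge0// s0.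
- by move=> p Dp k l kl; rewrite lee_fin ler_wpM2r ?s0//; exact: nd.
Qed.

Lemma change_of_variables (f : T' -> R) : measurable_fun D f ->
  (\int[m]_(x in E) (f (phi x))%:E = \int[lam]_(p in D) (f p * s p)%:E)%E.
Proof.
move=> mf; have part (g : T' -> \bar R) : measurable_fun D g -> (forall p, (0 <= g p)%E) ->
    (\int[m]_(x in E) g (phi x) = \int[lam]_(p in D) (g p * (s p)%:E))%E.
  move=> mg g0; have := @ge0_change_of_variables (g \_ D) ((measurable_restrictT _ mD).1 mg).
  move=> /(_ (fun p => erestrict_ge0 _ _)) H.
  transitivity (\int[m]_(x in E) (g \_ D) (phi x))%E.
    by apply: eq_integral => x; rewrite inE => Ex; rewrite patchE mem_set//; exact: phiD.
  by rewrite H//; apply: eq_integral => p Dp; rewrite patchE Dp.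
rewrite integralE [RHS]integralE; have mF : measurable_fun D (EFin \o f) by exact/measurable_EFinP.
have mulmax (a b : R) : 0 <= b -> (maxe a%:E 0 * b%:E = maxe (a * b)%:E 0)%E.
  by move=> b0; rewrite -!EFin_max -EFinM -{2}(mul0r b) maxr_pMl.
congr (_ - _)%E.
- transitivity (\int[m]_(x in E) (EFin \o f)^\+%E (phi x))%E.
    by apply: eq_integral => x _; rewrite !funeposE.
  rewrite (part _ (measurable_funepos mF) (fun p => funepos_ge0 _ p)).
  by apply: eq_integral => p; rewrite inE => Dp; rewrite !funeposE mulmax ?s0.
- transitivity (\int[m]_(x in E) (EFin \o f)^\-%E (phi x))%E.
    by apply: eq_integral => x _; rewrite !funenegE.
  rewrite (part _ (measurable_funeneg mF) (fun p => funeneg_ge0 _ p)).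
  by apply: eq_integral => p; rewrite inE => Dp; rewrite !funenegE -!EFinN mulmax ?s0// mulNr.
Qed.

Lemma integrable_change_of_variables (f : T' -> R) : measurable_fun D f ->
  lam.-integrable D (fun p => (f p * s p)%:E) -> m.-integrable E (fun x => (f (phi x))%:E).
Proof.
move=> mf /integrableP[_ fi]; apply/integrableP; split.
  by apply/measurable_EFinP; apply: (measurable_comp mD) => // _ [x Ex <-]; exact: phiD.
have mF : measurable_fun D (fun p => `|f p|) by exact: measurableT_comp.
rewrite (_ : (\int[m]_(x in E) _)%E = (\int[m]_(x in E) `|f (phi x)|%:E)%E)//.
rewrite (@change_of_variables (fun p => `|f p|) mF); move: fi; congr (_ < _)%E.
by apply: eq_integral => p; rewrite inE => Dp /=; rewrite normrM (ger0_norm (s0 Dp)).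
Qed.

End change_of_variables.

Section charts_measure.
Context {R : realType} {n : nat} {M : manifold R n}.
Variable m : {measure set (borel M) -> \bar R}.
Hypothesis hm : smooth_measure m.
Local Notation lambda := (lebesgue_rV R n).

Lemma measurable_cimage (c : chart R n M) (A : set M) : is_chart c ->
  measurable (A : set (borel M)) ->
  measurable (cmap c @` (cdom c `&` A) : set (borel 'rV[R]_n)).
Proof.
move=> hc mA; rewrite cimage_setI//; have [_ oU _ _ _] := hc.
have := @continuous_borel_fun _ _ (cimage c) (cinv c) oU (fun p => chart_inv_continuous hc).
by apply => //; exact: borel_open.
Qed.

Lemma measurable_cmap (c : chart R n M) : is_chart c ->
  measurable_fun (cdom c : set (borel M)) (cmap c : borel M -> borel 'rV[R]_n).
Proof.
move=> hc; have [oD _ _ _ _] := hc.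
by apply: (continuous_borel_fun oD) => x; exact: chart_continuous.
Qed.

Lemma chart_density (c : chart R n M) : atlas c -> exists sigma : 'rV[R]_n -> R,
  [/\ smooth_on (cimage c) sigma, forall p, cimage c p -> 0 < sigma p,
    forall (A : set M) (f : 'rV[R]_n -> R), open A ->
      measurable_fun (cmap c @` (cdom c `&` A) : set (borel 'rV[R]_n)) f ->
      (\int[m]_(x in (cdom c `&` A : set (borel M))) (f (cmap c x))%:E =
       \int[lambda]_(p in cmap c @` (cdom c `&` A)) (f p * sigma p)%:E)%E &
    forall (A : set M) (f : 'rV[R]_n -> R), open A ->
      measurable_fun (cmap c @` (cdom c `&` A) : set (borel 'rV[R]_n)) f ->
      lambda.-integrable (cmap c @` (cdom c `&` A)) (fun p => (f p * sigma p)%:E) ->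
      m.-integrable (cdom c `&` A : set (borel M)) (fun x => (f (cmap c x))%:E)].
Proof.
move=> hc; have hc' := atlas_chart hc; have [sigma [ss s0 sm]] := hm hc; exists sigma.
have [oD oU _ _ K] := hc'.
have aux (A : set M) : open A ->
  [/\ measurable (cdom c `&` A : set (borel M)),
    measurable_fun (cdom c `&` A : set (borel M)) (cmap c : borel M -> borel 'rV[R]_n),
    measurable (cmap c @` (cdom c `&` A) : set (borel 'rV[R]_n)),
    measurable_fun (cmap c @` (cdom c `&` A) : set (borel 'rV[R]_n)) sigma &
    forall p, (cmap c @` (cdom c `&` A)) p -> 0 <= sigma p] /\
  (forall B : set (borel 'rV[R]_n), measurable B ->
     m ((cdom c `&` A : set (borel M)) `&` cmap c @^-1` B) =
     (\int[lambda]_(p in B `&` cmap c @` (cdom c `&` A)) (sigma p)%:E)%E).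
  move=> oA; have oE : open (cdom c `&` A) by exact: openI.
  have sub : cmap c @` (cdom c `&` A) `<=` cimage c by move=> _ [x [Dx _] <-]; exists x.
  have mE : measurable (cdom c `&` A : set (borel M)) by exact: borel_open.
  have mc : measurable_fun (cdom c `&` A : set (borel M)) (cmap c : borel M -> borel 'rV[R]_n).
    by apply: measurable_funS (measurable_cmap hc') => //; exact: borel_open.
  split; first split => //.
  - by apply: borel_open; exact: open_cimage_setI.
  - apply: (continuous_borel_real (open_cimage_setI hc' oA)) => p /sub Up.
    exact: smooth_on_continuous ss Up.
  - by move=> p /sub/s0/ltW.
  move=> B mB; rewrite sm; last 2 first.
  - exact: mc.
  - by move=> x [[]].
  congr (integral _ _ _); apply/seteqP; split => [_ [x [[Dx Ax] Bx] <-]|p [Bp [x [Dx Ax] xp]]].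
    by split=> //; exists x.
  by exists x => //; split=> //=; rewrite xp.
split=> //.
- move=> A f oA mf; have [[mE mc mU ms s0'] den] := aux A oA.
  by apply: (change_of_variables mE mc mU ms s0' _ den mf) => x Ex; exists x.
- move=> A f oA mf; have [[mE mc mU ms s0'] den] := aux A oA.
  by apply: (integrable_change_of_variables mE mc mU ms s0' _ den mf) => x Ex; exists x.
Qed.

(** The density is strictly positive, so a set on which its integral vanishes is Lebesgue null. *)
Lemma negligible_cimage (c : chart R n M) (A : set M) : atlas c ->
  m.-negligible (A : set (borel M)) ->
  lambda.-negligible (cmap c @` (cdom c `&` A) : set (borel 'rV[R]_n)).
Proof.
move=> hc [B [mB mB0 AB]]; have hc' := atlas_chart hc; have [sigma [ss s0 sm]] := hm hc.
have [oD oU _ _ _] := hc'.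
pose D : set (borel 'rV[R]_n) := cmap c @` (cdom c `&` B).
have mD : measurable D by exact: measurable_cimage.
have mE : measurable (cdom c `&` B : set (borel M)) by apply: measurableI => //; exact: borel_open.
have sub : D `<=` cimage c by move=> _ [x [Dx _] <-]; exists x.
have ms : measurable_fun D sigma.
  have : measurable_fun (cimage c : set (borel 'rV[R]_n)) sigma.
    by apply: (continuous_borel_real oU) => p Up; exact: smooth_on_continuous ss Up.
  by apply: measurable_funS => //; exact: borel_open.
have E0 : m (cdom c `&` B : set (borel M)) = 0%E.
  by apply: (subset_measure0 mE mB _ mB0) => x [].
have I0 : (\int[lambda]_(p in D) `|(sigma p)%:E| = 0)%E.
  rewrite -E0 (sm _ mE); last by move=> x [].
  by apply: eq_integral => p; rewrite inE => /sub/s0 sp; rewrite gee0_abs// lee_fin ltW.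
have := (ae_eq_integral_abs lambda mD (proj2 (measurable_EFinP _ _) ms)).1 I0.
move=> [Z [mZ Z0 sZ]]; exists Z; split=> // _ [x [Dx Ax] <-]; apply: sZ => /=.
move=> H; have Dp : D (cmap c x) by exists x => //; split=> //; exact: AB.
by have := s0 _ (sub _ Dp); have [->] := H Dp; rewrite ltxx.
Qed.

End charts_measure.

(** * Smooth functions on the manifold and extension by zero *)

Section smooth_fun_theory.
Context {R : realType} {n : nat} {M : manifold R n}.
Implicit Types (c : chart R n M) (u v : M -> R) (Omega : set M).

Lemma smooth_fun_continuous u : smooth_fun u -> continuous u.
Proof.
move=> su x; set c := chart_at x; have hc : atlas c by exact: chart_at_atlas.
have [oD _ _ _ K] := atlas_chart hc; have Dx : cdom c x by exact: chart_at_dom.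
have cu : {for x, continuous ((u \o cinv c) \o cmap c)}.
  apply: continuous_comp; first exact: (chart_continuous (atlas_chart hc) Dx).
  apply: (smooth_on_continuous (su c hc)); by exists x.
by apply: (continuous_near_eq oD Dx _ cu) => z; rewrite inE => Dz /=; rewrite K.
Qed.

Lemma smooth_fun_sum k (f : 'I_k -> M -> R) :
  (forall i, smooth_fun (f i)) -> smooth_fun (fun x => \sum_i f i x).
Proof.
move=> sf c hc; have [_ oU _ _ _] := atlas_chart hc.
by apply: (smooth_on_sum oU) => i; exact: sf.
Qed.

Lemma differential_near_eq V u v x : open V -> V x -> {in V, u =1 v} ->
  differential u x = differential v x.
Proof.
move=> oV Vx uv; set c := chart_at x; have hc : atlas c by exact: chart_at_atlas.
have [_ oU _ _ K] := atlas_chart hc.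
have Up : cimage c (cmap c x) by exact: chart_at_cimage.
have oW : open (cimage c `&` cinv c @^-1` V).
  by apply: (open_preimage_for oU _ oV) => q; exact: chart_inv_continuous (atlas_chart hc).
apply/matrixP => i j; rewrite !mxE; apply: near_eq_derive; near=> q.
have [_ Vq] : (cimage c `&` cinv c @^-1` V) q.
  near: q; apply: open_nbhs_nbhs; split=> //; split=> //=; by rewrite chart_atK.
by apply: uv; rewrite inE.
Unshelve. all: by end_near. Qed.

Lemma differential_cst (k : R) x : differential (fun _ : M => k) x = 0 :> 'cV[R]_n.
Proof.
by apply/matrixP => i j; rewrite !mxE /partial (_ : _ \o _ = cst k)// derive_cst.
Qed.

Lemma tsupport_notin u x : ~ tsupport u x -> exists V, [/\ open V, V x & {in V, u =1 cst 0}].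
Proof.
move=> ux; exists (~` tsupport u); split=> //; first exact/closed_openC/closed_closure.
by move=> y; rewrite inE /= => uy; exact: tsupport_out uy.
Qed.

Lemma differential_out u x : ~ tsupport u x -> differential u x = 0 :> 'cV[R]_n.
Proof.
by move=> /tsupport_notin[V [oV Vx uV]]; rewrite (differential_near_eq oV Vx uV) differential_cst.
Qed.

Let at_chart u x : smooth_fun u -> forall i,
  is_derive (cmap (chart_at x) x) (delta_mx 0 i) (u \o cinv (chart_at x)) (differential u x i 0).
Proof.
move=> su i; rewrite mxE.
exact: (smooth_on_is_derive i (su _ (chart_at_atlas x)) (chart_at_cimage x)).
Qed.

Lemma differential_sum k (f : 'I_k -> M -> R) x : (forall i, smooth_fun (f i)) ->
  differential (fun x => \sum_i f i x) x = \sum_i (differential (f i) x : 'cV[R]_n).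
Proof.
move=> sf; apply/matrixP => i j; rewrite ord1 summxE [LHS]mxE /partial.
have D l := at_chart x (sf l) i.
rewrite (_ : _ \o _ = \sum_l (f l \o cinv (chart_at x))).
  exact: (@derive_val _ _ _ _ _ _ _ (is_derive_sum D)).
by apply/funext => p; rewrite fct_sumE.
Qed.

Lemma differential_sqr u x : smooth_fun u ->
  differential (fun x => u x ^+ 2) x = (2 * u x) *: (differential u x : 'cV[R]_n).
Proof.
move=> su; apply/matrixP => i j; rewrite ord1 [LHS]mxE [RHS]mxE /partial.
have D := is_deriveM (at_chart x su i) (at_chart x su i).
rewrite (_ : _ \o _ = (u \o cinv (chart_at x)) * (u \o cinv (chart_at x))).
  by rewrite (@derive_val _ _ _ _ _ _ _ D) /= chart_atK /GRing.scale/=; ring.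
by apply/funext => p; rewrite /= expr2.
Qed.

Definition chart_lift c (f : 'rV[R]_n -> R) x : R := if x \in cdom c then f (cmap c x) else 0.

Lemma chart_liftE c f x : cdom c x -> chart_lift c f x = f (cmap c x).
Proof. by move=> Dx; rewrite /chart_lift mem_set. Qed.

Section lift.
Variables (c : chart R n M) (Omega : set M) (f : 'rV[R]_n -> R).
Hypotheses (hc : atlas c) (tf : test_function (cmap c @` (cdom c `&` Omega)) f).
Let K := cinv c @` tsupport f.

Let sub : tsupport f `<=` cimage c `&` cinv c @^-1` Omega.
Proof. by have [_ _] := tf; rewrite cimage_setI//; exact: atlas_chart. Qed.

Let cK : compact K.
Proof.
have [_ ct _] := tf; apply: continuous_compact => //.
apply: continuous_in_subspaceT => p /set_mem/sub[Up _].
exact: chart_inv_continuous (atlas_chart hc) Up.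
Qed.

Let clK : closed K. Proof. by apply: compact_closed => //; exact: manifold_hausdorff. Qed.

Lemma chart_lift_out x : ~ K x -> chart_lift c f x = 0.
Proof.
move=> Kx; rewrite /chart_lift; case: ifP => //; rewrite inE => Dx.
apply: tsupport_out => tx; apply: Kx; exists (cmap c x) => //.
by have [_ _ _ _ k] := atlas_chart hc; rewrite k.
Qed.

Lemma tsupport_chart_lift : tsupport (chart_lift c f) `<=` K.
Proof. exact: (tsupport_sub clK chart_lift_out). Qed.

Lemma chart_lift_dom x : K x -> cdom c x /\ Omega x.
Proof.
by move=> [p /sub[Up Op] <-]; split=> //; exact: cinv_dom (atlas_chart hc) Up.
Qed.

(** The support is carried to a compact set, closed because the manifold is Hausdorff. On its open
    complement the extension is 0, and that complement together with the chart domain covers the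
    manifold. *)
Lemma C0infty_chart_lift : C0infty Omega (chart_lift c f).
Proof.
have [sf _ _] := tf; split.
- move=> c' hc'; have [_ oU' _ _ _] := atlas_chart hc'; have [oD oU _ _ _] := atlas_chart hc.
  apply: smooth_on_near => p Up; have [Dx|Dx] := pselect (cdom c (cinv c' p)).
    exists (cmap c' @` (cdom c' `&` cdom c)), (f \o transition c' c); split.
    - exact: transition_open hc' hc.
    - exact: (transition_mem hc' Up Dx).
    - apply: (smooth_on_comp_row (transition_open hc' hc) openT) => //.
      by move=> j; exact: (atlas_smooth hc' hc).
    - move=> q; rewrite inE cimage_setI; last exact: atlas_chart.
      by move=> [_ Dq] /=; rewrite chart_liftE.
  exists (cimage c' `&` cinv c' @^-1` (~` K)), (cst 0); split.
  - apply: (open_preimage_for oU') => [q|]; last exact: closed_openC.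
    exact: chart_inv_continuous (atlas_chart hc').
  - by split=> // /chart_lift_dom[].
  - apply: smooth_on_cst; apply: (open_preimage_for oU') => [q|]; last exact: closed_openC.
    exact: chart_inv_continuous (atlas_chart hc').
  - by move=> q; rewrite inE => -[_ Kq] /=; rewrite chart_lift_out.
- exact: (subclosed_compact (@closed_closure _ _) cK tsupport_chart_lift).
- by move=> x /tsupport_chart_lift/chart_lift_dom[].
Qed.

Lemma tsupport_lift_dom x : tsupport (chart_lift c f) x -> cdom c x.
Proof. by move=> /tsupport_chart_lift/chart_lift_dom[]. Qed.

Lemma covector_in_lift p i : cimage c p ->
  covector_in c (differential (chart_lift c f)) p i 0 = partial i f p.
Proof.
move=> Up; have [sl _ _] := C0infty_chart_lift; rewrite covector_in_differential//.
have [_ oU _ _ _] := atlas_chart hc.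
apply: near_eq_derive; near=> q.
have Uq : cimage c q by near: q; exact: open_nbhs_nbhs.
by rewrite /= chart_liftE ?cinvK//; [exact: atlas_chart|apply: cinv_dom => //; exact: atlas_chart].
Unshelve. all: by end_near. Qed.

End lift.

(** Outside the image of the chart [cinv] is meaningless, but every such point has a neighbourhood
    on which [f] vanishes. *)
Lemma test_function_mul_chart c Omega v f : atlas c -> smooth_fun v ->
  test_function (cmap c @` (cdom c `&` Omega)) f ->
  test_function (cmap c @` (cdom c `&` Omega)) (fun p => v (cinv c p) * f p).
Proof.
move=> hc sv [sf cf fU]; have [_ oU _ _ _] := atlas_chart hc.
have sub : tsupport (fun p => v (cinv c p) * f p) `<=` tsupport f.
  by apply: tsupport_sub; [exact: closed_closure|move=> p /tsupport_out ->; rewrite mulr0].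
split; [|exact: (subclosed_compact (@closed_closure _ _) cf sub)|exact: subset_trans sub fU].
apply: smooth_on_near => p _; have [Up|Up] := pselect (cimage c p).
  exists (cimage c), (fun p => v (cinv c p) * f p); split=> //.
  exact: (smooth_onM oU (sv c hc) (smooth_onS (fun _ _ => Logic.I) sf)).
have oC : open (~` tsupport f) by exact/closed_openC/closed_closure.
exists (~` tsupport f), (cst 0); split=> //.
- by move=> /fU[x [Dx _] xp]; apply: Up; exists x.
- exact: smooth_on_cst.
- by move=> q; rewrite inE => /= /tsupport_out ->; rewrite mulr0.
Qed.

End smooth_fun_theory.

(** * Localisation of the square of a test function *)

Section partition_of_square.
Context {R : realType} {n : nat} {M : manifold R n}.
Variables (Omega : set M) (u : M -> R).
Hypotheses (oO : open Omega) (uC : C0infty Omega u).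

(** By compactness finitely many chart bumps have a sum [S] that is positive on the support of [u].
    Dividing u^2 itself by [S] gives a smooth function, as the numerator vanishes off the support,
    and distributes u^2 over the bumps. *)
Lemma square_decomposition : exists (k : nat) (c : 'I_k -> chart R n M)
    (b : 'I_k -> 'rV[R]_n -> R) (v : M -> R),
  [/\ forall i, atlas (c i), forall i, test_function (cmap (c i) @` (cdom (c i) `&` Omega)) (b i),
      forall i p, 0 <= b i p, smooth_fun v /\ (forall x, 0 <= v x) &
      forall x, u x ^+ 2 = \sum_i chart_lift (c i) (fun p => v (cinv (c i) p) * b i p) x].
Proof.
have [su cK KO] := uC; set K := tsupport u in cK KO.
have bumps x : exists f : 'rV[R]_n -> R, Omega x ->
    [/\ test_function (cmap (chart_at x) @` (cdom (chart_at x) `&` Omega)) f,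
      forall q, 0 <= f q & 0 < f (cmap (chart_at x) x)].
  have [Ox|nOx] := pselect (Omega x); last by exists (cst 0) => /nOx.
  have oU := open_cimage_setI (atlas_chart (chart_at_atlas x)) oO.
  have Ux : (cmap (chart_at x) @` (cdom (chart_at x) `&` Omega)) (cmap (chart_at x) x).
    by exists x => //; split=> //; exact: chart_at_dom.
  by have [f fP] := test_function_pos oU Ux; exists f.
have [f fP] := choice bumps.
pose beta x := chart_lift (chart_at x) (f x).
have sbeta x : Omega x -> smooth_fun (beta x).
  by move=> /fP[tf _ _]; have [] := C0infty_chart_lift (chart_at_atlas x) tf.
have beta0 x y : Omega x -> 0 <= beta x y.
  by move=> /fP[_ f0 _]; rewrite /beta /chart_lift; case: ifP.
have [s sO sK] : exists2 s : seq M, (forall x, x \in s -> Omega x) &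
    forall y, K y -> exists2 x, x \in s & 0 < beta x y.
  move: (cK); rewrite compact_cover => /(_ M Omega (fun x => [set y | Omega x /\ 0 < beta x y])).
  case.
  - move=> x Ox; rewrite (_ : [set y | _] = [set y | 0 < beta x y]).
      apply: (@open_comp _ _ (beta x) [set t | 0 < t]) => [y _|]; last exact: open_gt.
      exact: smooth_fun_continuous (sbeta x Ox) y.
    by apply/seteqP; split => y /= => [[]//|].
  - move=> y /KO Oy; exists y => //; split=> //.
    rewrite /beta chart_liftE; last exact: chart_at_dom.
    by have [_ _] := fP y Oy.
  - move=> D DO KD; exists (finmap.enum_fset D).
      by move=> x /DO; rewrite inE.
    by move=> y /KD[x /= xD [_ b0]]; exists x.
pose c i := chart_at (tnth (in_tuple s) i).
pose b i := f (tnth (in_tuple s) i).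
have Oi i : Omega (tnth (in_tuple s) i) by apply: sO; exact: mem_tnth.
pose S y := \sum_(i < size s) beta (tnth (in_tuple s) i) y.
have sS : smooth_fun S by apply: smooth_fun_sum => i; exact: sbeta.
have S0 y : 0 <= S y by apply: sumr_ge0 => i _; exact: beta0.
have SK y : K y -> 0 < S y.
  move=> /sK[x /(tnthP (in_tuple s))[i ->] b0]; rewrite /S (bigD1 i)//= ltr_pwDl//.
  by apply: sumr_ge0 => j _; exact: beta0.
(* off the support of [u] this is possibly 0 / 0, which is 0 *)
pose v y := u y ^+ 2 / S y.
have v0 x : 0 <= v x by rewrite divr_ge0 ?sqr_ge0.
exists (size s), c, b, v; split.
- by move=> i; exact: chart_at_atlas.
- by move=> i; have [] := fP _ (Oi i).
- by move=> i p; have [_ + _] := fP _ (Oi i); exact.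
- split; last exact: v0.
  move=> c' hc'; have [_ oU' _ _ _] := atlas_chart hc'.
  have oV (V : set M) : open V -> open (cimage c' `&` cinv c' @^-1` V).
    by move=> oV; apply: (open_preimage_for oU' _ oV) => q; exact: chart_inv_continuous (atlas_chart hc').
  apply: smooth_on_near => p Up; have [Kp|Kp] := pselect (K (cinv c' p)).
    have oS : open [set y | 0 < S y].
      by apply: (@open_comp _ _ S [set t | 0 < t]) => [y _|]; [exact: smooth_fun_continuous sS y|exact: open_gt].
    exists (cimage c' `&` cinv c' @^-1` [set y | 0 < S y]), (v \o cinv c'); split=> //.
    + exact: oV.
    + by split=> //; exact: SK.
    + have sub : cimage c' `&` cinv c' @^-1` [set y | 0 < S y] `<=` cimage c' by move=> q [].
      have su' := smooth_onS sub (su c' hc').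
      apply: (smooth_onM (oV _ oS) (smooth_onM (oV _ oS) su' su')).
      apply: (smooth_on_inv (oV _ oS) (smooth_onS sub (sS c' hc'))).
      by move=> q [].
  exists (cimage c' `&` cinv c' @^-1` (~` K)), (cst 0); split=> //.
  + by apply: oV; exact/closed_openC/closed_closure.
  + by apply: smooth_on_cst; apply: oV; exact/closed_openC/closed_closure.
  + by move=> q; rewrite inE => -[_ Kq] /=; rewrite /v (tsupport_out Kq) expr0n/= mul0r.
move=> x; transitivity (\sum_(i < size s) v x * beta (tnth (in_tuple s) i) x).
  rewrite -mulr_sumr -/(S x) /v; have [Kx|/tsupport_out->] := pselect (K x).
    by rewrite mulfVK// gt_eqF// SK.
  by rewrite expr0n/= !mul0r.
apply: eq_bigr => i _; rewrite /beta /chart_lift -/(c i) -/(b i); case: ifP; last by rewrite mulr0.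
by rewrite inE => Dx; have [_ _ _ _ k] := atlas_chart (chart_at_atlas (tnth (in_tuple s) i)); rewrite k.
Qed.

End partition_of_square.

(** * The energy inequality for a test function in one chart *)

Section chart_energy.
Context {R : realType} {n : nat} {M : manifold R n}.
Variables (F : forall x : M, tangent x -> R) (m : {measure set (borel M) -> \bar R}).
Variables (Omega : set M) (rho : M -> R) (Drho : forall x : M, cotangent x).
Hypotheses (hF : finsler_structure F) (hm : smooth_measure m) (oO : open Omega)
  (hW : W12loc Omega rho Drho) (rho0 : forall x, Omega x -> 0 <= rho x)
  (hL : laplacian_ge0 F m Omega Drho).
Variables (g g' : R -> R) (C : R).
Hypotheses (sg : forall f : 'rV[R]_n -> R, smooth_on setT f -> (forall p, 0 <= f p) -> smooth_on setT (g \o f))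
  (dg : forall t : R, 0 <= t -> is_derive t 1 g (g' t))
  (cg' : forall t : R, 0 <= t -> {for t, continuous g'})
  (gC : forall t : R, 0 <= t -> 0 <= g t <= C) (g'C : forall t : R, 0 <= t -> `|g' t| <= C).
Local Notation lambda := (lebesgue_rV R n).

(** Formally the differential of W g(rho) paired with the gradient of rho, expanded by the product
    rule. It is linear in [W] and its differential. *)
Definition energy (W : M -> R) x : R := g (rho x) * pairing (differential W x) (gradient F Drho x) +
  W x * (g' (rho x) * polar F (Drho x) ^+ 2).

Lemma chart_energy_le0 (c : chart R n M) (w : 'rV[R]_n -> R) : atlas c ->
  test_function (cmap c @` (cdom c `&` Omega)) w -> (forall p, 0 <= w p) ->
  m.-integrable (Omega : set (borel M)) (EFin \o energy (chart_lift c w)) /\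
  (\int[m]_(x in (Omega : set (borel M))) (energy (chart_lift c w) x)%:E <= 0)%E.
Proof.
move=> hc tw w0; set U := cmap c @` (cdom c `&` Omega) in tw.
have hc' := atlas_chart hc; have oU : open U by exact: open_cimage_setI.
have sub : U `<=` cimage c by move=> _ [x [Dx _] <-]; exists x.
have [sigma [ss s0 int_c int_i]] := chart_density hm hc.
pose L := legendre_field (F_in F c); pose a := covector_in c Drho.
have mN p : U p -> minkowski_norm (F_in F c p) by move=> /sub; exact: F_in_minkowski.
have cN (z : 'rV[R]_(n + n)) : U (lsubmx z) -> {for z, continuous (fun z => F_in F c (lsubmx z) (rsubmx z))}.
  by move=> /sub; exact: F_in_continuous.
have [mr r2 aP] := hW hc; rewrite -/U -/a in mr r2 aP.
have ma j : measurable_fun (U : set (borel 'rV[R]_n)) (fun p => a p j 0) by have [] := aP j.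
have a2 j : L1loc lambda U (fun p => a p j 0 ^+ 2) by have [] := aP j.
have ssU := smooth_onS sub ss.
(* The density of the measure is absorbed into the field, so that the weak inequality becomes one
   for Lebesgue measure. *)
pose V i p := sigma p * L p (a p) 0 i.
have VP i := legendre_field_sqr_L1loc mN cN oU i ma a2 ssU.
have mL i : measurable_fun (U : set (borel 'rV[R]_n)) (fun p => L p (a p) 0 i).
  exact: (measurable_legendre_field mN cN oU i ma).
have transfer (k : M -> R) (f : 'rV[R]_n -> R) : (forall x, Omega x -> ~ cdom c x -> k x = 0) ->
    (forall p, U p -> k (cinv c p) = f p) -> measurable_fun (U : set (borel 'rV[R]_n)) f ->
    (\int[m]_(x in (Omega : set (borel M))) (k x)%:E = \int[lambda]_(p in U) (f p * sigma p)%:E)%E /\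
    (lambda.-integrable U (fun p => (f p * sigma p)%:E) -> m.-integrable (Omega : set (borel M)) (EFin \o k)).
  move=> k0 kf mf.
  have E : (EFin \o k) \_ Omega = (fun x => (f (cmap c x))%:E) \_ (cdom c `&` Omega).
    apply/funext => x; rewrite !patchE in_setI; case: (boolP (x \in Omega)) => [|_]; last by rewrite andbF.
    rewrite inE => Ox; rewrite andbT; case: (boolP (x \in cdom c)) => [|]; rewrite ?inE => Dx /=.
      have Up : U (cmap c x) by exists x.
      by rewrite -kf//; have [_ _ _ _ K] := hc'; rewrite K.
    by rewrite k0//; move=> D; move: Dx; rewrite notin_setE.
  split; first by rewrite integral_mkcond E -integral_mkcond int_c.
  have mO : measurable (Omega : set (borel M)) by exact: borel_open.
  have mE : measurable (cdom c `&` Omega : set (borel M)).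
    by apply: borel_open; apply: openI => //; have [] := hc'.
  by move=> fi; apply/(integrable_mkcond _ mO); rewrite E; apply/(integrable_mkcond _ mE); exact: int_i.
have pair beta p : U p -> pairing (beta (cinv c p)) (gradient F Drho (cinv c p)) =
    \sum_i covector_in c beta p i 0 * L p (a p) 0 i.
  by move=> /sub Up; exact: pairing_chart.
have HV phi : test_function U phi -> (forall p, 0 <= phi p) ->
     (\int[lambda]_(p in U) (\sum_i partial i phi p * V i p)%:E <= 0)%E.
  move=> tphi phi0.
  have Cphi := C0infty_chart_lift hc tphi.
  have lift0 x : 0 <= chart_lift c phi x by rewrite /chart_lift; case: ifP.
  have := hL Cphi lift0.
  have [|||-> _] := transfer (fun x => pairing (differential (chart_lift c phi) x) (gradient F Drho x))
    (fun p => \sum_i partial i phi p * L p (a p) 0 i).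
  - move=> x Ox Dx; rewrite differential_out /pairing ?mulmx0 ?mxE//.
    by move=> /(tsupport_lift_dom hc tphi).
  - move=> p Up; rewrite pair//; apply: eq_bigr => i _; rewrite (covector_in_lift hc tphi)//.
    exact: sub.
  - apply: measurable_sum => i; apply: measurable_funM => //; apply: measurable_funTS.
    by apply: continuous_measurable_rV; exact: (test_function_continuous (test_function_partial i tphi)).
  apply: le_trans; rewrite le_eqVlt; apply/orP; left; apply/eqP; apply: eq_integral => p _.
  by rewrite mulr_suml; congr (_%:E); apply: eq_bigr => i _; rewrite /V; ring.
have f0 p : U p -> 0 <= (rho \o cinv c) p.
  by rewrite /U cimage_setI// => -[_ Op]; exact: rho0.
have [hi hle] := weak_integrand_le0 oU (hW hc) f0 (fun i => (VP i).1) (fun i => (VP i).2) HV tw w0 sg dg cg' gC g'C.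
pose f p : R := \sum_i (g (rho (cinv c p)) * partial i w p + w p * g' (rho (cinv c p)) * a p i 0) * L p (a p) 0 i.
(* Measurability is recovered from the integrable integrand by dividing by the positive density. *)
have mf : measurable_fun (U : set (borel 'rV[R]_n)) f.
  have mH := proj1 (measurable_EFinP _ _) (measurable_int _ hi).
  pose H (p : borel 'rV[R]_n) : R := \sum_i
    (g (rho (cinv c p)) * partial i w p + w p * g' (rho (cinv c p)) * a p i 0) * V i p.
  pose f' (p : borel 'rV[R]_n) : R := f p.
  rewrite -/f'; apply: (eq_measurable_fun (fun p : borel 'rV[R]_n => H p * (sigma p)^-1)).
    move=> p; rewrite inE => /sub/s0 sp; rewrite /H /f' /f mulr_suml; apply: eq_bigr => i _.
    by rewrite /V; field; exact: lt0r_neq0.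
  apply: measurable_funM => //; apply: (continuous_borel_real oU) => p Up.
  exact: (smooth_on_continuous (smooth_on_inv oU ssU (fun q Uq => s0 q (sub q Uq))) Up).
have [||-> I] := transfer (energy (chart_lift c w)) f _ _ mf.
- move=> x Ox Dx; rewrite /energy differential_out /pairing; last by move=> /(tsupport_lift_dom hc tw).
  by rewrite mulmx0 mxE mulr0 add0r /chart_lift memNset// mul0r.
- move=> p Up; have Upc := sub p Up.
  have hA := cinv_dom hc' Upc.
  rewrite /energy pair// chart_liftE// cinvK// -(pairing_legendre hF) -/(gradient F Drho (cinv c p)) pair//.
  rewrite !mulr_sumr -big_split/= /f; apply: eq_bigr => i _.
  by rewrite (covector_in_lift hc tw)//; ring.
have E p : f p * sigma p = \sum_i (g (rho (cinv c p)) * partial i w p + w p * g' (rho (cinv c p)) * a p i 0) * V i p.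
  by rewrite mulr_suml; apply: eq_bigr => i _; rewrite /V; ring.
split; last by under eq_integral do rewrite E; exact: hle.
apply: I; rewrite (_ : (fun p => _) = EFin \o (fun p => \sum_i
    (g (rho (cinv c p)) * partial i w p + w p * g' (rho (cinv c p)) * a p i 0) * V i p)).
  exact: hi.
by apply/funext => p /=; rewrite E.
Qed.

End chart_energy.

(** * The energy estimate *)

Section energy_of_square.
Context {R : realType} {n : nat} {M : manifold R n}.
Variables (F : forall x : M, tangent x -> R) (m : {measure set (borel M) -> \bar R}).
Variables (Omega : set M) (rho : M -> R) (Drho : forall x : M, cotangent x).
Hypotheses (hF : finsler_structure F) (hm : smooth_measure m) (oO : open Omega)
  (hW : W12loc Omega rho Drho) (rho0 : forall x, Omega x -> 0 <= rho x)
  (hL : laplacian_ge0 F m Omega Drho).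

(** The energy is linear in its test function, and u^2 is a finite sum of nonnegative test functions
    supported in charts. *)
Lemma energy_sqr_le0 (g g' : R -> R) (C : R) (u : M -> R) :
  (forall f : 'rV[R]_n -> R, smooth_on setT f -> (forall p, 0 <= f p) -> smooth_on setT (g \o f)) ->
  (forall t : R, 0 <= t -> is_derive t 1 g (g' t)) ->
  (forall t : R, 0 <= t -> {for t, continuous g'}) ->
  (forall t : R, 0 <= t -> 0 <= g t <= C) -> (forall t : R, 0 <= t -> `|g' t| <= C) ->
  C0infty Omega u ->
  m.-integrable (Omega : set (borel M)) (EFin \o energy F rho Drho g g' (fun x => u x ^+ 2)) /\
  \int[m]_(x in (Omega : set (borel M))) energy F rho Drho g g' (fun x => u x ^+ 2) x <= 0.
Proof.
move=> sg dg cg' gC g'C uC; have mO : measurable (Omega : set (borel M)) by exact: borel_open.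
have [k [c [b [v [hc tb b0 [sv v0] uE]]]]] := square_decomposition oO uC.
pose w i p := v (cinv (c i) p) * b i p.
have tw i : test_function (cmap (c i) @` (cdom (c i) `&` Omega)) (w i).
  exact: test_function_mul_chart.
have w0 i p : 0 <= w i p by rewrite mulr_ge0.
have H i := chart_energy_le0 hF hm oO hW rho0 hL sg dg cg' gC g'C (hc i) (tw i) (w0 i).
have sl i : smooth_fun (chart_lift (c i) (w i)).
  by have [] := C0infty_chart_lift (hc i) (tw i).
have E : energy F rho Drho g g' (fun x => u x ^+ 2) =
    fun x => \sum_i energy F rho Drho g g' (chart_lift (c i) (w i)) x.
  apply/funext => x; rewrite /energy (_ : (fun x => u x ^+ 2) = fun x => \sum_i chart_lift (c i) (w i) x).
    rewrite differential_sum// big_split/= -mulr_suml uE; congr (_ + _).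
    by rewrite -mulr_sumr; congr (_ * _); rewrite /pairing mulmx_sumr summxE.
  by apply/funext => y; rewrite uE.
rewrite E; have I i := (H i).1; split; first exact: integrable_EFin_sum.
by rewrite Rintegral_sumr//; apply: sumr_le0 => i _; rewrite /Rintegral fine_le0//; have [] := H i.
Qed.

(** A smooth density is bounded on a compact ball of a chart, so every point has a neighbourhood of
    finite measure, and finitely many of these cover [K]. *)
Lemma compact_finite_measure (K : set M) : compact K -> (m (K : set (borel M)) < +oo)%E.
Proof.
move=> cK.
have V x : exists V : set M, [/\ open V, V x & (m (V : set (borel M)) < +oo)%E].
  set c := chart_at x; have hc : atlas c by exact: chart_at_atlas.
  have hc' := atlas_chart hc; have [sigma [ss s0 sm]] := hm hc; have [oD oU _ _ _] := hc'.
  have /nbhs_ballP[r /= r0 rU] : nbhs (cmap c x) (cimage c).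
    by apply: open_nbhs_nbhs; split=> //; exact: chart_at_cimage.
  pose B := [set p : 'rV[R]_n | `|p - cmap c x| <= r / 2].
  have BU : B `<=` cimage c.
    by move=> p pB; apply: rU; rewrite -ball_normE /= distrC (le_lt_trans pB)// ltr_pdivrMr// ltr_pMr// ltr1n.
  have cB : compact B.
    apply: bounded_closed_compact.
      exists (r / 2 + `|cmap c x|); split; first exact: num_real.
      move=> N rN p pB /=; rewrite -[p](subrK (cmap c x)) (le_trans (ler_normD _ _))//.
      by rewrite (le_trans _ (ltW rN))// lerD2r.
    have -> : B = (fun p => `|p - cmap c x|) @^-1` [set t | t <= r / 2] by [].
    apply: closed_comp; last exact: closed_le.
    by move=> p _; apply: (cvg_norm (cvgB (@cvg_id _ (nbhs p)) (cvg_cst _))).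
  pose A := cdom c `&` cmap c @^-1` ball (cmap c x) (r / 2).
  have oA : open A.
    apply: (open_preimage_for oD) => [y|]; [exact: chart_continuous|exact: ball_open].
  exists A; split=> //.
    split; first exact: chart_at_dom.
    by apply: ballxx; rewrite divr_gt0.
  have mA : measurable (A : set (borel M)) by exact: borel_open.
  have mB : measurable (B : set (borel 'rV[R]_n)) by apply: borel_compact => //; exact: norm_hausdorff.
  rewrite sm//; last by move=> y [].
  have AB : cmap c @` A `<=` B.
    by move=> _ [y [_ /= yA] <-]; move: yA; rewrite -ball_normE /= distrC => /ltW.
  have [C CP] : exists C : R, forall p, B p -> `|sigma p| <= C.
    apply: compact_continuous_bounded => //; apply: continuous_in_subspaceT => p /set_mem/BU.
    exact: smooth_on_continuous.
  have C0 : 0 <= C.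
    by apply: le_trans (CP (cmap c x) _) => //; rewrite /B /= subrr normr0 divr_ge0 ?ltW.
  have oW : open (cmap c @` A).
    by rewrite /A -[cdom c]setIid -setIA; apply: open_cimage_setI.
  have mW : measurable (cmap c @` A : set (borel 'rV[R]_n)) by exact: borel_open.
  apply: (@le_lt_trans _ _ (\int[lebesgue_rV R n]_(p in (cmap c @` A : set (borel 'rV[R]_n))) (cst C%:E p))%E).
    apply: ge0_le_integral => //.
    - by move=> p /AB/BU/s0 sp; rewrite lee_fin ltW.
    - apply/measurable_EFinP; apply: (continuous_borel_real oW) => p /AB/BU.
      exact: smooth_on_continuous.
    - by move=> p /AB pB; rewrite lee_fin (le_trans (ler_norm _))// CP.
  rewrite integral_cst//; apply: lte_mul_pinfty => //.
  apply: le_lt_trans (lebesgue_rV_compact_lt_pinfty cB).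
  by apply: le_measure => //; rewrite inE.
have [f fP] := choice V.
have [s KS] : exists s : seq M, forall y, K y -> exists2 x, x \in s & f x y.
  move: (cK); rewrite compact_cover => /(_ M setT f) [x _|y Ky|D _ KD].
  - by have [] := fP x.
  - by exists y => //; have [] := fP y.
  - by exists (finmap.enum_fset D) => y /KD[x /= xD fy]; exists x.
have fin (r : seq M) : (m (\bigcup_(x in [set x | x \in r]) f x : set (borel M)) < +oo)%E.
  elim: r => [|x r IH].
    by rewrite (_ : \bigcup_(x in _) _ = set0) ?measure0//; apply/seteqP; split=> // y [z].
  have -> : \bigcup_(z in [set z | z \in x :: r]) f z = f x `|` \bigcup_(z in [set z | z \in r]) f z.
    apply/seteqP; split=> [y [z /=]|y [fy|[z /= zr fz]]].
    - by rewrite inE => /orP[/eqP ->|zr] fz; [left|right; exists z].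
    - by exists x => //=; rewrite mem_head.
    - by exists z => //=; rewrite inE zr orbT.
  have mf : measurable (f x : set (borel M)) by apply: borel_open; have [] := fP x.
  have mg : measurable (\bigcup_(z in [set z | z \in r]) f z : set (borel M)).
    by apply: borel_open; apply: bigcup_open => z _; have [] := fP z.
  apply: le_lt_trans (measureU2 m mf mg) _; rewrite lte_add_pinfty//.
  by have [] := fP x.
apply: le_lt_trans (fin s); apply: le_measure; rewrite ?inE.
- by apply: borel_compact => //; exact: manifold_hausdorff.
- by apply: borel_open; apply: bigcup_open => z _; have [] := fP z.
- by move=> y /KS[x xs fy]; exists x.
Qed.

End energy_of_square.

(** * The truncated power *)

Section truncated_power.
Context {R : realType}.
Variables (q d : R).
Hypotheses (q1 : -1 < q) (d0 : 0 < d) (d1 : d <= 1).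
Let r : R := 1 + q.
Let r0 : 0 < r. Proof. by rewrite /r -ltrBlDl sub0r. Qed.

(* For d -> 0 this tends to t^(1+q)/(1+q). It is chosen as a function of
   (t + d)^(1+q) so that [trunc ^ 2 / trunc'] is exactly (t + d)^(2+q)/(1+q)^2. *)
Definition trunc (t : R) : R :=
  r^-1 * ((t + d) `^ r * (1 + d * (t + d) `^ r) `^ (-1)).

Definition trunc' (t : R) : R := (t + d) `^ q * (1 + d * (t + d) `^ r) `^ (-2).

Let s0 t : 0 <= t -> 0 < t + d. Proof. by move=> t0; rewrite ltr_wpDl. Qed.

Let D1 t : 1 <= 1 + d * (t + d) `^ r.
Proof. by rewrite lerDl mulr_ge0 ?powR_ge0// ltW. Qed.

Let D0 t : 0 < 1 + d * (t + d) `^ r. Proof. exact: lt_le_trans (D1 t). Qed.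

Let is_derive_shift_powR (a t : R) : 0 <= t ->
  is_derive t 1 (fun t => (t + d) `^ a) (a * (t + d) `^ (a - 1)).
Proof.
move=> t0; rewrite -[a * _]mulr1.
apply: (@is_derive_comp_dir _ _ (fun s => s `^ a) (fun t => t + d)).
  exact: is_derive_powR (s0 t0).
by apply: (is_derive_eq (is_deriveD _ _)); rewrite addr0.
Qed.

Let is_derive_den (a t : R) : 0 <= t ->
  is_derive t 1 (fun t => (1 + d * (t + d) `^ r) `^ a)
   (a * (1 + d * (t + d) `^ r) `^ (a - 1) * (d * (r * (t + d) `^ (r - 1)))).
Proof.
move=> t0; apply: (@is_derive_comp_dir _ _ (fun s => s `^ a) (fun t => 1 + d * (t + d) `^ r)).
  exact: is_derive_powR (D0 t).
have D := is_derive_shift_powR r t0.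
by apply: (is_derive_eq (is_deriveD _ (is_deriveM _ D))); rewrite /GRing.scale/= !mulr0 addr0 add0r.
Qed.

(** With S = (t + d)^r, [trunc] is S / (1 + d S) divided by r; in the quotient rule the numerator (1
    + d S) - d S is 1. *)
Lemma is_derive_trunc (t : R) : 0 <= t -> is_derive t 1 trunc (trunc' t).
Proof.
move=> t0; have Da := is_derive_shift_powR r t0; have Db := is_derive_den (-1) t0.
apply: (is_derive_eq (is_deriveM _ (is_deriveM Da Db))).
rewrite /GRing.scale/= /trunc'.
have -> : r - 1 = q by rewrite /r addrC addKr.
have -> : -1 - 1 = -2 :> R by ring.
set s := t + d; set D := 1 + d * s `^ r.
have E1 : D `^ (-1) = D * D `^ (-2).
  rewrite -{2}[D]powRr1 ?(ltW (D0 t))// -powRD; first by congr (_ `^ _); ring.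
  by rewrite (gt_eqF (D0 t)) implybT.
rewrite E1 mulr0 addr0; have : r^-1 * r = 1 by rewrite mulVf// gt_eqF.
move=> rr; rewrite (_ : _ * _ = (r^-1 * r) * (s `^ q * D `^ (-2) * (D - d * s `^ r))).
  by rewrite rr mul1r /D addrK mulr1.
by ring.
Qed.

Lemma trunc'_continuous (t : R) : 0 <= t -> {for t, continuous trunc'}.
Proof.
move=> t0; have Da := is_derive_shift_powR q t0; have Db := is_derive_den (-2) t0.
have [D _] := is_deriveM Da Db.
by apply: differentiable_continuous; apply/derivable1_diffP.
Qed.

Lemma smooth_on_trunc n (f : 'rV[R]_n -> R) : smooth_on setT f -> (forall p, 0 <= f p) ->
  smooth_on setT (trunc \o f).
Proof.
move=> sf f0; have sd : smooth_on setT (fun p => f p + d).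
  by apply: (smooth_onD openT sf); exact: smooth_on_cst openT.
have sr : smooth_on setT (fun p => (f p + d) `^ r).
  by apply: (smooth_on_powR r openT sd) => p _; exact: s0.
have sD : smooth_on setT (fun p => 1 + d * (f p + d) `^ r).
  apply: (smooth_onD openT (smooth_on_cst _ openT)).
  exact: (smooth_onM openT (smooth_on_cst _ openT) sr).
apply: (smooth_onM openT (smooth_on_cst _ openT)).
apply: (smooth_onM openT sr).
by apply: (smooth_on_powR (-1) openT sD) => p _; exact: D0.
Qed.

Lemma trunc'_gt0 (t : R) : 0 <= t -> 0 < trunc' t.
Proof. by move=> t0; rewrite mulr_gt0// powR_gt0// s0. Qed.

Lemma trunc_ge0 (t : R) : 0 <= trunc t.
Proof. by rewrite mulr_ge0 ?invr_ge0 ?(ltW r0)// mulr_ge0// powR_ge0. Qed.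

Lemma trunc_le (t : R) : trunc t <= r^-1 * d^-1.
Proof.
rewrite ler_pM2l ?invr_gt0// powR_inv1 ?(ltW (D0 t))// ler_pdivrMr// mulrDr mulr1 mulKf ?gt_eqF//.
by rewrite lerDr invr_ge0 ltW.
Qed.

(** Let s = t + d. For s <= 1 the denominator is dropped, and d <= s <= 1 bounds s^q by d^q if q < 0
    and by 1 <= 1/d otherwise. For s > 1 one factor 1 + d s^r absorbs s^q <= s^r. The bound may
    depend on [d]. *)
Lemma trunc'_le (t : R) : 0 <= t -> trunc' t <= d `^ q + d^-1.
Proof.
move=> t0; have s0' := s0 t0; set s := t + d; set D := 1 + d * s `^ r.
have D2 a : a <= 0 -> D `^ a <= 1 by move=> a0; rewrite -(powRr0 D); apply: (ler_powR (D1 t)).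
have dV0 : 0 <= d^-1 by rewrite invr_ge0 ltW.
have dV1 : 1 <= d^-1 by rewrite invf_ge1.
have [s1|s1] := leP s 1.
  apply: (@le_trans _ _ (s `^ q)).
    by rewrite -[leRHS]mulr1 ler_wpM2l ?powR_ge0// D2// oppr_le0.
  have [q0|q0] := leP 0 q.
    apply: (@le_trans _ _ 1); last by rewrite (le_trans dV1)// lerDr powR_ge0.
    by rewrite -(powRr0 s); apply: (@ger_powR _ s) => //; rewrite s0'.
  apply: (@le_trans _ _ (d `^ q)); last by rewrite lerDl.
  rewrite -[q]opprK !(powRN _ (- q)) lef_pV2 ?posrE ?powR_gt0//.
  by apply: ge0_ler_powR; rewrite ?nnegrE ?oppr_ge0 ?(ltW q0) ?(ltW d0) ?(ltW s0')// /s lerDr.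
apply: (@le_trans _ _ (s `^ r * D `^ (-1))).
  apply: ler_pM; rewrite ?powR_ge0//; last by apply: (ler_powR (D1 t)); lra.
  by apply: (ler_powR (ltW s1)); rewrite /r; lra.
apply: (@le_trans _ _ d^-1); last by rewrite lerDr powR_ge0.
rewrite powR_inv1 ?(ltW (D0 t))// ler_pdivrMr ?(D0 t)// /D mulrDr mulr1 mulKf ?gt_eqF//.
by rewrite lerDr.
Qed.

(** The map f(S) = S / (1 + d S) satisfies f(S)^2 = S^2 f'(S), so the ratio of [trunc] squared to
    [trunc'] is the same as for the pure power (t + d)^r / r. *)
Lemma trunc_sqr (t : R) : 0 <= t -> trunc t ^+ 2 = trunc' t * ((t + d) `^ (2 + q) / r ^+ 2).
Proof.
move=> t0; rewrite /trunc /trunc'; set s := t + d; set D := 1 + d * s `^ r.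
have s0' : 0 < s by exact: s0.
have D0' : 0 < D by exact: D0.
have E1 : D `^ (-2) = (D `^ (-1)) ^+ 2.
  by rewrite expr2 -powRD ?(gt_eqF D0') ?implybT//; congr (_ `^ _); ring.
have E2 : s `^ q * s `^ (2 + q) = (s `^ r) ^+ 2.
  by rewrite expr2 -!powRD ?(gt_eqF s0') ?implybT//; congr (_ `^ _); rewrite /r; ring.
rewrite !exprMn -E2 E1 exprVn; ring.
Qed.

Lemma measurable_trunc' : measurable_fun setT trunc'.
Proof.
have mp (a : R) : measurable_fun setT (fun t : R => (t + d) `^ a).
  by apply: (measurableT_comp (measurable_powR a)); exact: measurable_funD.
apply: measurable_funM; first exact: mp.
apply: (measurableT_comp (measurable_powR _)); apply: measurable_funD => //.
by apply: measurable_funM => //; exact: mp.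
Qed.

End truncated_power.

Section truncation_limit.
Context {R : realType}.
Variable q : R.
Hypothesis q1 : -1 < q.
Local Notation d k := (@harmonic R k).

Let d01 k : 0 < d k <= 1.
Proof. by rewrite /harmonic/= invr_gt0 ltr0n/= invf_le1 ?ltr0n// ler1n. Qed.

(** At t = 0 with a < 0 the shifted powers blow up while the power of 0 is 0 by convention; the
    disjunction keeps away from this case. *)
Lemma cvg_shift_powR (t a : R) : 0 <= t -> 0 < t \/ a = 0 \/ 1 <= a ->
  (fun k => (t + d k) `^ a) @ \oo --> t `^ a.
Proof.
move=> t0 H; have cd : (fun k => t + d k) @ \oo --> t.
  by rewrite -{2}[t]addr0; apply: cvgD; [exact: cvg_cst|exact: cvg_harmonic].
move: t0; rewrite le_eqVlt => /orP[/eqP t0|t0].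
  case: H => [|[->|a1]]; first by rewrite -t0 ltxx.
    by rewrite powRr0; under eq_fun do rewrite powRr0; exact: cvg_cst.
  rewrite -t0 powR0; last by rewrite gt_eqF// (lt_le_trans ltr01).
  apply: (@squeeze_cvgr _ _ _ _ (cst 0) (@harmonic R)); last 2 first.
  - exact: cvg_cst.
  - exact: cvg_harmonic.
  by apply: nearW => k; rewrite add0r powR_ge0/=; exact: (ge1r_powR (d01 k)).
have [D _] := is_derive_powR a t0.
have c : {for t, continuous (fun s : R => s `^ a)}.
  by apply: differentiable_continuous; apply/derivable1_diffP.
exact: (cvg_comp _ _ cd c).
Qed.

Lemma cvg_trunc' (t : R) : 0 <= t -> 0 < t \/ q = 0 ->
  (fun k => trunc' q (d k) t) @ \oo --> t `^ q.
Proof.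
move=> t0 H; rewrite (_ : t `^ q = t `^ q * 1 `^ (-2)); last by rewrite powR1 mulr1.
apply: cvgM; first by apply: cvg_shift_powR => //; case: H; [left|right; left].
have c : {for 1, continuous (fun s : R => s `^ (-2))}.
  have [D _] := is_derive_powR (-2) (@ltr01 R).
  by apply: differentiable_continuous; apply/derivable1_diffP.
suff z : (fun k => d k * (t + d k) `^ (1 + q)) @ \oo --> (0 : R).
  have cD : (fun k => 1 + d k * (t + d k) `^ (1 + q)) @ \oo --> (1 : R).
    by rewrite -[X in _ --> X]addr0; apply: cvgD; [exact: cvg_cst|exact: z].
  exact: (cvg_comp _ _ cD c).
apply: (@squeeze_cvgr _ _ _ _ (cst 0) (fun k => d k * (t + 1) `^ (1 + q))); last 2 first.
- exact: cvg_cst.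
- by rewrite -[X in _ --> X](mul0r ((t + 1) `^ (1 + q))); apply: cvgM; [exact: cvg_harmonic|exact: cvg_cst].
apply: nearW => k; have /andP[dk0 dk1] := d01 k.
rewrite mulr_ge0 ?powR_ge0 ?(ltW dk0)//= ler_wpM2l ?(ltW dk0)//.
have r0 : 0 <= 1 + q by rewrite -lerBlDl sub0r ltW.
by apply: (ge0_ler_powR r0); rewrite ?nnegrE ?addr_ge0 ?(ltW dk0)// lerD2l.
Qed.

(** Supplies a dominating function independent of the shift: for t <= 1 the base is at most 2, for t
    > 1 at most 2 t. *)
Lemma shift_powR_le (t e a : R) : 0 <= t -> 0 <= e <= 1 -> 0 <= a ->
  (t + e) `^ a <= 2 `^ a * (1 + t `^ a).
Proof.
move=> t0 /andP[e0 e1] a0.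
have mono (x y : R) : 0 <= x -> x <= y -> x `^ a <= y `^ a.
  by move=> x0 xy; apply: ge0_ler_powR; rewrite ?nnegrE// (le_trans x0).
have [t1|t1] := leP t 1.
  apply: (@le_trans _ _ (2 `^ a)); first by apply: mono; lra.
  by rewrite ler_peMr ?powR_ge0// lerDl powR_ge0.
apply: (@le_trans _ _ ((2 * t) `^ a)); first by apply: mono; lra.
by rewrite powRM// ler_wpM2l ?powR_ge0// lerDr.
Qed.

End truncation_limit.

(** * Passage to the limit in the truncation *)

Section energy_limit.
Context dT (T : measurableType dT) (R : realType) (mu : {measure set T -> \bar R}).

Lemma Rintegral_dominated_cvg (D : set T) (f_ : nat -> T -> R) (f G : T -> R) : measurable D ->
  (forall k, measurable_fun D (f_ k)) -> measurable_fun D f ->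
  (forall x, D x -> f_ ^~ x @ \oo --> f x) -> mu.-integrable D (EFin \o G) ->
  (forall k x, D x -> `|f_ k x| <= G x) ->
  mu.-integrable D (EFin \o f) /\
  (fun k => \int[mu]_(x in D) f_ k x) @ \oo --> \int[mu]_(x in D) f x.
Proof.
move=> mD mf_ mf ff iG fG.
have [||||if_ _ H] := @dominated_convergence _ _ _ mu D mD
   (fun k x => (f_ k x)%:E) (fun x => (f x)%:E) (fun x => (G x)%:E) (fun k => proj2 (measurable_EFinP _ _) (mf_ k)).
- exact/measurable_EFinP.
- by apply: aeW => x Dx; apply: cvg_EFin; [exact: nearW|exact: ff].
- exact: iG.
- by apply: aeW => x k Dx; rewrite /= lee_fin; exact: fG.
split=> //; move: H; rewrite (_ : (\int[mu]_(x in D) (f x)%:E)%E = (\int[mu]_(x in D) f x)%:E).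
  exact: fine_cvg.
by rewrite /Rintegral fineK//; exact: integrable_fin_num.
Qed.

Variables (D : set T) (q r : R) (rho u a b : T -> R) (e : R -> T -> R) (Cu Ca : R).
Hypotheses (mD : measurable D) (muD : (mu D < +oo)%E) (q1 : -1 < q)
  (mrho : measurable_fun D rho) (rho0 : forall x, D x -> 0 <= rho x)
  (m_u : measurable_fun D u) (uC : forall x, D x -> `|u x| <= Cu)
  (m_a : measurable_fun D a) (aC : forall x, D x -> `|a x| <= Ca)
  (iA : mu.-integrable D (EFin \o (fun x => rho x `^ q * b x ^+ 2)))
  (iB : mu.-integrable D (EFin \o (fun x => rho x `^ (2 + q))))
  (he : forall d, 0 < d <= 1 -> mu.-integrable D (EFin \o e d) /\ \int[mu]_(x in D) e d x <= 0)
  (hp : forall d, 0 < d <= 1 -> forall x, D x ->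
    2^-1 * u x ^+ 2 * (trunc' q d (rho x) * b x ^+ 2) <=
    e d x + 2 * r ^+ 2 * ((rho x + d) `^ (2 + q) / (1 + q) ^+ 2) * a x ^+ 2).

Let sqr_le (x C : R) : `|x| <= C -> x ^+ 2 <= C ^+ 2.
Proof.
move=> xC; rewrite -(real_normK (num_real x)) ler_sqr ?nnegrE//.
exact: le_trans xC.
Qed.

(** [a] stands for F*(Du), [b] for F*(Drho) and [e d] for the energy at truncation level [d]. On the
    left the integrands are replaced by smaller ones that converge under domination; on the right
    domination holds because [a] is bounded, [D] has finite measure and rho^(2+q) is integrable. *)
Lemma energy_limit : [/\ mu.-integrable D (EFin \o (fun x => rho x `^ q * b x ^+ 2 * u x ^+ 2)),
  mu.-integrable D (EFin \o (fun x => rho x `^ (2 + q) * a x ^+ 2)) &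
  2^-1 * \int[mu]_(x in D) (rho x `^ q * b x ^+ 2 * u x ^+ 2) <=
  2 * r ^+ 2 / (1 + q) ^+ 2 * \int[mu]_(x in D) (rho x `^ (2 + q) * a x ^+ 2)].
Proof.
pose A x := rho x `^ q * b x ^+ 2; pose d k : R := harmonic k.
have d01 k : 0 < d k <= 1.
  by rewrite /d /harmonic/= invr_gt0 ltr0n/= invf_le1 ?ltr0n// ler1n.
have A0 x : 0 <= A x by rewrite mulr_ge0 ?powR_ge0 ?sqr_ge0.
have mA : measurable_fun D A by have /measurable_EFinP := measurable_int _ iA.
have mpow (p : R) : measurable_fun D (fun x => rho x `^ p).
  by apply: (measurableT_comp (measurable_powR p)).
(* the minimum with 1 makes [A] a dominating function *)
pose f k x := A x * u x ^+ 2 * Num.min (trunc' q (d k) (rho x) * rho x `^ (- q)) 1.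
have mAu : measurable_fun D (fun x => A x * u x ^+ 2).
  by apply: measurable_funM => //; exact: measurable_funX.
have mf k : measurable_fun D (f k).
  apply: measurable_funM => //; apply: measurable_minr => //; apply: measurable_funM => //.
  by apply: (measurableT_comp (measurable_trunc' q (d k))).
have cf x : D x -> f ^~ x @ \oo --> A x * u x ^+ 2.
  move=> Dx; rewrite -[X in _ --> X]mulr1 /f.
  have [Ax|Ax] := eqVneq (rho x `^ q) 0.
    by rewrite /A Ax !mul0r; under eq_fun do rewrite !mul0r; exact: cvg_cst.
  apply: cvgM; first exact: cvg_cst.
  have E1 : rho x `^ q * rho x `^ (- q) = 1 by rewrite powRN mulfV.
  (* A power of 0 is 0 unless q = 0, so a nonzero value of rho^q excludes rho = 0 when q is
     nonzero. *)
  have H : 0 < rho x \/ q = 0.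
    have [->|q0] := eqVneq q 0; first by right.
    by left; rewrite lt0r rho0// andbT; apply: contraNneq Ax => ->; rewrite powR0.
  have c : (fun k => trunc' q (d k) (rho x) * rho x `^ (- q)) @ \oo --> (1 : R).
    rewrite -[X in _ --> X]E1; apply: cvgM; last exact: cvg_cst.
    exact: (cvg_trunc' q1 (rho0 Dx) H).
  have cm : {for 1, continuous (fun t : R => Num.min t 1)}.
    by apply: (@continuous_min R R (fun t => t) (cst 1)); [exact: cvg_id|exact: cvg_cst].
  by have := cvg_comp _ _ c cm; rewrite minxx.
have fA k x : D x -> `|f k x| <= A x * Cu ^+ 2.
  move=> Dx; have Au0 : 0 <= A x * u x ^+ 2 by apply: mulr_ge0 => //; exact: sqr_ge0.
  have m0 : 0 <= Num.min (trunc' q (d k) (rho x) * rho x `^ (- q)) 1.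
    by rewrite le_min ler01 andbT mulr_ge0 ?powR_ge0// mulr_ge0 ?powR_ge0.
  rewrite ger0_norm; last exact: mulr_ge0.
  rewrite -[leRHS]mulr1; apply: ler_pM => //; last by rewrite ge_min lexx orbT.
  by rewrite ler_wpM2l// sqr_le// uC.
have iAC : mu.-integrable D (EFin \o (fun x => A x * Cu ^+ 2)).
  rewrite (_ : (fun x => _) = fun x => Cu ^+ 2 * A x); first exact: (integrable_EFinZ (Cu ^+ 2) mD iA).
  by apply/funext => x; rewrite mulrC.
have [iAu cAu] := Rintegral_dominated_cvg mD mf mAu cf iAC fA.
have q2 : 1 <= 2 + q by rewrite (_ : 2 = 1 + 1 :> R)// -addrA lerDl -lerBlDl sub0r ltW.
pose c k x := (rho x + d k) `^ (2 + q) * a x ^+ 2.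
have mc k : measurable_fun D (c k).
  apply: measurable_funM; last exact: measurable_funX.
  by apply: (measurableT_comp (measurable_powR _)); exact: measurable_funD.
have mB : measurable_fun D (fun x => rho x `^ (2 + q) * a x ^+ 2).
  by apply: measurable_funM => //; exact: measurable_funX.
have cc x : D x -> c ^~ x @ \oo --> rho x `^ (2 + q) * a x ^+ 2.
  move=> Dx; apply: cvgM; last exact: cvg_cst.
  by apply: cvg_shift_powR; [exact: rho0|right; right].
have iG : mu.-integrable D (EFin \o (fun x => 2 `^ (2 + q) * Ca ^+ 2 * (1 + rho x `^ (2 + q)))).
  apply: (integrable_EFinZ _ mD); apply: (integrable_EFinD mD) => //.
  apply/integrableP; split; first exact/measurable_EFinP.
  rewrite (_ : (\int[_]_(x in _) _)%E = (\int[mu]_(x in D) cst 1 x)%E).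
    by rewrite integral_cst// mul1e.
  by apply: eq_integral => x _ /=; rewrite normr1.
have q20 : 0 <= 2 + q by exact: le_trans q2.
have cG k x : D x -> `|c k x| <= 2 `^ (2 + q) * Ca ^+ 2 * (1 + rho x `^ (2 + q)).
  move=> Dx; have a0 : 0 <= a x ^+ 2 by exact: sqr_ge0.
  rewrite ger0_norm; last exact: (mulr_ge0 (powR_ge0 _ _) a0).
  rewrite mulrAC; apply: ler_pM => //; first exact: powR_ge0.
    by have /andP[dk0 dk1] := d01 k; apply: shift_powR_le; rewrite ?rho0 ?(ltW dk0).
  by rewrite sqr_le// aC.
have [iBa cBa] := Rintegral_dominated_cvg mD mc mB cc iG cG.
split => //.
pose kap := 2 * r ^+ 2 / (1 + q) ^+ 2.
have ic k : mu.-integrable D (EFin \o c k).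
  exact: (integrable_EFin_le mD (mc k) (cG k) iG).
have if_ k : mu.-integrable D (EFin \o f k).
  exact: (integrable_EFin_le mD (mf k) (fA k) iAC).
have step k : 2^-1 * \int[mu]_(x in D) f k x <= kap * \int[mu]_(x in D) c k x.
  have [ie e0] := he (d01 k).
  rewrite -!RintegralZl//; apply: (@le_trans _ _ (\int[mu]_(x in D) (e (d k) x + kap * c k x))).
    apply: le_Rintegral => //.
    - exact: (integrable_EFinZ _ mD (if_ k)).
    - by apply: (integrable_EFinD mD ie); exact: (integrable_EFinZ _ mD (ic k)).
    move=> x Dx; apply: le_trans (_ : 2^-1 * u x ^+ 2 * (trunc' q (d k) (rho x) * b x ^+ 2) <= _).
      have t0 := ltW (trunc'_gt0 q (proj1 (andP (d01 k))) (rho0 Dx)).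
      (* The product is 1 or, where rho^q = 0, it is 0; hence [f k] never exceeds the integrand
         formed with [trunc']. *)
      have PY : rho x `^ q * rho x `^ (- q) <= 1.
        by rewrite powRN; have [->|h] := eqVneq (rho x `^ q) 0; rewrite ?mul0r// mulfV.
      have P0 := powR_ge0 (rho x) q.
      have := sqr_ge0 (b x); have := sqr_ge0 (u x); rewrite /f /A.
      have : Num.min (trunc' q (d k) (rho x) * rho x `^ (- q)) 1 <= trunc' q (d k) (rho x) * rho x `^ (- q).
        by rewrite ge_min lexx.
      move: PY P0 t0; move: (trunc' _ _ _) (rho x `^ q) (rho x `^ (- q)) (Num.min _ _) (b x ^+ 2) (u x ^+ 2).
      move=> X P Y mi b2 u2 PY P0 X0 mX u20 b20.
      apply: (@le_trans _ _ (2^-1 * (P * b2 * u2 * (X * Y)))).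
        by rewrite ler_pM2l ?invr_gt0// ler_wpM2l// mulr_ge0// mulr_ge0.
      have -> : 2^-1 * (P * b2 * u2 * (X * Y)) = (P * Y) * (2^-1 * u2 * (X * b2)) by ring.
      by rewrite -[leRHS]mul1r ler_wpM2r// !mulr_ge0 ?invr_ge0.
    have := hp (d01 k) Dx; rewrite /kap /c => h; apply: le_trans h _.
    by rewrite lerD2l le_eqVlt; apply/orP; left; apply/eqP; ring.
  rewrite RintegralD//; last exact: (integrable_EFinZ _ mD (ic k)).
  by rewrite gerDr.
have c1 : (fun k => 2^-1 * \int[mu]_(x in D) f k x) @ \oo -->
    2^-1 * \int[mu]_(x in D) (rho x `^ q * b x ^+ 2 * u x ^+ 2).
  by apply: cvgM; [exact: cvg_cst|exact: cAu].
have c2 : (fun k => kap * \int[mu]_(x in D) c k x) @ \oo -->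
    kap * \int[mu]_(x in D) (rho x `^ (2 + q) * a x ^+ 2).
  by apply: cvgM; [exact: cvg_cst|exact: cBa].
exact: (ler_cvg_to c1 c2 (nearW _ step)).
Qed.

End energy_limit.

(** * Changing rho on a null set *)

Section modification.
Context {R : realType} {n : nat} {M : manifold R n}.
Variables (m : {measure set (borel M) -> \bar R}) (Omega N : set M).
Hypotheses (hm : smooth_measure m) (oO : open Omega)
  (mN : measurable (N : set (borel M))) (N0 : m (N : set (borel M)) = 0%E).
Local Notation lambda := (lebesgue_rV R n).

(** rho is nonnegative only almost everywhere, whereas the truncations are controlled only on
    nonnegative values. The null set stays null in every chart, so weak derivatives, being tested by
    integrals, are unaffected. *)
Lemma W12loc_modify (rho : M -> R) (Drho : forall x, cotangent x) :
  W12loc Omega rho Drho -> W12loc Omega (fun x => if x \in N then 0 else rho x) Drho.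
Proof.
move=> hW c hc; have hc' := atlas_chart hc; have [mf f2 aP] := hW c hc.
set U := cmap c @` (cdom c `&` Omega) in mf f2 aP *.
set f := rho \o cinv c in mf f2 aP; set f' := _ \o cinv c.
have oU : open U by exact: open_cimage_setI.
have mU : measurable (U : set (borel 'rV[R]_n)) by exact: borel_open.
pose Z : set (borel 'rV[R]_n) := cmap c @` (cdom c `&` N).
have mZ : measurable Z by exact: measurable_cimage.
have Z0 : lambda Z = 0%E.
  apply/(negligibleP (lambda : measure _ _) mZ); apply: (negligible_cimage hm hc).
  exact/negligibleP.
have ZE p : U p -> (cinv c p \in N) = (p \in Z).
  rewrite /Z /U !cimage_setI// => -[Up _].
  by apply/idP/idP; rewrite !inE; [move=> Np|case].
have f'E p : U p -> f' p = if p \in Z then 0 else f p.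
  by move=> Up; rewrite /f' /= ZE.
have mf' : measurable_fun (U : set (borel 'rV[R]_n)) f'.
  apply: (eq_measurable_fun (f \_ (~` Z))).
    move=> p; rewrite inE => Up; rewrite f'E// patchE in_setC.
    by case: (p \in Z).
  apply: (proj1 (measurable_restrict _ (measurableC mZ) mU)).
  by apply: measurable_funS mf => //; exact: subIsetl.
have le p : U p -> `|f' p| <= `|f p|.
  by move=> Up; rewrite f'E//; case: ifP; rewrite ?normr0.
split=> //.
  move=> K cK KU; have mK : measurable (K : set (borel 'rV[R]_n)).
    by apply: borel_compact => //; exact: norm_hausdorff.
  pose k (p : borel 'rV[R]_n) : R := f' p ^+ 2; pose k0 (p : borel 'rV[R]_n) : R := f p ^+ 2.
  apply: (@integrable_EFin_le _ _ _ lambda K k k0 mK); last exact: f2.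
    by apply: measurable_funX; apply: measurable_funS mf'.
  move=> p /KU Up; rewrite /k /k0 ger0_norm ?sqr_ge0//.
  by rewrite -(real_normK (num_real (f' p))) -(real_normK (num_real (f p))) ler_sqr ?nnegrE// le.
move=> i; have [ma a2 wk] := aP i; split=> // psi tpsi; rewrite -wk//.
have mdpsi : measurable_fun (U : set (borel 'rV[R]_n)) (partial i psi).
  apply: measurable_funTS; apply: continuous_measurable_rV.
  exact: (test_function_continuous (test_function_partial i tpsi)).
apply: ae_eq_integral => //.
- by apply/measurable_EFinP; exact: measurable_funM.
- by apply/measurable_EFinP; exact: measurable_funM.
exists Z; split=> // p /= H; apply: contrapT => Zp; apply: H => Up.
by rewrite f'E// memNset.
Qed.

Lemma integral_support (K : set M) (f : M -> R) : K `<=` Omega -> (forall x, ~ K x -> f x = 0) ->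
  (\int[m]_(x in (Omega : set (borel M))) (f x)%:E = \int[m]_(x in (K : set (borel M))) (f x)%:E)%E.
Proof.
move=> KO f0; rewrite integral_mkcond [RHS]integral_mkcond; congr (integral _ _ _).
apply/funext => x; rewrite !patchE; case: (boolP (x \in Omega)) => xO; case: (boolP (x \in K)) => xK //.
  by rewrite f0// => Kx; move: xK; rewrite mem_set.
by move: xO; rewrite mem_set//; apply: KO; rewrite inE in xK.
Qed.

End modification.

(** * Reversibility and the pointwise estimate *)

Section reversibility_bound.
Context {R : realType} {n : nat} {M : manifold R n}.
Variable F : forall x : M, tangent x -> R.
Hypotheses (hF : finsler_structure F) (revF : (reversibility F < +oo)%E).
Local Notation r := (fine (reversibility F)).
Hypothesis r0 : r != 0.

Let Fgt0 x (y : 'rV[R]_n) : y != 0 -> 0 < @F x y.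
Proof. exact: minkowski_gt0 (F_minkowski hF x). Qed.

Let ratio_le x (y : 'rV[R]_n) : y != 0 -> @F x y / @F x (- y) <= r.
Proof.
move=> y0; have H : ((@F x y / @F x (- y))%:E <= reversibility F)%E.
  by apply: ereal_sup_ubound; exists x, y.
by move: H revF; case: (reversibility F).
Qed.

(** A nonzero [r] forces a nonzero tangent vector, since the supremum of the empty set is -oo, whose
    finite part is 0. The ratios for [y] and for [- y] are inverse to each other, so one of them is
    at least 1. *)
Lemma reversibility_ge1 : 1 <= r.
Proof.
have [x [y y0]] : exists (x : M) (y : 'rV[R]_n), y != 0.
  apply: contrapT => H; move: r0; rewrite /reversibility (_ : [set _ | _] = set0).
    by rewrite ereal_sup0 eqxx.
  by apply/seteqP; split => [z [x [y [y0 _]]]|//]; apply: H; exists x, y.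
have yN0 : - y != 0 by rewrite oppr_eq0.
have p1 := Fgt0 x y0; have p2 := Fgt0 x yN0.
have h1 := ratio_le x y0; have h2 := ratio_le x yN0; rewrite opprK in h2.
have [le|lt] := leP (@F x (- y)) (@F x y).
  by apply: le_trans h1; rewrite ler_pdivlMr// mul1r.
by apply: le_trans h2; rewrite ler_pdivlMr// mul1r ltW.
Qed.

Lemma reversibility_le x (y : 'rV[R]_n) : @F x (- y) <= r * @F x y.
Proof.
have [->|y0] := eqVneq y 0.
  by rewrite oppr0 (minkowski0 (F_minkowski hF x)) mulr0.
have yN0 : - y != 0 by rewrite oppr_eq0.
by have := ratio_le x yN0; rewrite opprK ler_pdivrMr ?Fgt0.
Qed.

(** For s >= 0 the covector is evaluated at minus the gradient, which costs the factor [r]; for s <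
    0 no sign has to be turned, and r >= 1 weakens the bound to the same form. *)
Lemma pairing_gradient_ge x (s : R) (alpha beta : cotangent x) :
  - (s * pairing beta (legendre F alpha)) <= `|s| * r * polar F beta * polar F alpha.
Proof.
have b0 := polar_ge0 hF beta; have a0 := polar_ge0 hF alpha.
have r1 := reversibility_ge1.
have ba0 : 0 <= polar F beta * polar F alpha by exact: mulr_ge0.
have [s0|s0] := leP 0 s.
  rewrite ger0_norm// -mulrN -!mulrA ler_wpM2l//.
  have -> : - pairing beta (legendre F alpha) = pairing beta (- (legendre F alpha : 'rV[R]_n) : tangent x).
    by rewrite /pairing mulNmx [RHS]mxE.
  apply: le_trans (pairing_le hF beta _) _.
  rewrite mulrCA ler_wpM2l// [polar F alpha](polarE hF); exact: reversibility_le.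
rewrite ltr0_norm// -mulNr -!mulrA ler_wpM2l ?oppr_ge0 ?(ltW s0)//.
apply: le_trans (pairing_le hF beta _) _; rewrite -(polarE hF).
by rewrite ler_peMl.
Qed.

Lemma energy_pointwise (rho u : M -> R) (Drho : forall x, cotangent x) (q d : R) x :
  -1 < q -> 0 < d -> smooth_fun u -> 0 <= rho x ->
  2^-1 * u x ^+ 2 * (trunc' q d (rho x) * polar F (Drho x) ^+ 2) <=
  energy F rho Drho (trunc q d) (trunc' q d) (fun x => u x ^+ 2) x +
  2 * r ^+ 2 * ((rho x + d) `^ (2 + q) / (1 + q) ^+ 2) * polar F (differential u x) ^+ 2.
Proof.
move=> q1 d0 su rho0; rewrite /energy differential_sqr//.
have G := trunc_sqr q d0 rho0; have g'0 := trunc'_gt0 q d0 rho0.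
have g0 := trunc_ge0 d q1 (rho x).
have H := pairing_gradient_ge (u x) (Drho x) (differential u x).
have -> : pairing (2 * u x *: (differential u x : 'cV[R]_n) : cotangent x) (gradient F Drho x) =
    2 * (u x * pairing (differential u x) (legendre F (Drho x))).
  by rewrite /pairing -scalemxAr mxE mulrA.
rewrite -[u x ^+ 2]real_normK ?num_real//.
move: G g'0 g0 H; move: (trunc' q d (rho x)) (trunc q d (rho x)) (_ / (1 + q) ^+ 2) => g' g h.
move: (u x * pairing _ _) (polar F (Drho x)) (polar F (differential u x)) `|u x| => P b a X G g'0 g0 H.
(* Here X = |u|, a = F*(Du), b = F*(Drho) and g^2 = g' h. Half of this square, divided by g' > 0, is
   exactly the expression in [K]. *)
have E : 0 <= (X * g' * b - 2 * r * g * a) ^+ 2 by exact: sqr_ge0.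
have gP := ler_wpM2l g0 H.
have K : 0 <= 2^-1 * X ^+ 2 * (g' * b ^+ 2) - 2 * (g * (X * r * a * b)) + 2 * r ^+ 2 * h * a ^+ 2.
  rewrite -(pmulr_rge0 _ g'0).
  have -> : g' * (2^-1 * X ^+ 2 * (g' * b ^+ 2) - 2 * (g * (X * r * a * b)) + 2 * r ^+ 2 * h * a ^+ 2) =
     2^-1 * (X * g' * b) ^+ 2 - 2 * g * g' * X * r * a * b + 2 * r ^+ 2 * (g' * h) * a ^+ 2 by ring.
  rewrite -G (_ : _ + _ = 2^-1 * (X * g' * b - 2 * r * g * a) ^+ 2); first by rewrite mulr_ge0// invr_ge0.
  by field.
move: K gP; lra.
Qed.

End reversibility_bound.

Unset Implicit Arguments.

(* At points where rho vanishes, rho `^ q is 0 (or 1 if q = 0), so the product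
   below is 0 where moreover Drho = 0. *)
Theorem corollary3p3 (R : realType) (n : nat) (M : manifold R n)
    (F : forall x : M, tangent x -> R)
    (m : {measure set (borel M) -> \bar R})
    (Omega : set M) (rho : M -> R) (Drho : forall x : M, cotangent x) (q : R) :
  connected [set: M] ->
  finsler_structure F ->
  finsler_complete F ->
  smooth_measure m ->
  (reversibility F < +oo)%E ->
  open Omega ->
  W12loc Omega rho Drho ->
  {ae m, forall x, Omega x -> 0 <= rho x} ->
  laplacian_ge0 F m Omega Drho ->
  -1 < q ->
  L1loc m Omega (fun x => rho x `^ q * polar F (Drho x) ^+ 2) ->
  L1loc m Omega (fun x => rho x `^ (2 + q)) ->
  forall u : M -> R, C0infty Omega u ->
  (((1 + q) ^+ 2 / (4 * fine (reversibility F) ^+ 2))%:E *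
     \int[m]_(x in (Omega : set (borel M)))
        (rho x `^ q * polar F (Drho x) ^+ 2 * u x ^+ 2)%:E <=
   \int[m]_(x in (Omega : set (borel M)))
        (rho x `^ (2 + q) * F x (gradient F (differential u) x) ^+ 2)%:E)%E.
Proof.
move=> _ hF _ hm revF oO hW hae hL q1 LA LB u uC.
have [su cK KO] := uC; set K := tsupport u in cK KO.
set r := fine (reversibility F).
(* this happens for n = 0 only: the supremum is then -oo, and 1 / 0 = 0 *)
have [r0|r0] := eqVneq r 0.
  rewrite r0 expr0n/= mulr0 invr0 mulr0 mul0e; apply: integral_ge0 => x _.
  by rewrite lee_fin mulr_ge0 ?powR_ge0 ?sqr_ge0.
have r1 : 1 <= r by exact: reversibility_ge1.
have [N [mN N0 NP]] := hae.
have rhoN x : Omega x -> ~ N x -> 0 <= rho x.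
  by move=> Ox Nx; apply: contrapT => h; apply: Nx; apply: NP => /(_ Ox).
(* rho is set to 0 on a null set containing all points of Omega where it is negative. *)
pose rho' x := if x \in N then 0 else rho x.
have rho'0 x : Omega x -> 0 <= rho' x.
  move=> Ox; rewrite /rho'; case: ifPn => // Nx; apply: rhoN => //.
  by move=> h; move: Nx; rewrite mem_set.
have hW' : W12loc Omega rho' Drho by exact: W12loc_modify hm oO mN N0 _ _ hW.
have mK : measurable (K : set (borel M)) by apply: borel_compact => //; exact: manifold_hausdorff.
have mO : measurable (Omega : set (borel M)) by exact: borel_open.
(* The limit is taken on the support of [u] without the null set: there rho' = rho >= 0, and the
   measure is finite. *)
pose D : set (borel M) := K `\` N.
have mD : measurable D by exact: measurableD.
have DK : D `<=` K by move=> x [].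
have DO : D `<=` Omega by move=> x /DK/KO.
have rho'E x : D x -> rho' x = rho x by move=> [_ Nx]; rewrite /rho' memNset.
have muD : (m D < +oo)%E.
  apply: le_lt_trans (compact_finite_measure hm cK).
  by apply: le_measure; rewrite ?inE.
have iB : m.-integrable (K : set (borel M)) (EFin \o (fun x => rho x `^ (2 + q))) by exact: LB.
have iA : m.-integrable (K : set (borel M)) (EFin \o (fun x => rho x `^ q * polar F (Drho x) ^+ 2)).
  exact: LA.
have rhoD x : D x -> 0 <= rho x by move=> [Kx Nx]; apply: rhoN => //; exact: KO.
(* Measurability of rho on [D] is recovered from that of rho^(2+q) by taking a root, 2 + q being
   positive. *)
have mrho : measurable_fun D (rho : borel M -> R).
  have mB : measurable_fun D (fun x : borel M => rho x `^ (2 + q)).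
    by have /measurable_EFinP mB := measurable_int _ iB; apply: measurable_funS mB.
  have q2 : 2 + q != 0 by rewrite gt_eqF// (_ : 2 = 1 + 1 :> R)// -addrA ltr_wpDl// -ltrBlDl sub0r.
  apply: (eq_measurable_fun (fun x : borel M => (rho x `^ (2 + q)) `^ (2 + q)^-1)).
    by move=> x; rewrite inE => Dx; rewrite -powRrM mulfV// powRr1// rhoD.
  exact: (measurableT_comp (measurable_powR _) mB).
pose a (x : borel M) : R := polar F (differential u x).
have ca : continuous (fun x : M => polar F (differential u x)).
  by move=> x; exact: (polar_differential_continuous hF).
have mcont (f : M -> R) : continuous f -> measurable_fun setT (f : borel M -> R).
  by move=> cf; apply: (continuous_borel_real openT) => x _; exact: cf.
have bounded (f : M -> R) : continuous f -> exists C, forall x, K x -> `|f x| <= C.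
  by move=> cf; apply: compact_continuous_bounded => //; exact: continuous_subspaceT.
have cu := smooth_fun_continuous su.
have [Cu CuP] := bounded _ cu.
have [Ca CaP] := bounded _ ca.
pose e d : borel M -> R := energy F rho' Drho (trunc q d) (trunc' q d) (fun x => u x ^+ 2).
have out x : ~ K x -> u x = 0 by exact: tsupport_out.
have he d : 0 < d <= 1 -> m.-integrable D (EFin \o e d) /\ \int[m]_(x in D) e d x <= 0.
  (* A common bound for [trunc] and [trunc']: the sum of their separate bounds. *)
  move=> /andP[d0 d1]; pose C := (1 + q)^-1 / d + (d `^ q + d^-1).
  have q10 : 0 <= (1 + q)^-1 by rewrite invr_ge0 -lerBlDl sub0r ltW.
  have dq : 0 <= d `^ q + d^-1 by rewrite addr_ge0 ?powR_ge0// invr_ge0 ltW.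
  have [ie le0] : m.-integrable (Omega : set (borel M)) (EFin \o e d) /\
      \int[m]_(x in (Omega : set (borel M))) e d x <= 0.
    apply: (energy_sqr_le0 hF hm oO hW' rho'0 hL (C := C)); last exact: uC.
    - by move=> f sf f0; exact: smooth_on_trunc.
    - by move=> t; exact: is_derive_trunc.
    - by move=> t; exact: trunc'_continuous.
    - move=> t t0; rewrite trunc_ge0//= (le_trans (trunc_le q1 d0 t))//.
      by rewrite lerDl.
    - move=> t t0; rewrite gtr0_norm ?trunc'_gt0// (le_trans (trunc'_le q d0 d1 t0))//.
      by rewrite lerDr mulr_ge0// invr_ge0 ltW.
  have e0 x : ~ K x -> e d x = 0.
    move=> Kx; rewrite /e /energy differential_sqr// (out x Kx) mulr0 scale0r /pairing.
    by rewrite mulmx0 mxE mulr0 expr0n/= mul0r addr0.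
  have iK : m.-integrable (K : set (borel M)) (EFin \o e d).
    exact: (integrableS mO mK KO ie).
  split; first exact: (integrableS mK mD DK iK).
  move: le0; rewrite /Rintegral (integral_support m KO e0).
  by rewrite (negligible_integral mN mK iK N0).
have hp d : 0 < d <= 1 -> forall x, D x ->
    2^-1 * u x ^+ 2 * (trunc' q d (rho x) * polar F (Drho x) ^+ 2) <=
    e d x + 2 * r ^+ 2 * ((rho x + d) `^ (2 + q) / (1 + q) ^+ 2) * a x ^+ 2.
  move=> /andP[d0 _] x Dx; rewrite -(rho'E x Dx); apply: energy_pointwise => //.
  by apply: rho'0; exact: DO.
have mu_ : measurable_fun D (u : borel M -> R) by apply: measurable_funTS; exact: mcont.
have ma : measurable_fun D a by apply: measurable_funTS; exact: mcont.
have [iAu iBa main] := energy_limit mD muD q1 mrho rhoD mu_ (fun x Dx => CuP x (DK x Dx)) ma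
  (fun x Dx => CaP x (DK x Dx)) (integrableS mK mD DK iA) (integrableS mK mD DK iB) he hp.
(* Both integrands of the statement vanish off [K], and the null set is negligible, so the integrals
   over Omega are finite integrals over [D]. *)
have reduce (f : borel M -> R) : (forall x, ~ K x -> f x = 0) -> (forall x, 0 <= f x) ->
    measurable_fun (K : set (borel M)) f -> m.-integrable D (EFin \o f) ->
    (\int[m]_(x in (Omega : set (borel M))) (f x)%:E = (\int[m]_(x in D) f x)%:E)%E.
  move=> f0 fge mf jf; rewrite (integral_support m KO f0).
  rewrite (ge0_negligible_integral mN mK _ _ N0).
  - by rewrite /Rintegral fineK//; exact: integrable_fin_num.
  - exact/measurable_EFinP.
  - by move=> x _; rewrite lee_fin.
have muK (f : M -> R) : continuous f -> measurable_fun (K : set (borel M)) (f : borel M -> R).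
  by move=> cf; apply: measurable_funTS; exact: mcont.
rewrite (reduce (fun x => rho x `^ q * polar F (Drho x) ^+ 2 * u x ^+ 2)) //; last 3 first.
- by move=> x Kx; rewrite out// expr0n/= mulr0.
- by move=> x; exact: (mulr_ge0 (mulr_ge0 (powR_ge0 _ _) (sqr_ge0 _)) (sqr_ge0 _)).
- apply: measurable_funM; first by have /measurable_EFinP := measurable_int _ iA.
  by apply: measurable_funX; exact: muK.
have -> : (\int[m]_(x in (Omega : set (borel M))) (rho x `^ (2 + q) * F x (gradient F (differential u) x) ^+ 2)%:E =
   \int[m]_(x in (Omega : set (borel M))) (rho x `^ (2 + q) * a x ^+ 2)%:E)%E.
  by apply: eq_integral => x _; rewrite /a (polarE hF).
rewrite (reduce (fun x => rho x `^ (2 + q) * a x ^+ 2)) //; last 3 first.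
- by move=> x Kx; rewrite /a differential_out// (polar0 hF) expr0n/= mulr0.
- by move=> x; exact: (mulr_ge0 (powR_ge0 _ _) (sqr_ge0 _)).
- apply: measurable_funM; first by have /measurable_EFinP := measurable_int _ iB.
  by apply: measurable_funX; exact: muK.
rewrite -EFinM lee_fin.
suff scale (I J : R) : 2^-1 * I <= 2 * r ^+ 2 / (1 + q) ^+ 2 * J ->
    (1 + q) ^+ 2 / (4 * r ^+ 2) * I <= J by exact: scale.
have q10 : 0 < 1 + q by rewrite -ltrBlDl sub0r.
(* This factor clears the constant on the right and turns the 1/2 on the left into the constant of
   the statement. *)
have k0 : 0 < (1 + q) ^+ 2 / (2 * r ^+ 2).
  by rewrite divr_gt0 ?exprn_gt0 ?mulr_gt0 ?exprn_gt0 ?(lt_le_trans ltr01 r1).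
rewrite -(ler_pM2l k0).
rewrite (_ : _ * (2^-1 * I) = (1 + q) ^+ 2 / (4 * r ^+ 2) * I); last by field.
rewrite (_ : _ * (_ * J) = J)//; field.
by rewrite r0 (gt_eqF q10).
Qed.
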